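(* Let $(\Omega,\mathcal{B},\mu,\sigma,X,\|\cdot\|,L)$ be either a strongly measurable random dynamical system or a $\mu$-continuous random dynamical system, such that $\log^+\|L(1,\cdot)\|\in L^1(\mu)$. Let $\mathcal{C}\subset X$ be a nice cone such that $L(1,\omega)\mathcal{C}\subset\mathcal{C}$ for all $\omega$. Suppose that there exist a positive measure subset $G_P$ of $\Omega$, a positive integer $k_P$, and a positive real number $D_P$ such that for all $\omega\in G_P$, $\operatorname{diam}_\theta(L(k_P,\omega)\mathcal{C})\le D_P$. Then there exists a $\sigma$-invariant set of full measure $\tilde\Omega\subset\Omega$ on which the following statements are true: (1) There exist a unique function $v:\tilde\Omega\to\mathcal{C}$ and a positive measurable function $\phi:\tilde\Omega\to\mathbb{R}_{>0}$ such that $\|v(\omega)\|=1$, $\log^+(\phi)\in L^1(\mu)$, and $L(1,\omega)v(\omega)=\phi(\omega)v(\sigma(\omega))$. (2) There exists a family of bounded linear functionals $\omega\mapsto\eta(\omega,\cdot):\tilde\Omega\to X^*$ such that $\eta(\omega,\cdot)$ is strictly positive with respect to $\mathcal{C}$; $\eta(\sigma(\omega),L(1,\omega)x)=\phi(\omega)\eta(\omega,x)$ for all $x\in X$ and $\omega\in\tilde\Omega$; and $\eta(\omega,v(\omega))=1$. Thus $X=\operatorname{span}_{\mathbb{R}}\{v(\omega)\}\oplus\ker(\eta(\omega,\cdot))$ is an equivariant decomposition of $X$ with respect to $L(n,\omega)$, and $\pi_\omega:X\to X$ given by $\pi_\omega(x)=\eta(\omega,x)v(\omega)$ is the continuous projection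 onto $\operatorname{span}_{\mathbb{R}}\{v(\omega)\}$ (with kernel $\ker(\eta(\omega,\cdot))$). (3) If the system is strongly measurable, then: $v$ is measurable from $\mathcal{B}$ to the Borel $\sigma$-algebra of $\|\cdot\|$; $\eta(\omega,\cdot)$ is strongly measurable; the projection operators $\pi_\omega$ and $I-\pi_\omega$ are strongly measurable; and $\omega\mapsto\operatorname{span}_{\mathbb{R}}\{v(\omega)\}$ is measurable from $\mathcal{B}$ to the Borel $\sigma$-algebra of the Grassmannian metric $d$. If the system is $\mu$-continuous, then: $v$ is $\mu$-continuous with respect to $\|\cdot\|_X$; $\eta(\omega,\cdot)$ is $\mu$-continuous with respect to $\|\cdot\|_{X^*}$; $\pi_\omega$ and $I-\pi_\omega$ are $\mu$-continuous with respect to the operator norm; and $\operatorname{span}_{\mathbb{R}}\{v(\omega)\}$ and $\ker(\eta(\omega,\cdot))$ are $\mu$-continuous with respect to the distance $d$ on the Grassmannian. (4) The Lyapunov exponent for $v(\omega)$ is $$\lim_{n\to\infty}\frac1n\log\|L(n,\omega)v(\omega)\|=\lim_{n\to\infty}\frac1n\sum_{i=0}^{n-1}\log(\phi(\sigma^i(\omega)))=\lambda_1=\lim_{n\to\infty}\frac1n\log\|L(n,\omega)\|,$$ where $\lambda_1$ is the maximal Lyapunov exponent for $L(n,\omega)$ (possibly $-\infty$), and $$\limsup_{n\to\infty}\left[\frac1n\log\left\|L(n,\omega)|_{\ker(\eta(\omega,\cdot))}\right\|-\frac1n\sum_{i=0}^{n-1}\log(\phi(\sigma^i(\omega)))\right]\le-\frac{\mu(G_P)}{k_P}\log\left(\tanh\left(\tfrac14D_P\right)^{-1}\right)<0.$$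 If $\lambda_1>-\infty$, then $\lambda_1$ has multiplicity $1$ with $\lambda_1=\int_\Omega\log\phi\,d\mu$, and the projection operators $\pi_\omega$ and $I-\pi_\omega$ are norm-tempered in $\omega$.
   Context: Nice cones. Let $(X,\|\cdot\|)$ be a real Banach space. A cone is a set $\mathcal{C}\subset X$ with $\lambda\mathcal{C}\subset\mathcal{C}$ for all $\lambda>0$. It is a nice cone if: it is convex; $0\notin\mathcal{C}$; $\mathcal{C}\cap(-\mathcal{C})=\emptyset$; $\mathcal{C}\cup\{0\}$ is closed; $\mathcal{C}-\mathcal{C}=X$ (generating); and it is $D$-adapted for some real $D\ge1$, i.e. for $x\in X$, $y\in\mathcal{C}$, if $y+x$ and $y-x$ both lie in $\mathcal{C}\cup\{0\}$ then $\|x\|\le D\|y\|$. Write $x\preceq y$ iff $y-x\in\mathcal{C}\cup\{0\}$. Projective metric. For $v,w\in\mathcal{C}$: $\alpha(v,w)=\sup\{\lambda\ge0:\lambda v\preceq w\}$, $\beta(v,w)=\inf\{\mu\ge0:w\preceq\mu v\}$ ($+\infty$ if there is no such $\mu$), $\theta(v,w)=\log(\beta(v,w)/\alpha(v,w))\in[0,\infty]$ ($=\infty$ if $\alpha=0$ or $\beta=\infty$). For $S\subset\mathcal{C}$, $\operatorname{diam}_\theta(S)=\sup_{v,w\in S}\theta(v,w)$. Random dynamical systems. $(\Omega,\mathcal{B},\mu,\sigma)$ is an ergodic, invertible, probability-preserving transformation, $\mathcal{B}(X)$ is the space of bounded linear operators on $X$, $L:\Omega\to\mathcal{B}(X)$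 is a map with $L(1,\omega)=L(\omega)$, and $L(n,\omega)=L(1,\sigma^{n-1}(\omega))\cdots L(1,\omega)$. - The tuple is a strongly measurable random dynamical system if $X$ is separable and $L$ is strongly measurable. - The tuple is a $\mu$-continuous random dynamical system if $\Omega$ is (homeomorphic to) a Borel subset of a Polish space, $\mu$ is a Borel measure, $\sigma$ is a homeomorphism, and $L$ is $\mu$-continuous for the operator norm topology ($X$ need not be separable). A map from $\Omega$ to bounded operators $\mathcal{B}(X,Y)$ (with $Y=X$ or $Y=\mathbb{R}$) is strongly measurable if it is measurable for the Borel $\sigma$-algebra of the strong operator topology (for separable $X$ and $Y$: $\omega\mapsto L_\omega x$ is Borel measurable for all $x\in X$). A map $f$ from $\Omega$ to a topological space is $\mu$-continuous if there is an increasing sequence of compact sets $K_n\subset\Omega$ with $\mu(\bigcup_nK_n)=1$ such that $f$ is continuous on each $K_n$. Other terms. A functional $\eta\in X^*$ is strictly positive with respect to $\mathcal{C}$ if $\eta(x)>0$ for all $x\in\mathcal{C}$. Equivariant means $L(1,\omega)$ maps each summand at $\omega$ into the corresponding summand at $\sigma(\omega)$. The Grassmannian is the set of closed complemented subspaces of $X$ with metric $d(E,F)$ the Hausdorff distance between the closed unit balls of $E$ and $F$. A function $f:\Omega\to\mathbb{R}$ is tempered if $\lim_{n\to\pm\infty}\frac1n\log|f(\sigma^n(\omega))|=0$; an operator family is norm-tempered if its operator norm is tempered. ''$\lambda_1$ has multiplicity $1$'' means that the equivariant space associated with $\lambda_1$ is the one-dimensional space $\operatorname{span}_{\mathbb{R}}\{v(\omega)\}$,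 all vectors in the complement $\ker(\eta(\omega,\cdot))$ having Lyapunov exponent strictly less than $\lambda_1$. *)

(* Defs.v *)
From HB Require Import structures.
From mathcomp Require Import all_boot all_order all_algebra.
From mathcomp Require Import all_classical all_reals all_analysis.
From mathcomp Require Import lra.

Set Implicit Arguments.
Unset Strict Implicit.
Unset Printing Implicit Defensive.

Import Order.TTheory GRing.Theory Num.Theory.
Import numFieldNormedType.Exports.

Local Open Scope classical_set_scope.
Local Open Scope ring_scope.

Section operator_norm.
Context {R : realType} {X Y : normedModType R}.
Implicit Types (E : set X) (f g : X -> Y).

(* The norm of the restriction of f to E; the operator norm when E = setT. *)
Definition opnorm_on E f : R := sup [set `|f x| | x in E `&` [set x | `|x| <= 1]].

Definition opnorm f : R := opnorm_on setT f.

Lemma lin_cts_bound f : linear f -> continuous f ->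
  exists2 M, 0 < M & forall x, `|f x| <= M * `|x|.
Proof.
move=> lf cf.
pose F : {linear X -> Y} := HB.pack f (GRing.isLinear.Build _ _ _ _ _ lf).
have /linear_boundedP : bounded_near F (nbhs 0) by apply/linear_bounded_continuous.
move=> /pinfty_ex_gt0 [M M0 MF]; exists M => // x; exact: MF.
Qed.

Let ball_nonempty f : [set `|f x| | x in setT `&` [set x | `|x| <= 1]] !=set0.
Proof. by exists `|f 0|, 0 => //; split => //=; rewrite normr0. Qed.

Lemma opnorm_has_sup f : linear f -> continuous f ->
  has_sup [set `|f x| | x in setT `&` [set x | `|x| <= 1]].
Proof.
move=> lf cf; split; first exact: ball_nonempty.
have [M M0 Mf] := lin_cts_bound lf cf.
exists M => _ [x [_ /= x1] <-].
by rewrite (le_trans (Mf x))// ler_piMr// ltW.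
Qed.

Lemma opnorm_ub f x : linear f -> continuous f -> `|f x| <= opnorm f * `|x|.
Proof.
move=> lf cf.
pose F : {linear X -> Y} := HB.pack f (GRing.isLinear.Build _ _ _ _ _ lf).
have [->|x0] := eqVneq x 0.
  by rewrite [f 0](linear0 F) !normr0 mulr0.
have nx : 0 < `|x| by rewrite normr_gt0.
rewrite -ler_pdivrMr//.
have -> : `|f x| / `|x| = `|f (`|x|^-1 *: x)|.
  rewrite [f (_ *: _)](linearZ_LR F)/= normrZ ger0_norm ?invr_ge0//.
  by rewrite mulrC.
apply: sup_upper_bound; first exact: opnorm_has_sup.
exists (`|x|^-1 *: x) => //; split => //=.
by rewrite normrZ ger0_norm ?invr_ge0// mulVf// gt_eqF.
Qed.

Lemma opnorm_le f M : (forall x, `|x| <= 1 -> `|f x| <= M) -> opnorm f <= M.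
Proof.
move=> fM; apply: ge_sup; first exact: ball_nonempty.
by move=> _ [x [_ /= x1] <-]; exact: fM.
Qed.

End operator_norm.

Section bounded_operators.
Context {R : realType} (X Y : normedModType R).

Definition lin_cts : {pred X -> Y} := mem [set f : X -> Y | linear f /\ continuous f].

Record bop := Bop { bop_fun :> X -> Y ; bop_subproof : bop_fun \in lin_cts }.

HB.instance Definition _ := [isSub for bop_fun].
HB.instance Definition _ := [Choice of bop by <:].

Lemma lin_cts_submod_closed : submod_closed lin_cts.
Proof.
split=> [|a f g]; rewrite !inE/=.
  split; last by move=> x; exact: cvg_cst.
  by move=> k x y; rewrite -[0 x]/(0 : Y) -[0 y]/(0 : Y) scaler0 addr0.
move=> [lf cf] [lg cg]; split.
  move=> k x y; rewrite /= -![(a *: f + g) _]/(a *: f _ + g _) lf lg.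
  by rewrite !scalerDr !scalerA (mulrC a k) addrACA.
by move=> x; apply: cvgD; [apply: cvgZr; exact: cf|exact: cg].
Qed.
HB.instance Definition _ := GRing.isSubmodClosed.Build _ _ lin_cts
  lin_cts_submod_closed.
HB.instance Definition _ := [SubChoice_isSubLmodule of bop by <:].

Lemma bop_linear (f : bop) : linear f.
Proof. by have := bop_subproof f; rewrite inE => -[]. Qed.

Lemma bop_continuous (f : bop) : continuous f.
Proof. by have := bop_subproof f; rewrite inE => -[]. Qed.

HB.instance Definition _ (f : bop) :=
  GRing.isLinear.Build R X Y *:%R (bop_fun f) (@bop_linear f).

Lemma bopP (f g : bop) : f = g <-> f =1 g.
Proof. by split=> [->//|fg]; exact/val_inj/funext. Qed.

Lemma bop_opnorm_ub (f : bop) x : `|f x| <= opnorm f * `|x|.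
Proof. exact: opnorm_ub (@bop_linear f) (@bop_continuous f). Qed.

Lemma bop_opnorm_ge0 (f : bop) : 0 <= opnorm f.
Proof.
apply: sup_upper_bound; first exact: opnorm_has_sup (@bop_linear f) (@bop_continuous f).
exists 0; first by split => //=; rewrite normr0.
by rewrite (linear0 f) normr0.
Qed.

Lemma bop_opnorm_ball (f : bop) x : `|x| <= 1 -> `|f x| <= opnorm f.
Proof.
move=> x1; rewrite (le_trans (bop_opnorm_ub f x))//.
apply: ler_piMr => //; exact: bop_opnorm_ge0.
Qed.

Lemma bop_opnormD (f g : bop) : opnorm (f + g : bop) <= opnorm f + opnorm g.
Proof.
apply: opnorm_le => x x1; rewrite (le_trans (ler_normD _ _))//.
by apply: lerD; exact: bop_opnorm_ball.
Qed.

Lemma bop_opnormZ (a : R) (f : bop) : opnorm (a *: f : bop) = `|a| * opnorm f.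
Proof.
have le b (g : bop) : opnorm (b *: g : bop) <= `|b| * opnorm g.
  apply: opnorm_le => x x1; rewrite -[(_ *: _ : bop) _]/(b *: g x) normrZ.
  by rewrite ler_wpM2l// bop_opnorm_ball.
apply/eqP; rewrite eq_le le andTb.
have [->|a0] := eqVneq a 0; first by rewrite normr0 mul0r bop_opnorm_ge0.
have := le a^-1 (a *: f); rewrite scalerA mulVf// scale1r normfV.
by rewrite -ler_pdivrMl ?invr_gt0 ?normr_gt0// invrK.
Qed.

Lemma bop_opnorm0_eq0 (f : bop) : opnorm f = 0 -> f = 0.
Proof.
move=> f0; apply/bopP => x; apply/eqP; rewrite -normr_le0.
by have := bop_opnorm_ub f x; rewrite f0 mul0r.
Qed.

HB.instance Definition _ :=
  Lmodule_isNormed.Build R bop bop_opnormD bop_opnormZ bop_opnorm0_eq0.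

Lemma bop_normE (f : bop) : `|f| = opnorm f.
Proof. by []. Qed.

End bounded_operators.
Arguments lin_cts {R} X Y.

(* B(X, Y) with the strong operator topology. *)
Definition sot {R : realType} (X Y : normedModType R) :=
  initial_topology (fun f : bop X Y => bop_fun f : {ptws X -> Y}).

HB.instance Definition _ (R : realType) (X Y : normedModType R) :=
  Topological.on (sot X Y).

Section operators.
Context {R : realType} {X Y Z : normedModType R}.

Fact idop_subproof : (idfun : X -> X) \in lin_cts X X.
Proof. by rewrite inE; split=> // x; exact: cvg_id. Qed.

Definition idop : bop X X := Bop idop_subproof.

Fact comp_op_subproof (g : bop Y Z) (f : bop X Y) :
  (fun x => g (f x)) \in lin_cts X Z.
Proof.
rewrite inE; split=> [k x y|x]; first by rewrite !linearP.
by apply: continuous_comp; exact: bop_continuous.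
Qed.

Definition comp_op (g : bop Y Z) (f : bop X Y) : bop X Z :=
  Bop (comp_op_subproof g f).

Fact rank1_subproof (eta : bop X R) (v : Y) :
  (fun x => eta x *: v) \in lin_cts X Y.
Proof.
rewrite inE; split=> [k x y|x].
  by rewrite linearP scalerDl scalerA.
by apply: cvgZl; exact: bop_continuous.
Qed.

Definition rank1 (eta : bop X R) (v : Y) : bop X Y :=
  Bop (rank1_subproof eta v).

End operators.
Arguments idop {R X}.

Section grassmannian.
Context {R : realType} (X : normedModType R).
Implicit Types (A B C : set X) (x y : X).

Definition subspace_set (E : set X) :=
  E 0 /\ forall (a : R) x y, E x -> E y -> E (a *: x + y).

Definition closed_complemented (E : set X) :=
  [/\ subspace_set E, closed E &
      exists F : set X, [/\ subspace_set F, closed F,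
        E `&` F = [set 0] &
        forall x, exists y z, [/\ E y, F z & x = y + z]]].

Record grassmannian :=
  Grassmannian { gr_set :> set X ; _ : closed_complemented gr_set }.

Definition dist_set x B : R := inf [set `|x - b| | b in B].

Definition excess A B : R := sup [set dist_set x B | x in A].

Definition hausdorff_dist A B : R := Num.max (excess A B) (excess B A).

Definition closed_unit_ball (E : set X) := E `&` [set x | `|x| <= 1].

Definition gr_dist (E F : grassmannian) : R :=
  hausdorff_dist (closed_unit_ball E) (closed_unit_ball F).

HB.instance Definition _ := gen_eqMixin grassmannian.
HB.instance Definition _ := gen_choiceMixin grassmannian.

Let good A := A 0 /\ forall x, A x -> `|x| <= 1.

Let goodP (E : grassmannian) : good (closed_unit_ball E).
Proof.
have [[E0 _] _ _] : closed_complemented E by case: E.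
by split=> [|x []//]; split=> //=; rewrite normr0.
Qed.

Let has_inf_dist x B : good B -> has_inf [set `|x - b| | b in B].
Proof.
move=> [B0 _]; split; first by exists `|x - 0|, 0.
by exists 0 => r [b Bb <-].
Qed.

Let dist_le x B b : good B -> B b -> dist_set x B <= `|x - b|.
Proof.
by move=> gB Bb; apply: inf_lbound; [case: (has_inf_dist x gB)|exists b].
Qed.

Let dist_ge0 x B : good B -> 0 <= dist_set x B.
Proof.
by move=> gB; apply: lb_le_inf; [case: (has_inf_dist x gB)|move=> r [b Bb <-]].
Qed.

Let dist_adh x B e : good B -> 0 < e ->
  exists2 b, B b & `|x - b| < dist_set x B + e.
Proof.
by move=> gB e0; have [r [b Bb <-] ?] := inf_adherent e0 (has_inf_dist x gB); exists b.
Qed.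

Let has_sup_exc A B : good A -> good B -> has_sup [set dist_set x B | x in A].
Proof.
move=> [A0 A1] gB; split; first by exists (dist_set 0 B), 0.
exists 1 => _ [x Ax <-]; rewrite (le_trans (dist_le x gB gB.1))//.
by rewrite subr0 A1.
Qed.

Let exc_ub A B x : good A -> good B -> A x -> dist_set x B <= excess A B.
Proof.
by move=> gA gB Ax; apply: sup_upper_bound; [exact: has_sup_exc|exists x].
Qed.

Let exc_ge0 A B : good A -> good B -> 0 <= excess A B.
Proof. by move=> gA gB; rewrite (le_trans _ (exc_ub gA gB gA.1))// dist_ge0. Qed.

Let exc_triangle A B C : good A -> good B -> good C ->
  excess A C <= excess A B + excess B C.
Proof.
move=> gA gB gC; apply: ge_sup; first by case: (has_sup_exc gA gC).
move=> _ [x Ax <-]; apply/ler_addgt0Pl => e e0.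
have e2 : 0 < e / 2 by rewrite divr_gt0.
have [b Bb xb] := dist_adh x gB e2.
have [c Cc bc] := dist_adh b gC e2.
rewrite (le_trans (dist_le x gC Cc))// (le_trans (ler_distD b _ _))//.
have := exc_ub gA gB Ax; have := exc_ub gB gC Bb.
move: xb bc; lra.
Qed.

Let excxx A : good A -> excess A A = 0.
Proof.
move=> gA; apply/eqP; rewrite eq_le exc_ge0// andbT.
apply: ge_sup; first by case: (has_sup_exc gA gA).
by move=> _ [x Ax <-]; rewrite (le_trans (dist_le x gA Ax))// subrr normr0.
Qed.

Let exc_le0_sub (E F : grassmannian) :
  excess (closed_unit_ball E) (closed_unit_ball F) <= 0 -> E `<=` F.
Proof.
move=> EF0.
have ballEF x : closed_unit_ball E x -> gr_set F x.
  move=> Ex; have cF : closed F by case: (F) => ? [].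
  apply: cF => U /nbhs_ballP[e /= e0 eU].
  have [b [Fb _] xb] := dist_adh x (goodP F) e0.
  exists b; split => //; apply: eU; rewrite -ball_normE/=.
  rewrite (lt_le_trans xb)// gerDr.
  exact: le_trans (exc_ub (goodP E) (goodP F) Ex) EF0.
move=> x Ex; have [->|x0] := eqVneq x 0; first by case: (F) => ? [[]].
have [[E0 ES] _ _] : closed_complemented E by case: (E).
have [[F0 FS] _ _] : closed_complemented F by case: (F).
have nx : `|x| != 0 by rewrite normr_eq0.
have : gr_set F (`|x|^-1 *: x).
  apply: ballEF; split; first by rewrite -[_ *: _]addr0; exact: ES.
  by rewrite /= normrZ ger0_norm ?invr_ge0// mulVf.
move=> Fx; have := FS `|x| _ _ Fx F0.
by rewrite addr0 scalerA divff// scale1r.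
Qed.

Fact gr_distxx (E : grassmannian) : gr_dist E E = 0.
Proof. by rewrite /gr_dist /hausdorff_dist maxxx excxx. Qed.

Fact gr_dist_positivity (E F : grassmannian) : gr_dist E F = 0 -> E = F.
Proof.
move=> EF0; suff : E = F :> set X.
  case: E F {EF0} => [E PE] [F PF] /= EF; rewrite EF in PE *.
  by congr Grassmannian; exact: Prop_irrelevance.
have : gr_dist E F <= 0 by rewrite EF0.
rewrite ge_max => /andP[EF FE].
by apply/seteqP; split; exact: exc_le0_sub.
Qed.

Fact gr_dist_sym (E F : grassmannian) : gr_dist E F = gr_dist F E.
Proof. by rewrite /gr_dist /hausdorff_dist maxC. Qed.

Fact gr_dist_triangle (F E G : grassmannian) :
  gr_dist E G <= gr_dist E F + gr_dist F G.
Proof.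
rewrite ge_max; apply/andP; split.
  by rewrite (le_trans (exc_triangle (goodP E) (goodP F) (goodP G)))// lerD//
    le_max lexx.
rewrite addrC (le_trans (exc_triangle (goodP G) (goodP F) (goodP E)))// lerD//.
  by rewrite le_max lexx orbT.
by rewrite le_max lexx orbT.
Qed.

HB.instance Definition _ := @isMetric.Build R grassmannian gr_dist
  gr_distxx gr_dist_positivity gr_dist_sym gr_dist_triangle.

End grassmannian.

Section cones.
Context {R : realType} {X : normedModType R}.
Implicit Types (C : set X) (v w : X).

Definition cone C := forall (a : R) x, 0 < a -> C x -> C (a *: x).

Definition cone_le C v w := (C `|` [set 0]) (w - v).

Definition adapted (D : R) C := forall x y, C y ->
  (C `|` [set 0]) (y + x) -> (C `|` [set 0]) (y - x) -> `|x| <= D * `|y|.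

Definition nice_cone C :=
  [/\ cone C,
      forall (t : R) x y, 0 <= t <= 1 -> C x -> C y -> C (t *: x + (1 - t) *: y),
      ~ C 0,
      C `&` [set - x | x in C] = set0 &
      [/\ closed (C `|` [set 0]),
          forall x, exists y z, [/\ C y, C z & x = y - z] &
          exists2 D : R, 1 <= D & adapted D C]].

Local Open Scope ereal_scope.

Definition cone_alpha C v w : \bar R :=
  ereal_sup [set a%:E | a in [set a : R | (0 <= a)%R /\ cone_le C (a *: v) w]].

Definition cone_beta C v w : \bar R :=
  ereal_inf [set b%:E | b in [set b : R | (0 <= b)%R /\ cone_le C w (b *: v)]].

Definition cone_theta C v w : \bar R :=
  if (cone_alpha C v w == 0) || (cone_beta C v w == +oo) then +oo
  else lne (cone_beta C v w / cone_alpha C v w).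

Definition cone_diam C (S : set X) : \bar R :=
  ereal_sup [set cone_theta C p.1 p.2 | p in S `*` S].

End cones.

Definition log_plus {R : realType} (x : R) : R := Num.max 0 (ln x).

Definition tanh {R : realType} (x : R) : R :=
  (expR x - expR (- x)) / (expR x + expR (- x)).

Definition separable (T : topologicalType) :=
  exists2 D : set T, countable D & dense D.

Definition borel (T : topologicalType) : set (set T) := <<s @open T >>.

(* The topology and the sigma-algebra are unrelated: mu_continuous_rds below
   requires the sigma-algebra to be the Borel one, while
   strongly_measurable_rds ignores the topology, which can then be any (such as
   the discrete one), so that it covers every measurable space. *)
#[short(type="topMeasurableType")]
HB.structure Definition TopMeasurable d :=
  {T of Topological T & Measurable d T}.

(* T is homeomorphic to a Borel subset of a Polish space, given as a separable
   complete metric space. *)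
Definition borel_of_polish (R : realType) (T : topologicalType) :=
  exists (P : completePseudoMetricType R) (i : T -> P),
    [/\ hausdorff_space P, separable P, injective i,
        (forall U : set T, open U <-> exists2 V : set P, open V & i @^-1` V = U) &
        borel (range i)].

Section random_dynamical_systems.
Context {d : measure_display} {R : realType} {Omega : topMeasurableType d}.
Variable mu : probability Omega R.

Definition ergodic_invertible_mpt (sigma sigmaV : Omega -> Omega) :=
  [/\ cancel sigma sigmaV /\ cancel sigmaV sigma,
      measurable_fun setT sigma /\ measurable_fun setT sigmaV,
      (forall A, measurable A -> mu (sigma @^-1` A) = mu A) &
      (forall A, measurable A -> sigma @^-1` A = A ->
         mu A = 0%E \/ mu A = 1%E)].

(* A function defined on a subset D of Omega is represented by a total function,
   of which only the values on D are constrained. *)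
Definition borel_measurable_on (D : set Omega) {T : topologicalType}
    (f : Omega -> T) :=
  forall B, borel B -> measurable (D `&` f @^-1` B).

Definition strongly_measurable_on (D : set Omega) {X Y : normedModType R}
    (f : Omega -> bop X Y) :=
  borel_measurable_on D (f : Omega -> sot X Y).

Definition mu_continuous_on (D : set Omega) {T : topologicalType}
    (f : Omega -> T) :=
  exists K : (set Omega)^nat,
    [/\ forall n, compact (K n) /\ K n `<=` D,
        forall n, K n `<=` K n.+1,
        mu (\bigcup_n K n) = 1%E &
        forall n, {within K n, continuous f}].

Definition strongly_measurable_rds {X : normedModType R}
    (L : Omega -> bop X X) :=
  separable X /\ strongly_measurable_on setT L.

Definition mu_continuous_rds {X : normedModType R}
    (sigma sigmaV : Omega -> Omega) (L : Omega -> bop X X) :=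
  [/\ borel_of_polish R Omega,
      (@measurable d Omega) = (@borel Omega),
      continuous sigma /\ continuous sigmaV &
      mu_continuous_on setT L].

Definition invariant_full (sigma : Omega -> Omega) (D : set Omega) :=
  [/\ measurable D, mu D = 1%E & sigma @^-1` D = D].

(* Since ln 0 = 0, the zero function is tempered; this is needed for I - pi when
   X has dimension 1, in which case I - pi = 0. *)
Definition tempered_on (D : set Omega) (sigma sigmaV : Omega -> Omega)
    (f : Omega -> R) :=
  forall w, D w ->
    (n%:R^-1 * ln `|f (iter n sigma w)| @[n --> \oo] --> (0 : R)) /\
    (n%:R^-1 * ln `|f (iter n sigmaV w)| @[n --> \oo] --> (0 : R)).

End random_dynamical_systems.

Section cocycles.
Context {R : realType} {Omega : Type} {X : normedModType R}.
Variables (sigma : Omega -> Omega) (L : Omega -> bop X X).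

Fixpoint cocycle (n : nat) (w : Omega) : bop X X :=
  if n is m.+1 then comp_op (L (iter m sigma w)) (cocycle m w) else idop.

(* lne 0 = -oo, so the exponent of a vector that is eventually killed is -oo. *)
Definition lyapunov (w : Omega) (x : X) : \bar R :=
  limn_esup (fun n => n%:R^-1%:E * lne `|cocycle n w x|%:E)%E.

End cocycles.

Section directions.
Context {R : realType} {X : normedModType R}.

Definition line (v : X) : set X := [set a *: v | a in [set: R]].

Definition ker_op {Y : normedModType R} (f : bop X Y) : set X :=
  [set x | f x = 0].

Definition direct_sum (E F : set X) :=
  E `&` F = [set 0] /\ forall x, exists y z, [/\ E y, F z & x = y + z].

End directions.

Section conclusions.
Context {d : measure_display} {R : realType} {Omega : topMeasurableType d}.
Context {X : normedModType R}.
Variables (mu : probability Omega R) (sigma : Omega -> Omega).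
Variables (L : Omega -> bop X X) (C : set X) (D : set Omega).

Definition equivariant_direction (v : Omega -> X) (phi : Omega -> R) :=
  [/\ forall w, D w -> C (v w),
      forall w, D w -> `|v w| = 1,
      (forall w, D w -> 0 < phi w) /\ measurable_fun D phi,
      mu.-integrable D (EFin \o log_plus \o phi) &
      forall w, D w -> L w (v w) = phi w *: v (sigma w)].

Definition equivariant (E : Omega -> set X) :=
  forall w, D w -> L w @` E w `<=` E (sigma w).

End conclusions.

(* Main.v *)
(* By Birkhoff's inequality a cone map of projective diameter Delta contracts the
   projective metric by tanh(Delta / 4). By the ergodic theorem a typical orbit
   visits G_P with frequency mu(G_P), in the past and in the future, so the
   projective diameter of L(n, w) C decays like tanh(D_P / 4)^(n mu(G_P) / k_P).
   Contraction along the past gives v(w) = lim L(n, sigma^-n w) x0 normalized.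
   Contraction along the future squeezes L(n, w) x, for the cone order, between
   multiples of L(n, w) v(w), and eta(w, x) is the common limit of the ratios; as
   the cone generates X, this gives |L(n, w) - eta(w, .) L(n, w) v(w)| <=
   (small) |eta(w, .)| |L(n, w) v(w)|, hence all the statements on growth rates.
   In the strongly measurable case v and eta are pointwise limits of measurable
   maps; in the mu-continuous case these limits are uniform on compact sets of
   almost full measure on which all the w |-> L(sigma^j w) are continuous. For
   temperedness, log |eta(w, .)| is at most a constant plus the Birkhoff sum up to
   m of log^+ |L| - log phi, for each m such that k_P < #(visits before m); at
   sigma^(+-n) w one takes for m a small proportion of n. *)

From HB Require Import structures.
Require Import Defs.
From mathcomp Require Import all_boot all_order all_algebra.
From mathcomp Require Import all_classical all_reals all_analysis.
From mathcomp Require Import measurable_realfun ring lra.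

Set Implicit Arguments.
Unset Strict Implicit.
Unset Printing Implicit Defensive.

Import Order.TTheory GRing.Theory Num.Theory.
Import numFieldNormedType.Exports.

Local Open Scope classical_set_scope.
Local Open Scope ring_scope.

(** * Birkhoff's contraction theorem *)

(** The projective metric enters through inequalities [a u <= w <= b u] with [b <= e^t a], so that
    contraction and limits become manipulations of scalars; [theta] itself serves only to read the
    hypothesis on [G_P]. Estimates on the cone pass to [X] by two constants: the normality constant
    [D], and a constant [K] such that every [x] is a difference of cone vectors of norm at most
    [K |x|], which the definition of a generating cone does not provide.

    Two obstacles shape the rest. As [lambda1] may be [-oo], only the positive part of [log phi] is
    known to be integrable; the ergodic theorem is therefore derived from one-sided bounds that
    survive truncation from below. In the mu-continuous case [X] may be nonseparable, so the
    measurability of [phi] is not drawn from that of [v]: [phi] is a limit of quotients of norms of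
    images of one fixed cone vector. As [v] and [eta] are defined at each point by limits, they
    exist wherever the orbit visits [G_P] often enough in both directions, and the invariant set can
    be reduced later without changing them. *)

Section cone_order.
Context {R : realType} {X : normedModType R} (C : set X).
Hypothesis nC : nice_cone C.
Implicit Types (x y z u w : X) (a b t : R).

Local Notation "x <=c y" := (cone_le C x y) (at level 70).

Lemma cone_scale a x : 0 < a -> C x -> C (a *: x).
Proof. by case: nC => cC _ _ _ _; exact: cC. Qed.

Lemma cone_neq0 x : C x -> x != 0.
Proof. by case: nC => _ _ C0 _ _ Cx; apply/eqP => x0; apply: C0; rewrite -x0. Qed.

Lemma cone_add x y : C x -> C y -> C (x + y).
Proof.
move=> Cx Cy; have [_ cvx _ _ _] := nC.
have -> : x + y = 2%:R *: ((1 / 2) *: x + (1 - 1 / 2) *: y).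
  rewrite scalerDr !scalerA.
  have -> : 2%:R * (1 / 2) = 1 :> R by lra.
  have -> : 2%:R * (1 - 1 / 2) = 1 :> R by lra.
  by rewrite !scale1r.
by apply: cone_scale; [lra|apply: cvx => //; lra].
Qed.

Lemma cone_le_refl x : x <=c x.
Proof. by right; rewrite /= subrr. Qed.

Lemma cone_le0 x : (0 <=c x) = (C `|` [set 0]) x.
Proof. by rewrite /cone_le subr0. Qed.

Lemma cone_ge0 x : C x -> 0 <=c x.
Proof. by rewrite cone_le0; left. Qed.

Lemma cone0_add x y : 0 <=c x -> 0 <=c y -> 0 <=c x + y.
Proof.
rewrite !cone_le0 => -[Cx|->] [Cy|->]; rewrite ?add0r ?addr0;
  by [left; exact: cone_add|left|right].
Qed.

Lemma cone0_scale a x : 0 <= a -> 0 <=c x -> 0 <=c a *: x.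
Proof.
rewrite !cone_le0 le_eqVlt => /predU1P[<-|a0] [Cx|->];
  rewrite ?scale0r ?scaler0; try by right.
by left; exact: cone_scale.
Qed.

Lemma cone_subr_ge0 x y : (0 <=c y - x) = (x <=c y).
Proof. by rewrite /cone_le subr0. Qed.

Lemma cone_le_add x y z u : x <=c y -> z <=c u -> x + z <=c y + u.
Proof.
by rewrite -!(cone_subr_ge0 _ y) -(cone_subr_ge0 _ u) -(cone_subr_ge0 _ (y + u))
  opprD addrACA; exact: cone0_add.
Qed.

Lemma cone_le_trans y x z : x <=c y -> y <=c z -> x <=c z.
Proof.
move=> xy yz; have := cone_le_add xy yz.
by rewrite -cone_subr_ge0 (addrC x y) (addrC y z) addrKA cone_subr_ge0.
Qed.

Lemma cone_le_scale a x y : 0 <= a -> x <=c y -> a *: x <=c a *: y.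
Proof.
rewrite -cone_subr_ge0 => a0 /(cone0_scale a0).
by rewrite scalerBr cone_subr_ge0.
Qed.

Lemma cone_le_scalel a b x : 0 <=c x -> a <= b -> a *: x <=c b *: x.
Proof.
by move=> x0 ab; rewrite -cone_subr_ge0 -scalerBl; apply: cone0_scale; rewrite ?subr_ge0.
Qed.

Lemma cone_le_opp x y : x <=c y -> - y <=c - x.
Proof. by rewrite -cone_subr_ge0 -(cone_subr_ge0 (- y)) opprK addrC. Qed.

Lemma cone_lt_irrefl x : C x -> ~ x <=c 0.
Proof.
rewrite /cone_le sub0r => Cx [CNx|/eqP]; last first.
  by rewrite oppr_eq0; apply/negP; exact: cone_neq0.
case: nC => _ _ _ CC _; suff : (C `&` [set - z | z in C]) x by rewrite CC.
by split => //; exists (- x) => //; rewrite opprK.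
Qed.

(** If [b < a], then [(a - b) *: x] is in the cone and below 0, which pointedness excludes. This is
    how order relations between vectors become inequalities between scalars. *)
Lemma cone_lemm a b x : C x -> a *: x <=c b *: x -> a <= b.
Proof.
move=> Cx abx; rewrite leNgt; apply/negP => ba.
apply: (@cone_lt_irrefl ((a - b) *: x)); first by apply: cone_scale; rewrite ?subr_gt0.
have := cone_le_add abx (cone_le_refl (- (b *: x))).
by rewrite subrr scalerBl.
Qed.

Lemma cone_closed : closed [set x | 0 <=c x].
Proof.
case: nC => _ _ _ _ [cC _ _].
suff -> : [set x | 0 <=c x] = C `|` [set 0] by [].
by apply/seteqP; split => x /=; rewrite cone_le0.
Qed.

(** Adding the two inequalities gives [0 <= 2 y], so that [adapted] applies when [y] is in [C]; for
    [y = 0], pointedness forces [x = 0]. *)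
Lemma cone_normal : exists2 D, 1 <= D &
  forall x y, - y <=c x -> x <=c y -> `|x| <= D * `|y|.
Proof.
have [_ _ _ _ [_ _ [D D1 aD]]] := nC; exists D => // x y yx xy.
have y0 : 0 <=c y.
  have := cone_le_add yx xy; rewrite -cone_subr_ge0.
  have -> : x + y - (- y + x) = 2%:R *: y.
    by rewrite opprD opprK (addrC y) addrACA subrr add0r scaler_nat.
  move=> /(@cone0_scale 2^-1); rewrite scalerA mulVf ?scale1r ?pnatr_eq0//.
  by apply; rewrite invr_ge0.
move: (y0); rewrite cone_le0 => -[Cy|y00].
  apply: aD => //; first by rewrite -cone_le0 addrC -[y]opprK cone_subr_ge0.
have x0 : x = 0.
  move: yx xy; rewrite y00 oppr0 cone_le0 => -[Cx /(cone_lt_irrefl Cx)//|//].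
by rewrite x0 normr0 mulr_ge0// (le_trans _ D1).
Qed.

(* For u and w in the cone, [prox t u w] means theta(u, w) <= t. *)
Definition prox t u w := exists a b,
  [/\ 0 < a, a *: u <=c w, w <=c b *: u & b <= expR t * a].

Lemma prox_ratio t u w : C u -> prox t u w -> exists a b,
  [/\ 0 < a, a <= b, a *: u <=c w, w <=c b *: u & b <= expR t * a].
Proof.
move=> Cu [a [b [a0 aw wb ba]]]; exists a, b; split => //.
exact: cone_lemm Cu (cone_le_trans aw wb).
Qed.

Lemma prox_ge0 t u w : C u -> prox t u w -> 0 <= t.
Proof.
move=> Cu /(prox_ratio Cu)[a [b [a0 ab _ _ ba]]].
rewrite -(ler_expR 0) expR0; have := le_trans ab ba.
by rewrite ler_pMl.
Qed.

Lemma prox_le t t' u w : t <= t' -> prox t u w -> prox t' u w.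
Proof.
move=> tt' [a [b [a0 aw wb ba]]]; exists a, b; split => //.
by rewrite (le_trans ba)// ler_pM2r// ler_expR.
Qed.

Lemma prox_sym t u w : C u -> prox t u w -> prox t w u.
Proof.
move=> Cu /(prox_ratio Cu)[a [b [a0 ab aw wb ba]]].
have b0 := lt_le_trans a0 ab.
exists b^-1, a^-1; split; rewrite ?invr_gt0//.
- have := @cone_le_scale b^-1 _ _ _ wb.
  by rewrite scalerA mulVf ?gt_eqF// scale1r; apply; rewrite invr_ge0 ltW.
- have := @cone_le_scale a^-1 _ _ _ aw.
  by rewrite scalerA mulVf ?gt_eqF// scale1r; apply; rewrite invr_ge0 ltW.
- by rewrite ler_pdivlMr// mulrC ler_pdivrMr// mulrC.
Qed.

Lemma prox_scaler t u w c : 0 < c -> prox t u w -> prox t u (c *: w).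
Proof.
move=> c0 [a [b [a0 aw wb ba]]]; exists (c * a), (c * b); split.
- exact: mulr_gt0.
- by rewrite -scalerA; apply: cone_le_scale; rewrite // ltW.
- by rewrite -scalerA; apply: cone_le_scale; rewrite // ltW.
- by rewrite mulrCA ler_pM2l.
Qed.

Lemma prox_scalel t u w c : 0 < c -> C u -> C w -> prox t u w -> prox t (c *: u) w.
Proof.
move=> c0 Cu Cw /(prox_sym Cu)/(prox_scaler c0).
by apply: prox_sym.
Qed.

(** Normality applied to [a u <= w] gives [a <= D]; applied to [w - a u], which lies between 0 and
    [(b - a) u] with [b - a <= a (e^t - 1)], it gives [D ^ 2 (e^t - 1)]. The same number bounds
    [|a - 1|], a difference of the norms of [a u] and [w]: hence the factor 2. *)
Lemma prox_norm (D : R) : 1 <= D ->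
  (forall x y, - y <=c x -> x <=c y -> `|x| <= D * `|y|) ->
  forall t u w, C u -> `|u| = 1 -> `|w| = 1 -> prox t u w ->
  `|u - w| <= 2 * D ^+ 2 * (expR t - 1).
Proof.
move=> D1 nD t u w Cu u1 w1 /(prox_ratio Cu)[a [b [a0 ab aw wb ba]]].
have D0 : 0 <= D := le_trans ler01 D1.
have aD : a <= D.
  have : `|a *: u| <= D * `|w|.
    apply: (nD _ _ _ aw); apply: (@cone_le_trans 0); last first.
      by apply: cone_ge0; exact: cone_scale.
    rewrite -oppr0; apply: cone_le_opp; apply: cone_le_trans aw.
    by apply: cone_ge0; exact: cone_scale.
  by rewrite normrZ u1 w1 !mulr1 gtr0_norm.
have wau : `|w - a *: u| <= D ^+ 2 * (expR t - 1).
  have : `|w - a *: u| <= D * `|(b - a) *: u|.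
    apply: nD; last first.
      by rewrite scalerBl; apply: cone_le_add wb _; exact: cone_le_refl.
    apply: (@cone_le_trans 0); last by rewrite cone_subr_ge0.
    rewrite -oppr0; apply: cone_le_opp; apply: cone0_scale.
      by rewrite subr_ge0.
    exact: cone_ge0.
  move=> /le_trans; apply.
  rewrite normrZ u1 mulr1 ger0_norm ?subr_ge0// expr2 -mulrA ler_wpM2l//.
  rewrite (@le_trans _ _ (a * (expR t - 1)))//.
    by move: ba; rewrite mulrBr mulr1 lerD2r mulrC.
  by rewrite ler_wpM2r// subr_ge0 -[leLHS]expR0 ler_expR;
    apply: (@prox_ge0 t u w) => //; exists a, b; split.
have au : `|(a - 1) *: u| <= D ^+ 2 * (expR t - 1).
  apply: le_trans wau; rewrite normrZ u1 mulr1.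
  have -> : a - 1 = `|a *: u| - `|w| by rewrite w1 normrZ u1 gtr0_norm// mulr1.
  by rewrite (distrC w); exact: ler_dist_dist.
rewrite -mulrA mulr2n mulrDl mul1r.
have -> : u - w = - (w - a *: u) - (a - 1) *: u.
  by rewrite opprB scalerBl scale1r opprB [RHS]addrC addrA subrK.
by rewrite (le_trans (ler_normB _ _))// lerD// normrN.
Qed.

End cone_order.

(** * The scalar inequality behind the factor tanh(Delta / 4) *)

Section birkhoff_inequality.
Context {R : realType}.
Implicit Types (s t p h D : R).

Lemma is_derive_ln1expR s (x : R) : 0 < s ->
  is_derive x 1 (fun y => ln (1 + s * expR y)) (s * expR x / (1 + s * expR x)).
Proof.
move=> s0; have p0 : 0 < 1 + s * expR x by rewrite addr_gt0// mulr_gt0// expR_gt0.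
have d1 := is_derive1_ln p0.
have d2 : is_derive x 1 (fun y => 1 + s * expR y) (s * expR x).
  have -> : s * expR x = 0 + s *: expR x by rewrite add0r.
  by apply: is_deriveD; apply: is_deriveZ.
have := @is_derive1_comp _ (@ln R) (fun y => 1 + s * expR y) x _ _ d1 d2.
by rewrite mulrC.
Qed.

(** The right side minus the left side is a nonnegative multiple of [(1 - h p) ^ 2]: the bound is
    the maximum over [p], reached at [p = 1 / h]. *)
Lemma birkhoff_rate p h : 0 < p -> 1 <= h ->
  h ^+ 2 * p / (1 + h ^+ 2 * p) - p / (1 + p) <= (h - 1) / (h + 1).
Proof.
move=> p0 h1.
have d1 : 0 < 1 + h ^+ 2 * p by rewrite addr_gt0// mulr_gt0// exprn_gt0; lra.
have d2 : 0 < 1 + p by lra.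
have d3 : 0 < h + 1 by lra.
rewrite -subr_ge0.
have -> : (h - 1) / (h + 1) - (h ^+ 2 * p / (1 + h ^+ 2 * p) - p / (1 + p)) =
   (h - 1) * (1 - h * p) ^+ 2 / ((h + 1) * ((1 + h ^+ 2 * p) * (1 + p))).
  by field; do ?[apply/andP; split]; rewrite gt_eqF.
apply: divr_ge0; first by rewrite mulr_ge0 ?sqr_ge0// subr_ge0.
by rewrite !mulr_ge0// ltW.
Qed.

(** Puts the Birkhoff coefficient in the form of the bound of [birkhoff_rate], with
    [h = e^(t / 2)]. *)
Lemma tanhE t : tanh (t / 4) = (expR (t / 2) - 1) / (expR (t / 2) + 1).
Proof.
rewrite /tanh expRN.
have -> : t / 2 = t / 4 + t / 4 by field.
rewrite expRD; have g0 := expR_gt0 (t / 4).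
move: (expR _) g0 => g g0.
have g1 : 0 < g * g + 1 by rewrite addr_gt0// mulr_gt0.
have g2 : g + g^-1 != 0 by rewrite gt_eqF// addr_gt0// invr_gt0.
by field; rewrite !gt_eqF.
Qed.

Lemma tanh_itv t : 0 < t -> 0 < tanh t < 1.
Proof.
move=> t0; rewrite /tanh; have g1 : 1 < expR t by rewrite expR_gt1.
have g2 : 0 < expR (- t) := expR_gt0 _.
have g3 : expR (- t) < 1 by rewrite expR_lt1 oppr_lt0.
have d : 0 < expR t + expR (- t) by lra.
by rewrite divr_gt0 ?ltr_pdivrMr//=; lra.
Qed.

(** For [t = e^Delta s], the function [ln (1 + t e^x) - ln (1 + s e^x)] has slope at most
    [tanh (Delta / 4)] by [birkhoff_rate]; its increment over [[0, D]], exponentiated, is the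
    inequality. *)
Lemma birkhoff_ineq s t D Delta : 0 < s -> 0 <= t -> t <= expR Delta * s ->
  0 <= Delta -> 0 <= D ->
  (1 + t * expR D) * (1 + s) <=
    expR (tanh (Delta / 4) * D) * ((1 + t) * (1 + s * expR D)).
Proof.
move=> s0 t0 ts De0 D0.
have M1 : 1 <= expR D by rewrite -[leLHS]expR0 ler_expR.
have s1 : 0 < 1 + s by lra.
pose t' := expR Delta * s.
have t'0 : 0 < t' by rewrite mulr_gt0// expR_gt0.
have p1 (q : R) x : 0 < q -> 0 < 1 + q * expR x.
  by move=> q0; rewrite addr_gt0// mulr_gt0// expR_gt0.
(* The ratio [(1 + t e^D) / (1 + t)] increases with [t], so the extreme value [t' = e^Delta s] is
   the worst case. *)
suff main : (1 + t' * expR D) * (1 + s) <=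
    expR (tanh (Delta / 4) * D) * ((1 + t') * (1 + s * expR D)).
  have tt' : (1 + t * expR D) * (1 + t') <= (1 + t' * expR D) * (1 + t).
    have : 0 <= (t' - t) * (expR D - 1) by rewrite mulr_ge0// subr_ge0.
    lra.
  have t1 : 0 < 1 + t by lra.
  have t'1 : 0 < 1 + t' by lra.
  rewrite -(ler_pM2r t'1) mulrAC (le_trans (ler_wpM2r (ltW s1) tt'))//.
  rewrite mulrAC (le_trans (ler_wpM2r (ltW t1) main))//.
  by rewrite le_eqVlt -subr_eq0; apply/orP; left; apply/eqP; ring.
pose H x := tanh (Delta / 4) * x + ln (1 + s * expR x) - ln (1 + t' * expR x).
have dH (x : R) : is_derive x 1 H (tanh (Delta / 4) + s * expR x / (1 + s * expR x) -
    t' * expR x / (1 + t' * expR x)).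
  have dl : is_derive x 1 (fun y => tanh (Delta / 4) * y) (tanh (Delta / 4)).
    by rewrite -[X in is_derive _ _ _ X]mulr1; apply: is_deriveZ.
  apply: is_deriveB; last exact: is_derive_ln1expR.
  by apply: is_deriveD; exact: is_derive_ln1expR.
have : H 0 <= H D.
  apply: (@ger0_derive1_le_cc _ H 0 D); rewrite ?bound_itvE//.
  - move=> x _; rewrite derive1E; have [_ ->] := dH x; rewrite tanhE.
    pose h := expR (Delta / 2).
    have h1 : 1 <= h by rewrite -[leLHS]expR0 ler_expR divr_ge0.
    have -> : t' = h ^+ 2 * s.
      by rewrite /t' /h expr2 -expRD; congr (expR _ * _); field.
    have := @birkhoff_rate (s * expR x) h (mulr_gt0 s0 (expR_gt0 x)) h1.
    rewrite -/h (mulrA (h ^+ 2)); lra.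
  - apply: continuous_subspaceT => x; apply: differentiable_continuous.
    by apply/derivable1_diffP; have [] := dH x.
have q1 (q : R) : 0 < q -> 0 < 1 + q by move=> ?; lra.
rewrite /H expR0 !mulr1 mulr0 add0r => H0D.
have : ln (1 + t' * expR D) + ln (1 + s) <=
  tanh (Delta / 4) * D + (ln (1 + t') + ln (1 + s * expR D)) by lra.
have sD := p1 s D s0; have tD := p1 t' D t'0; have t1 := q1 _ t'0.
rewrite -[in X in X -> _](expRK (tanh _ * D)) -!lnM ?posrE ?mulr_gt0 ?expR_gt0//.
by rewrite ler_ln ?posrE ?mulr_gt0 ?expR_gt0.
Qed.

End birkhoff_inequality.

(** * Contraction of the projective metric by cone maps *)

Section contraction.
Context {R : realType} {X : normedModType R} (C : set X).
Hypothesis nC : nice_cone C.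
Implicit Types (x y z u w : X) (a b t : R) (T : bop X X).

Local Notation "x <=c y" := (cone_le C x y) (at level 70).

Lemma prox_eqscale t u w c : 0 < c -> 0 <= t -> w = c *: u -> prox C t u w.
Proof.
move=> c0 t0 ->; exists c, c; split => //; try exact: cone_le_refl.
by rewrite ler_peMl ?(ltW c0)// -[leLHS]expR0 ler_expR.
Qed.

Lemma cone_mono T x y : (forall z, C z -> C (T z)) -> x <=c y -> T x <=c T y.
Proof.
move=> TC [Cyx|/eqP]; first by left; rewrite -linearB; exact: TC.
by rewrite subr_eq0 => /eqP ->; exact: cone_le_refl.
Qed.

Lemma prox_map T t u w : (forall z, C z -> C (T z)) ->
  prox C t u w -> prox C t (T u) (T w).
Proof.
move=> TC [a [b [a0 aw wb ba]]]; exists a, b.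
by split => //; rewrite -linearZ; exact: cone_mono.
Qed.

Lemma cone_comb_id a b s x y :
  y - a *: x - s *: (b *: x - y) = (1 + s) *: y - (a + s * b) *: x.
Proof.
rewrite scalerBr opprB !scalerDl scale1r scalerA opprD.
by rewrite addrACA [- _ - _]addrC.
Qed.

(** Collecting the terms in [y] turns a comparison of the two gaps [y - a x] and [b x - y] into a
    comparison of [y] with [x] times the mean of [a] and [b] of weights 1 and [s]. *)
Lemma cone_comb a b s x y : 0 < 1 + s -> s *: (b *: x - y) <=c y - a *: x ->
  ((1 + s)^-1 * (a + s * b)) *: x <=c y.
Proof.
move=> s0; rewrite -(cone_subr_ge0 _ (s *: _)) cone_comb_id.
rewrite cone_subr_ge0 -scalerA => /(@cone_le_scale _ _ _ nC (1 + s)^-1).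
by rewrite [_ *: (_ *: y)]scalerA mulVf ?gt_eqF// scale1r invr_ge0; apply; exact: ltW.
Qed.

Lemma cone_comb' a b s x y : 0 < 1 + s -> y - a *: x <=c s *: (b *: x - y) ->
  y <=c ((1 + s)^-1 * (a + s * b)) *: x.
Proof.
move=> s0; rewrite -(cone_subr_ge0 _ (y - _)).
rewrite -opprB cone_comb_id opprB.
rewrite cone_subr_ge0 => /(@cone_le_scale _ _ _ nC (1 + s)^-1).
by rewrite !scalerA mulVf ?gt_eqF// scale1r invr_ge0; apply; exact: ltW.
Qed.

(* The theta-diameter of [T @` C] is at most [d]. *)
Definition cone_bounded T d := forall u w, C u -> C w -> prox C d (T u) (T w).

Definition cone_contracts T c := forall u w t, C u -> C w ->
  prox C t u w -> prox C (c * t) (T u) (T w).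

(** The diameter bound is applied to the two gaps [b u - w] and [w - a u]: the scalars [s] and [t]
    comparing their images place [T w] between the multiples of [T u] by the means
    [(a + s b) / (1 + s)] and [(a + t b) / (1 + t)]. As [t <= e^Delta s], [birkhoff_ineq] at
    [ln (b / a)] bounds the quotient of these means. *)
Lemma birkhoff_contraction T Delta : 0 <= Delta -> (forall z, C z -> C (T z)) ->
  cone_bounded T Delta -> cone_contracts T (tanh (Delta / 4)).
Proof.
move=> De0 TC bT u w D Cu Cw uw; have D0 := prox_ge0 nC Cu uw.
have k0 : 0 <= tanh (Delta / 4) :> R.
  have [<-|d0] := eqVneq 0 Delta; first by rewrite mul0r /tanh oppr0 subrr mul0r.
  have /(@tanh_itv R)/andP[/ltW//] : 0 < Delta / 4.
  by rewrite divr_gt0// lt_neqAle d0.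
have [a [b [a0 ab aw wb ba]]] := prox_ratio nC Cu uw.
have b0 := lt_le_trans a0 ab.
(* A gap that vanishes is outside the cone; [w] is then a multiple of [u] and there is nothing to
   contract. *)
case: (aw) => [Cp|/eqP]; last first.
  rewrite subr_eq0 => /eqP ->; apply: (@prox_eqscale _ _ _ a) => //.
    exact: mulr_ge0.
  by rewrite linearZ.
case: (wb) => [Cq|/eqP]; last first.
  rewrite subr_eq0 => /eqP <-; apply: (@prox_eqscale _ _ _ b) => //.
    exact: mulr_ge0.
  by rewrite linearZ.
have [s [t [s0 st]]] := prox_ratio nC (TC _ Cq) (bT _ _ Cq Cp).
have -> : T (w - a *: u) = T w - a *: T u by rewrite linearB linearZ.
have -> : T (b *: u - w) = b *: T u - T w by rewrite linearB linearZ.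
move=> h1 h2 ts.
have s1 : 0 < 1 + s by rewrite addr_gt0.
have t0 := lt_le_trans s0 st.
have t1 : 0 < 1 + t by rewrite addr_gt0.
exists ((1 + s)^-1 * (a + s * b)), ((1 + t)^-1 * (a + t * b)); split.
- by rewrite mulr_gt0 ?invr_gt0// addr_gt0// mulr_gt0.
- exact: cone_comb.
- exact: cone_comb'.
have ab1 : 1 <= b / a by rewrite ler_pdivlMr// mul1r.
have ab0 : 0 < b / a := lt_le_trans ltr01 ab1.
have := birkhoff_ineq s0 (ltW t0) ts De0 (ln_ge0 ab1).
rewrite lnK ?posrE// => key.
have {key} : (a + t * b) * (1 + s) <=
    expR (tanh (Delta / 4) * ln (b / a)) * ((1 + t) * (a + s * b)).
  rewrite -(ler_pM2r a0) in key; apply: le_trans (le_trans _ key) _.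
    by rewrite le_eqVlt -subr_eq0; apply/orP; left; apply/eqP; field; rewrite gt_eqF.
  by rewrite le_eqVlt -subr_eq0; apply/orP; left; apply/eqP; field; rewrite gt_eqF.
set E := expR _ => key.
have EE : E <= expR (tanh (Delta / 4) * D).
  rewrite ler_expR ler_wpM2l//.
  by rewrite -(expRK D) ler_ln ?posrE ?expR_gt0// ler_pdivrMr.
apply: (@le_trans _ _ (E * ((1 + s)^-1 * (a + s * b)))); last first.
  apply: ler_wpM2r EE; rewrite mulr_ge0 ?invr_ge0 ?addr_ge0 ?mulr_ge0 // ltW//.
rewrite mulrC ler_pdivrMr// -(ler_pM2r s1) (le_trans key)//.
by rewrite le_eqVlt -subr_eq0; apply/orP; left; apply/eqP; field; rewrite gt_eqF.
Qed.

(** Since the cone with 0 is closed, the supremum [alpha] and the infimum [beta] are attained and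
    serve as the two scalars. If [alpha] were infinite, [- u], as the limit of [w / n - u], would be
    in the cone with 0. *)
Lemma cone_theta_prox d u w : C u -> C w ->
  (cone_theta C u w <= d%:E)%E -> prox C d u w.
Proof.
move=> Cu Cw; rewrite /cone_theta; case: ifPn => [_|]; first by rewrite leye_eq.
rewrite negb_or => /andP[a0 bo].
have alpha0 : (0 <= cone_alpha C u w)%E.
  apply: ereal_sup_ubound; exists 0 => //=; split => //.
  by rewrite scale0r; exact: cone_ge0.
have beta0 : (0 <= cone_beta C u w)%E.
  by apply: le_ereal_inf_tmp => _ [b [b0 _] <-]; rewrite lee_fin.
have cvgZ (e : nat -> R) (r : R) (z : X) : e @ \oo --> r -> e n *: z @[n --> \oo] --> r *: z.
  by move=> er; apply: cvgZr_tmp.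
have [a aE] : exists a, cone_alpha C u w = a%:E.
  case E : (cone_alpha C u w) alpha0 => [a||]// _; first by exists a.
  have h n : exists2 l : R, n%:R < l & l *: u <=c w.
    have : (n%:R%:E < cone_alpha C u w)%E by rewrite E ltry.
    by move=> /ereal_sup_gt[_ [l [l0 luw] <-]]; rewrite lte_fin; exists l.
  have [] := cone_lt_irrefl nC Cu.
  rewrite -(cone_subr_ge0 _ u) sub0r.
  have cv : n.+1%:R^-1 *: w - u @[n --> \oo] --> - u.
    rewrite -[X in _ --> X]add0r -(scale0r w); apply: cvgD; last exact: cvg_cst.
    by apply: cvgZ; exact: cvg_harmonic.
  apply: (closed_cvg _ (cone_closed nC) _ _ cv).
  apply: nearW => n /=; have [l nl luw] := h n.+1.
  have -> : n.+1%:R^-1 *: w - u = n.+1%:R^-1 *: (w - n.+1%:R *: u).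
    by rewrite scalerBr scalerA mulVf// scale1r.
  apply: (cone0_scale nC); rewrite ?invr_ge0// cone_subr_ge0.
  apply: (cone_le_trans nC) luw; apply: cone_le_scalel (ltW nl) => //.
  exact: cone_ge0.
have [b bE] : exists b, cone_beta C u w = b%:E.
  by case E : (cone_beta C u w) bo beta0 => [b||]//; exists b.
rewrite aE bE in a0 bo alpha0 beta0 *.
rewrite eqe in a0; rewrite lee_fin in alpha0; rewrite lee_fin in beta0.
have a_gt0 : 0 < a by rewrite lt_neqAle eq_sym a0.
have aw : a *: u <=c w.
  rewrite -cone_subr_ge0.
  have h n : exists2 l : R, a - n.+1%:R^-1 < l & l *: u <=c w.
    have : ((a - n.+1%:R^-1)%:E < cone_alpha C u w)%E by rewrite aE lte_fin gtrBl.
    by move=> /ereal_sup_gt[_ [l [l0 luw] <-]]; rewrite lte_fin; exists l.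
  have cv : w - (a - n.+1%:R^-1) *: u @[n --> \oo] --> w - a *: u.
    apply: cvgB; first exact: cvg_cst.
    apply: cvgZ; rewrite -[X in _ --> X]subr0; apply: cvgB; first exact: cvg_cst.
    exact: cvg_harmonic.
  apply: (closed_cvg _ (cone_closed nC) _ _ cv); apply: nearW => n /=.
  rewrite cone_subr_ge0; have [l nl luw] := h n.
  apply: (cone_le_trans nC) luw; apply: cone_le_scalel (ltW nl) => //.
  exact: cone_ge0.
have wb : w <=c b *: u.
  rewrite -cone_subr_ge0.
  have h n : exists2 l : R, l < b + n.+1%:R^-1 & w <=c l *: u.
    have : (cone_beta C u w < (b + n.+1%:R^-1)%:E)%E by rewrite bE lte_fin ltrDl.
    by move=> /ereal_inf_lt[_ [l [l0 luw] <-]]; rewrite lte_fin; exists l.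
  have cv : (b + n.+1%:R^-1) *: u - w @[n --> \oo] --> b *: u - w.
    apply: cvgB; last exact: cvg_cst.
    apply: cvgZ; rewrite -[X in _ --> X]addr0; apply: cvgD; first exact: cvg_cst.
    exact: cvg_harmonic.
  apply: (closed_cvg _ (cone_closed nC) _ _ cv); apply: nearW => n /=.
  rewrite cone_subr_ge0; have [l nl luw] := h n.
  apply: (cone_le_trans nC) luw _; apply: cone_le_scalel (ltW nl) => //.
  exact: cone_ge0.
have b_gt0 : 0 < b.
  exact: lt_le_trans a_gt0 (cone_lemm nC Cu (cone_le_trans nC aw wb)).
rewrite inver (negbTE a0) -EFinM lne_EFin ?divr_gt0// lee_fin => lnd.
exists a, b; split => //.
by rewrite -ler_pdivrMr// -[leLHS]lnK ?posrE ?divr_gt0// ler_expR.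
Qed.

Lemma cone_diam_bounded T d :
  (forall z, C z -> C (T z)) -> (cone_diam C (T @` C) <= d%:E)%E -> cone_bounded T d.
Proof.
move=> TC dT u w Cu Cw; apply: cone_theta_prox; [exact: TC|exact: TC|].
apply: le_trans dT; apply: ereal_sup_ubound.
by exists (T u, T w) => //=; split; [exists u|exists w].
Qed.

End contraction.

(** * Nonflatness of generating cones *)

Section nonflat.
Context {R : realType} {X : completeNormedModType R}.

Lemma geometric_series_cvg (u : nat -> X) (c : R) : 0 <= c ->
  (forall n, `|u n| <= c * 2^-1 ^+ n) ->
  exists2 l, series u @ \oo --> l & `|l| <= 2 * c.
Proof.
move=> c0 uc; have h1 : `|2^-1 : R| < 1 by rewrite ger0_norm ?invr_ge0//; lra.
have cg := @cvg_geometric_series R c 2^-1 h1.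
have cl : c * (1 - 2^-1)^-1 = 2 * c by field.
have cn : cvgn [normed series u].
  apply: (@series_le_cvg _ _ (geometric c 2^-1)) => //=.
    by move=> n; rewrite mulr_ge0// exprn_ge0// invr_ge0.
  by apply/cvg_ex; exists (c * (1 - 2^-1)^-1).
have cu := normed_cvg cn.
exists (limn (series u)) => //; rewrite -cl.
rewrite -(cvg_lim _ cg)// -lim_norm//.
apply: ler_lim; [exact: is_cvg_norm|by apply/cvg_ex; exists (c * (1 - 2^-1)^-1)|].
apply: nearW => n /=; rewrite /series/= (le_trans (ler_norm_sum _ _ _))//.
exact: ler_sum.
Qed.

Lemma subrACA (a b p q : X) : a - p - (b - q) = a - b - (p - q).
Proof. by rewrite !opprB addrACA [RHS]addrACA [- p - b]addrC. Qed.

Context (C : set X).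
Hypothesis nC : nice_cone C.
Local Notation "x <=c y" := (cone_le C x y) (at level 70).

Let B (n : nat) : set X := [set x | exists y z,
  [/\ 0 <=c y, 0 <=c z, x = y - z, `|y| <= n%:R & `|z| <= n%:R]].

Let closure_ball : exists n x0 r, 0 < r /\ ball (x0 : X) r `<=` closure (B n).
Proof.
apply: contrapT => H.
have /Baire/(_ setT) [] : forall n, open (~` closure (B n)) /\ dense (~` closure (B n)).
- move=> n; split; first by rewrite openC; exact: closed_closure.
  move=> O [x Ox] oO; apply: contrapT => OB; apply: H.
  have : nbhs x O by exact: open_nbhs_nbhs.
  move=> /nbhs_ballP[r /= r0 rO]; exists n, x, r; split => // y /rO Oy.
  by apply: contrapT => By; apply: OB; exists y.
- by exists 0.
- exact: openT.
move=> x [_ xB]; have [_ _ _ _ [_ /(_ x)[y [z [Cy Cz xyz]]] _]] := nC.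
pose n := Num.bound (`|y| + `|z|).
have : `|y| + `|z| < n%:R := archi_boundP (addr_ge0 (normr_ge0 y) (normr_ge0 z)).
move=> yzn; have := normr_ge0 y; have := normr_ge0 z => z0 y0.
apply: (xB n) => //; apply: subset_closure; exists y, z; split => //.
- exact: cone_ge0.
- exact: cone_ge0.
- lra.
- lra.
Qed.

(** Differences of bounded cone vectors form a symmetric convex set, so density in some ball gives
    density in the ball of the same radius about 0; scaling then approximates any [x] within half
    its norm. *)
Let approx : exists2 M : R, 0 < M & forall x, exists p : X * X,
  [/\ 0 <=c p.1, 0 <=c p.2, `|p.1| <= M * `|x|, `|p.2| <= M * `|x| &
      `|x - (p.1 - p.2)| <= `|x| / 2].
Proof.
have [n [x0 [r [r0 rB]]]] := closure_ball.
have nearB x e : 0 < e -> ball x0 r x -> exists2 b, B n b & `|x - b| < e.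
  move=> e0 /rB /(_ (ball x e)) [|b [Bb xb]]; first exact: nbhsx_ballx.
  by exists b => //; move: xb; rewrite -ball_normE.
have appr u e : 0 < e -> `|u| < r -> exists2 b, B n b & `|u - b| < e.
  move=> e0 ur.
  have [|b1 [y1 [z1 [y10 z10 -> y1n z1n]]] h1] := nearB (x0 + u) _ e0.
    by rewrite -ball_normE/= opprD addNKr normrN.
  have [|b2 [y2 [z2 [y20 z20 -> y2n z2n]]] h2] := nearB (x0 - u) _ e0.
    by rewrite -ball_normE/= opprB addrC subrK.
  have n2 (y z : X) : `|y| <= n%:R -> `|z| <= n%:R -> `|2^-1 *: (y + z)| <= n%:R.
    move=> yn zn; rewrite normrZ ger0_norm ?invr_ge0//.
    by have := ler_normD y z; lra.
  (* Half the difference of the approximations of [x0 + u] and [x0 - u]; the regrouping into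
     [y1 + z2] and [z1 + y2] keeps both parts nonnegative and of norm at most [n]. *)
  exists (2^-1 *: (y1 + z2) - 2^-1 *: (z1 + y2)).
    exists (2^-1 *: (y1 + z2)), (2^-1 *: (z1 + y2)); split => //.
    - by apply: (cone0_scale nC); rewrite ?invr_ge0//; exact: cone0_add.
    - by apply: (cone0_scale nC); rewrite ?invr_ge0//; exact: cone0_add.
    - exact: n2.
    - exact: n2.
  have -> : u - (2^-1 *: (y1 + z2) - 2^-1 *: (z1 + y2)) =
      2^-1 *: ((x0 + u - (y1 - z1)) - (x0 - u - (y2 - z2))).
    have -> : x0 + u - (y1 - z1) - (x0 - u - (y2 - z2)) =
        2 *: u - ((y1 + z2) - (z1 + y2)).
      rewrite subrACA opprB [x0 + u + _]addrC addrA subrK scaler_nat mulr2n.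
      by congr (_ - _); rewrite opprB addrACA opprD.
    by rewrite scalerBr scalerA mulVf// scale1r scalerBr.
  rewrite normrZ ger0_norm ?invr_ge0//.
  have := ler_normB (x0 + u - (y1 - z1)) (x0 - u - (y2 - z2)); lra.
(* Dividing [x] by [2 |x| / r] brings it into the ball of radius [r], whence [2 n / r]; the 1 makes
   the constant positive even for [n = 0]. *)
exists (2 * n%:R / r + 1).
  by rewrite ltr_wpDl// divr_ge0// ?ltW// mulr_ge0.
move=> x; have [->|x0'] := eqVneq x 0.
  exists (0, 0) => /=; rewrite !normr0 !mulr0 subrr subr0 normr0 mul0r.
  by split => //; exact: cone_le_refl.
have nx : 0 < `|x| by rewrite normr_gt0.
pose k := 2 * `|x| / r; have k0 : 0 < k by rewrite divr_gt0// mulr_gt0.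
have kN : `|k^-1| = k^-1 by rewrite ger0_norm// invr_ge0 ltW.
have [||b [y [z [y0 z0 -> yn zn]]] h] := appr (k^-1 *: x) (k^-1 * (`|x| / 2)).
- by rewrite mulr_gt0 ?invr_gt0// divr_gt0.
- rewrite normrZ kN /k invf_div mulrAC ltr_pdivrMr ?mulr_gt0//; nra.
have M1 : k * n%:R <= (2 * n%:R / r + 1) * `|x|.
  have -> : k * n%:R = 2 * n%:R / r * `|x| by rewrite /k; ring.
  by rewrite mulrDl mul1r; have := ltW nx; lra.
exists (k *: y, k *: z) => /=; split.
- exact: cone0_scale (ltW k0) _.
- exact: cone0_scale (ltW k0) _.
- by rewrite normrZ gtr0_norm// (le_trans _ M1)// ler_pM2l.
- by rewrite normrZ gtr0_norm// (le_trans _ M1)// ler_pM2l.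
- have -> : x - (k *: y - k *: z) = k *: (k^-1 *: x - (y - z)).
    by rewrite 2!scalerBr scalerA divff ?gt_eqF// scale1r.
  by rewrite normrZ gtr0_norm// -ler_pdivlMl// ltW.
Qed.

(* Baire's theorem: the differences of elements of the cone of norm at most n
   are dense in some ball, and successive approximation makes this exact. *)
Lemma cone_nonflat : exists2 K : R, 0 < K & forall x, exists y z,
  [/\ 0 <=c y, 0 <=c z, x = y - z, `|y| <= K * `|x| & `|z| <= K * `|x|].
Proof.
have [M M0 /choice[f fP]] := approx.
exists (2 * M); first by rewrite mulr_gt0.
(* [u n] is what remains of [x] after [n] approximations; the bound on its norm halves each time. *)
move=> x; pose u := fix u n := if n is m.+1 then u m - ((f (u m)).1 - (f (u m)).2) else x.
have ux n : `|u n| <= `|x| * 2^-1 ^+ n.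
  elim: n => [|n ih]/=; first by rewrite expr0 mulr1.
  have [_ _ _ _ /le_trans] := fP (u n); apply.
  by rewrite exprSr mulrA ler_pM2r ?invr_gt0.
have c0 : 0 <= M * `|x| by rewrite mulr_ge0// ltW.
have [|y cy yb] := @geometric_series_cvg (fun n => (f (u n)).1) _ c0.
  by move=> n; have [_ _ /le_trans + _ _] := fP (u n); apply; rewrite -mulrA ler_pM2l.
have [|z cz zb] := @geometric_series_cvg (fun n => (f (u n)).2) _ c0.
  by move=> n; have [_ _ _ /le_trans + _] := fP (u n); apply; rewrite -mulrA ler_pM2l.
have s0 (g : nat -> X) l : (forall n, 0 <=c g n) -> series g @ \oo --> l -> 0 <=c l.
  move=> g0 gl; apply: (closed_cvg _ (cone_closed nC) _ _ gl); apply: nearW => n /=.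
  elim: n => [|n ih]; first by rewrite /series/= big_geq//; exact: cone_le_refl.
  by rewrite /series/= big_nat_recr//=; exact: cone0_add.
exists y, z; split; rewrite -?mulrA//.
- by apply: s0 cy => n; have [] := fP (u n).
- by apply: s0 cz => n; have [] := fP (u n).
have uE n : series (fun n => (f (u n)).1) n - series (fun n => (f (u n)).2) n = x - u n.
  elim: n => [|n ih]; first by rewrite /series/= !big_geq// !subrr.
  rewrite /series/= !big_nat_recr//= opprD addrACA.
  by move: ih; rewrite /series/= => ->; rewrite [in RHS]opprD opprK !addrA.
have cu : u @ \oo --> 0.
  apply: norm_cvg0.
  have h1 : `|2^-1 : R| < 1 by rewrite ger0_norm ?invr_ge0//; lra.
  apply: (@squeeze_cvgr _ _ _ _ (cst 0) (geometric `|x| 2^-1)).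
  - by apply: nearW => n /=; rewrite normr_ge0 ux.
  - exact: cvg_cst.
  - exact: cvg_geometric.
have h : x - u n @[n --> \oo] --> y - z.
  rewrite (_ : (fun n => x - u n) = (fun n => series (fun n => (f (u n)).1) n -
    series (fun n => (f (u n)).2) n)); first exact: cvgB.
  by apply/funext => n; rewrite -uE.
have : x - u n @[n --> \oo] --> x - 0 by apply: cvgB => //; exact: cvg_cst.
rewrite subr0 => h'.
by apply: (@cvg_unique _ (@norm_hausdorff _ X) _ _ _ _ h' h).
Qed.

End nonflat.

(** * The ergodic theorem *)

Section birkhoff_sums.
Context {T : Type} {R : realType} (s : T -> T).
Implicit Types (f : T -> R) (x : T).

Definition birkhoff_sum f n x := \sum_(i < n) f (iter i s x).

Lemma birkhoff_sum0 f x : birkhoff_sum f 0 x = 0.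
Proof. by rewrite /birkhoff_sum big_ord0. Qed.

Lemma birkhoff_sumS f n x :
  birkhoff_sum f n.+1 x = f x + birkhoff_sum f n (s x).
Proof.
rewrite /birkhoff_sum big_ord_recl; congr (_ + _).
by apply: eq_bigr => i _; rewrite -iterSr.
Qed.

Lemma birkhoff_sumD f m n x :
  birkhoff_sum f (m + n) x = birkhoff_sum f m x + birkhoff_sum f n (iter m s x).
Proof.
elim: m x => [|m ih] x; first by rewrite birkhoff_sum0 add0r.
by rewrite addSn 2!birkhoff_sumS ih addrA iterSr.
Qed.

Lemma birkhoff_sum_ge0 f n x : (forall y, 0 <= f y) -> 0 <= birkhoff_sum f n x.
Proof. by move=> f0; exact: sumr_ge0. Qed.

End birkhoff_sums.

(** * The maximal ergodic lemma *)

Section birkhoff_theorem.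
Context d (T : measurableType d) (R : realType) (mu : probability T R).
Variable s : T -> T.
Hypothesis ms : measurable_fun setT s.
Hypothesis invs : forall A, measurable A -> mu (s @^-1` A) = mu A.

Lemma measurable_preimageT A : measurable A -> measurable (s @^-1` A).
Proof. by move=> mA; rewrite -[_ @^-1` _]setTI; exact: ms. Qed.

Lemma measurable_iter n : measurable_fun setT (iter n s).
Proof.
elim: n => [|n ih]; first exact: measurable_id.
by rewrite (_ : iter n.+1 s = s \o iter n s)//; exact: measurableT_comp.
Qed.

Lemma mpt_iter n A : measurable A -> mu (iter n s @^-1` A) = mu A.
Proof.
elim: n A => [//|n ih] A mA.
have -> : iter n.+1 s @^-1` A = iter n s @^-1` (s @^-1` A) by [].
by rewrite ih ?invs//; exact: measurable_preimageT.
Qed.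

Lemma ge0_integral_mpt (f : T -> \bar R) : measurable_fun setT f ->
  (forall x, 0 <= f x)%E ->
  (\int[mu]_x f (s x) = \int[mu]_x f x)%E.
Proof.
move=> mf f0.
have := @ge0_integral_pushforward _ _ T T R s ms mu setT f measurableT mf (in1W f0).
rewrite preimage_setT => <-.
by apply: eq_measure_integral => A mA _; exact: invs.
Qed.

Lemma integrable_mpt (f : T -> \bar R) :
  mu.-integrable setT f -> mu.-integrable setT (f \o s).
Proof.
move=> /integrableP[mf foo]; apply/integrableP; split.
  exact: measurableT_comp.
rewrite (@ge0_integral_mpt (fun x => `|f x|)%E)//.
exact: measurableT_comp.
Qed.

Lemma integral_mpt (f : T -> \bar R) : mu.-integrable setT f ->
  (\int[mu]_x f (s x) = \int[mu]_x f x)%E.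
Proof.
move=> fi; have mf : measurable_fun setT f by case/integrableP : fi.
have := @integral_pushforward _ _ T T R s ms mu setT f mf.
rewrite preimage_setT => /(_ (integrable_mpt fi) measurableT) <-.
by apply: eq_measure_integral => A mA _; exact: invs.
Qed.

(** The maximum of the Birkhoff sums of lengths 0 to [n]: those of positive length start with [f x]
    and continue along the orbit of [s x]. *)
Fixpoint max_birkhoff (f : T -> R) n x : R :=
  if n is m.+1 then Num.max 0 (f x + max_birkhoff f m (s x)) else 0.

Variable f : T -> R.
Hypothesis intf : mu.-integrable setT (EFin \o f).

Let M := max_birkhoff f.

Let M_ge0 n x : 0 <= M n x.
Proof. by case: n => [|n]//=; rewrite /M /= le_max lexx. Qed.

Let M_S n x : M n.+1 x = Num.max 0 (f x + M n (s x)).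
Proof. by []. Qed.

Let M_leS n x : M n x <= M n.+1 x.
Proof.
elim: n x => [|n ih] x; first exact: M_ge0.
rewrite !M_S ge_max !le_max lexx/=.
by apply/orP; right; rewrite lerD2l ih.
Qed.

Let M_le m n x : (m <= n)%N -> M m x <= M n x.
Proof. by move=> mn; apply: (homo_leq (@lexx _ _) le_trans (fun k => M_leS k x)). Qed.

Let sum_le_M n x : birkhoff_sum s f n x <= M n x.
Proof.
elim: n x => [|n ih] x; first by rewrite /birkhoff_sum big_ord0.
by rewrite birkhoff_sumS M_S le_max lerD2l ih orbT.
Qed.

Let mf : measurable_fun setT f.
Proof. by apply/measurable_EFinP; case/integrableP : intf. Qed.

Let mM n : measurable_fun setT (M n).
Proof.
elim: n => [|n ih]; first exact: measurable_cst.
apply: measurable_maxr; first exact: measurable_cst.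
by apply: measurable_funD => //; apply: measurableT_comp ms.
Qed.

Let intM n : mu.-integrable setT (EFin \o M n).
Proof.
elim: n => [|n ih]; first exact: integrable0.
apply: (@le_integrable _ _ _ _ _ _ _
    (fun x => `|(f x)%:E| + `|(M n (s x))%:E|)%E) => //.
- exact/measurable_EFinP/mM.
- move=> x _ /=; rewrite lee_fin M_S (ger0_norm (addr_ge0 _ _))//.
  rewrite ger0_norm ?le_max ?lexx// ge_max addr_ge0//= lerD//; exact: ler_norm.
- apply: integrableD => //; apply: integrable_abse => //.
  exact: (integrable_mpt ih).
Qed.

Let A : set T := [set x | forall B : nat, exists n, B%:R < M n x].

Let mA : measurable A.
Proof.
have -> : A = \bigcap_B \bigcup_n [set x | B%:R < M n x].
  apply/seteqP; split=> x /= Ax B; first by have [n] := Ax B; exists n.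
  by have [n _] := Ax B I; exists n.
apply: bigcapT_measurable => B; apply: bigcupT_measurable => n.
rewrite -[X in measurable X]setTI.
have -> : [set x | B%:R < M n x] = M n @^-1` `]B%:R, +oo[.
  by apply/seteqP; split=> x /=; rewrite in_itv/= andbT.
exact: mM.
Qed.

(** One step along the orbit changes a positive maximum by [f x], which is absorbed by raising the
    threshold by a bound of [|f x|]. *)
Let sA : s @^-1` A = A.
Proof.
apply/seteqP; split=> x /= Ax B.
  have [n nB] := Ax (B + Num.bound `|f x|)%N.
  exists n.+1; rewrite M_S lt_max; apply/orP; right.
  move: nB; rewrite natrD.
  have := archi_boundP (normr_ge0 (f x)).
  rewrite ltr_norml => /andP[+ _]; lra.
have [n nB] := Ax (B + Num.bound `|f x|)%N.
case: n nB => [|n]; first by rewrite ltNge ler0n.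
rewrite M_S lt_max ltNge ler0n/= => nB; exists n.
move: nB; rewrite natrD.
have := archi_boundP (normr_ge0 (f x)).
rewrite ltr_norml => /andP[_ +]; lra.
Qed.

(* Garsia's argument: [M n.+1 - M n \o s] has nonnegative integral and, where the
   maxima of the Birkhoff sums tend to infinity, converges to [f]. *)
Lemma maximal_ergodic : (forall B, measurable B -> s @^-1` B = B ->
    mu B = 0%E \/ mu B = 1%E) ->
  (\int[mu]_x (f x)%:E < 0)%E ->
  {ae mu, forall x, exists B : R, forall n, birkhoff_sum s f n x <= B}.
Proof.
move=> erg f0; have [A0|A1] := erg _ mA sA.
  exists A; split => // x /= Hx; apply: contrapT => nAx; apply: Hx.
  move: nAx => /existsNP[B /forallNP HB]; exists B%:R => n.
  by rewrite (le_trans (sum_le_M n x))// leNgt; apply/negP; exact: HB.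
exfalso.
pose g n x := (M n.+1 x - M n (s x))%:E.
have gE n x : g n x = (Num.max (- M n (s x)) (f x))%:E.
  by rewrite /g M_S addr_maxl sub0r [f x + _]addrC addrAC subrr add0r.
have mg n : measurable_fun setT (g n).
  apply/measurable_EFinP; apply: measurable_funB; first exact: mM.
  by apply: measurableT_comp ms; exact: mM.
have g_f : {ae mu, forall x, setT x -> g n x @[n --> \oo] --> (f x)%:E}.
  exists (~` A); split; first exact: measurableC.
    by rewrite probability_setC// A1 subee.
  apply: subsetC => x Ax _; apply: cvg_near_cst.
  have : (s @^-1` A) x by rewrite sA.
  move=> /(_ (Num.bound `|f x|))[N fN]; exists N => // n /= Nn.
  apply/esym/eqP; rewrite gE eqe; apply/eqP/esym/max_idPr.
  have := archi_boundP (normr_ge0 (f x)); rewrite ltr_norml => /andP[+ _].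
  have := M_le (s x) Nn; lra.
(* By [gE], [g n x] is either [f x] or a number between [f x] and 0. *)
have g_le : {ae mu, forall x n, setT x -> (`|g n x| <= `|(f x)%:E|)%E}.
  apply: aeW => x n _; rewrite gE lee_fin.
  have := M_ge0 n (s x); case: (leP (- M n (s x)) (f x)) => // h1 h2.
  by rewrite ler0_norm ?ler0_norm; lra.
have [_ _ gf] := dominated_convergence measurableT mg (measurable_int mu intf) g_f
  (integrable_abse intf) g_le.
suff : (0 <= \int[mu]_x (f x)%:E)%E by rewrite leNgt f0.
rewrite -(cvg_lim _ gf)//; apply: lime_ge; first by apply/cvg_ex; eexists; exact: gf.
apply: nearW => n /=.
rewrite /g (integralB_EFin measurableT (intM n.+1) (integrable_mpt (intM n))).
rewrite (integral_mpt (intM n)) sube_ge0.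
  by apply: (le_integral measurableT (intM n) (intM n.+1)) => x _; rewrite lee_fin.
by rewrite (integrable_fin_num _ (intM n))// orbT.
Qed.

End birkhoff_theorem.

(** * From one-sided bounds to the pointwise ergodic theorem *)

Section birkhoff_ergodic.
Context d (T : measurableType d) (R : realType) (mu : probability T R).
Variable s : T -> T.
Hypothesis ms : measurable_fun setT s.
Hypothesis invs : forall A, measurable A -> mu (s @^-1` A) = mu A.
Hypothesis erg : forall B, measurable B -> s @^-1` B = B ->
  mu B = 0%E \/ mu B = 1%E.
Implicit Types f : T -> R.

Lemma birkhoff_sumB_cst f c n x :
  birkhoff_sum s (fun y => f y - c) n x = birkhoff_sum s f n x - n%:R * c.
Proof. by rewrite /birkhoff_sum sumrB sumr_const card_ord mulr_natl. Qed.

Lemma birkhoff_sumN f n x :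
  birkhoff_sum s (fun y => - f y) n x = - birkhoff_sum s f n x.
Proof. by rewrite /birkhoff_sum sumrN. Qed.

Lemma ler_birkhoff_sum f g n x : (forall y, f y <= g y) ->
  birkhoff_sum s f n x <= birkhoff_sum s g n x.
Proof. by move=> fg; apply: ler_sum. Qed.

Lemma birkhoff_upper_integrable f (c : R) : mu.-integrable setT (EFin \o f) ->
  (\int[mu]_x (f x)%:E < c%:E)%E ->
  {ae mu, forall x, exists B : R, forall n, birkhoff_sum s f n x <= n%:R * c + B}.
Proof.
move=> fi fc; have ci : mu.-integrable setT (EFin \o cst c).
  exact: finite_measure_integrable_cst.
have fci : mu.-integrable setT (EFin \o (fun y => f y - c)).
  by have := integrableB measurableT fi ci; apply: eq_integrable.
have f0 : (\int[mu]_x (f x - c)%:E < 0)%E.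
  under eq_integral do rewrite EFinB.
  rewrite (integralB_EFin measurableT fi ci).
  have -> : (\int[mu]_x (cst c x)%:E = c%:E)%E.
    rewrite (integral_cst mu measurableT c%:E) -[RHS]mule1; congr (_ * _)%E.
    exact: probability_setT.
  by rewrite lteBlDr// add0e.
have := maximal_ergodic ms invs fci erg f0.
apply: filterS => x [B HB]; exists B => n.
by have := HB n; rewrite birkhoff_sumB_cst lerBlDr addrC.
Qed.

Lemma integral_posneg f : (\int[mu]_x (f x)%:E =
  \int[mu]_x (Num.max 0 (f x))%:E - \int[mu]_x (Num.max 0 (- f x))%:E)%E.
Proof.
rewrite integralE; congr (_ - _)%E; apply: eq_integral => x _.
  by rewrite funeposE EFin_max maxC.
by rewrite funenegE EFin_max maxC.
Qed.

Section positive_part.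
Variable f : T -> R.
Hypothesis mf : measurable_fun setT f.
Hypothesis fpi : mu.-integrable setT (EFin \o (fun x => Num.max 0 (f x))).

Let h (m : nat) x := Num.min (Num.max 0 (- f x)) m%:R.
Let fm (m : nat) x := Num.max (f x) (- m%:R).

Let fmE m x : fm m x = Num.max 0 (f x) - h m x.
Proof.
rewrite /fm /h; have m0 : 0 <= m%:R :> R by [].
by case: (leP 0 (f x)); case: (leP 0 (- f x)); case: (leP (f x) (- m%:R));
  [case: (leP (- f x) m%:R)|case: (leP (- f x) m%:R)|case: (leP 0 m%:R)|
   case: (leP 0 m%:R)|case: (leP (- f x) m%:R)|case: (leP (- f x) m%:R)|
   case: (leP 0 m%:R)|case: (leP 0 m%:R)]; lra.
Qed.

Let h_ge0 m x : 0 <= h m x.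
Proof. by rewrite /h le_min le_max lexx/=. Qed.

Let mh m : measurable_fun setT (h m).
Proof.
apply: measurable_minr; last exact: measurable_cst.
apply: measurable_maxr; first exact: measurable_cst.
exact: measurable_funN.
Qed.

Let hi m : mu.-integrable setT (EFin \o h m).
Proof.
apply: (@le_integrable _ _ _ _ _ _ _ (cst m%:R%:E)) => //.
- exact/measurable_EFinP.
- move=> x _ /=; rewrite lee_fin ger0_norm// (le_trans _ (ler_norm _))//.
  by rewrite /h ge_min lexx orbT.
- exact: finite_measure_integrable_cst.
Qed.

Let fmi m : mu.-integrable setT (EFin \o fm m).
Proof.
have := integrableB measurableT fpi (hi m); apply: eq_integrable => // x _.
by rewrite /= fmE.
Qed.

Let int_h : (\int[mu]_x (h n x)%:E @[n --> \oo] -->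
  \int[mu]_x (Num.max 0 (- f x))%:E)%E.
Proof.
have := @cvg_monotone_convergence _ _ _ mu setT measurableT
  (fun n x => (h n x)%:E) (fun n => (iffRL (measurable_EFinP _ _) (mh n))).
rewrite (_ : (\int[mu]_x limn _)%E = (\int[mu]_x (Num.max 0 (- f x))%:E)%E).
  apply; first by move=> n x _; rewrite lee_fin.
  move=> x _ n m nm; rewrite lee_fin /h le_min ge_min lexx/= ge_min.
  by rewrite ler_nat nm orbT.
apply: eq_integral => x _; apply/cvg_lim => //; apply: cvg_near_cst.
near=> n; congr EFin; apply/min_idPl; near: n.
exact: nbhs_infty_ger.
Unshelve. all: by end_near. Qed.

(** The integrals of the truncations of [f] from below at [- m] tend to that of [f] by monotone
    convergence, even when it is [-oo]; one of them is below [c], and truncation only increases the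
    Birkhoff sums. *)
Lemma birkhoff_upper (c : R) : (\int[mu]_x (f x)%:E < c%:E)%E ->
  {ae mu, forall x, exists B : R, forall n, birkhoff_sum s f n x <= n%:R * c + B}.
Proof.
move=> fc.
have fmc : (\int[mu]_x (fm n x)%:E @[n --> \oo] --> \int[mu]_x (f x)%:E)%E.
  rewrite integral_posneg.
  under eq_fun do (under eq_integral do rewrite fmE EFinB;
    rewrite (integralB_EFin measurableT fpi (hi _))).
  apply: cvgeB => //; last exact: cvg_cst.
  apply: fin_num_adde_defr; exact: integrable_fin_num fpi.
have [N _ HN] := fmc _ (open_ereal_lt' fc).
have {}HN : (\int[mu]_x (fm N x)%:E < c%:E)%E := HN N (leqnn _).
have := birkhoff_upper_integrable (fmi N) HN.
apply: filterS => x [B HB]; exists B => n; apply: le_trans (HB n).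
by apply: ler_birkhoff_sum => y; rewrite /fm le_max lexx.
Qed.

End positive_part.

Lemma near_lin_bound (B e : R) : 0 < e -> \forall n \near \oo, B <= e * n%:R.
Proof.
move=> e0; near=> n; rewrite mulrC -ler_pdivrMr//; near: n.
exact: nbhs_infty_ger.
Unshelve. all: by end_near. Qed.

(** The one-sided bounds for [f] and [- f], with constants [1 / (k + 1)] above [r] and [- r] and for
    all [k] at once, leave [r] as the only possible limit. *)
Theorem birkhoff_integrable f : mu.-integrable setT (EFin \o f) ->
  {ae mu, forall x, n%:R^-1 * birkhoff_sum s f n x @[n --> \oo] -->
     fine (\int[mu]_x (f x)%:E)}.
Proof.
move=> fi; have fin := integrable_fin_num measurableT fi.
set r := fine _; have rE : (\int[mu]_x (f x)%:E = r%:E)%E by rewrite fineK.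
have fNi : mu.-integrable setT (EFin \o (fun x => - f x)).
  by have := integrableN fi; apply: eq_integrable.
have rNE : (\int[mu]_x (- f x)%:E = (- r)%:E)%E.
  by rewrite EFinN -rE -(integralN (integrable_add_def measurableT fi)).
have up k : {ae mu, forall x, exists B : R, forall n,
    birkhoff_sum s f n x <= n%:R * (r + k.+1%:R^-1) + B}.
  by apply: birkhoff_upper_integrable => //; rewrite rE lte_fin ltrDl.
have lo k : {ae mu, forall x, exists B : R, forall n,
    birkhoff_sum s (fun y => - f y) n x <= n%:R * (- r + k.+1%:R^-1) + B}.
  by apply: birkhoff_upper_integrable => //; rewrite rNE lte_fin ltrDl.
apply: filterS2 (ae_foralln up) (ae_foralln lo) => x ux lx.
suff key (e : R) : 0 < e ->
    \forall n \near \oo, `|r - n%:R^-1 * birkhoff_sum s f n x| <= e.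
  by apply/cvgrPdist_le => e; exact: key.
move=> e0; have [k ke] : exists k : nat, k.+1%:R^-1 < e / 2.
  have e2 : 0 < e / 2 by rewrite divr_gt0.
  have [N _ /(_ N (leqnn _))] := near_infty_natSinv_lt (PosNum e2).
  by exists N.
have [B1 HB1] := ux k; have [B2 HB2] := lx k.
near=> n.
have n0 : 0 < n%:R :> R by rewrite ltr0n; near: n; exact: nbhs_infty_gt.
have B1n : B1 <= e / 2 * n%:R by near: n; apply: near_lin_bound; rewrite divr_gt0.
have B2n : B2 <= e / 2 * n%:R by near: n; apply: near_lin_bound; rewrite divr_gt0.
have := HB1 n; have := HB2 n; rewrite birkhoff_sumN.
move: (birkhoff_sum _ _ _ _) => S h2 h1.
have kn : n%:R * k.+1%:R^-1 <= n%:R * (e / 2) by rewrite ler_pM2l// ltW.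
move: h1 h2 kn; move: (k.+1%:R^-1) => k' h1 h2 kn.
set q := n%:R^-1 * _; have qE : n%:R * q = S.
  by rewrite /q mulrA divff ?mul1r// gt_eqF.
rewrite ler_norml; apply/andP; split.
  by rewrite -(ler_pM2l n0) mulrBr mulrN qE; lra.
by rewrite -(ler_pM2l n0) mulrBr qE; lra.
Unshelve. all: by end_near. Qed.

Section quasi_integrable.
Variable f : T -> R.
Hypothesis mf : measurable_fun setT f.
Hypothesis fpi : mu.-integrable setT (EFin \o (fun x => Num.max 0 (f x))).

Lemma quasi_integral_lty : (\int[mu]_x (f x)%:E < +oo)%E.
Proof.
apply: le_lt_trans (integrable_lty measurableT fpi).
rewrite integral_posneg -[leRHS]sube0; apply: leeB => //.
by apply: integral_ge0 => x _; rewrite lee_fin le_max lexx.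
Qed.

Lemma quasi_integrable : (-oo < \int[mu]_x (f x)%:E)%E -> mu.-integrable setT (EFin \o f).
Proof.
move=> fNy; have p_fin := integrable_fin_num measurableT fpi.
have nE : (\int[mu]_x (Num.max 0 (- f x))%:E < +oo)%E.
  rewrite ltey; apply/eqP => n_oo; move: fNy.
  by rewrite integral_posneg n_oo -(fineK p_fin).
have ni : mu.-integrable setT (EFin \o (fun x => Num.max 0 (- f x))).
  apply/integrableP; split.
    apply/measurable_EFinP; apply: measurable_maxr => //.
    exact: measurable_funN.
  rewrite (le_lt_trans _ nE)//; apply: ge0_le_integral => //.
  - do 2 apply: measurableT_comp => //.
    by apply: measurable_maxr => //; exact: measurable_funN.
  - apply/measurable_EFinP; apply: measurable_maxr => //.
    exact: measurable_funN.
  - by move=> x _; rewrite lee_fin ger0_norm// le_max lexx.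
have := integrableB measurableT fpi ni; apply: eq_integrable => // x _ /=.
by rewrite -EFinB; congr EFin; case: (leP 0 (f x)); case: (leP 0 (- f x)); lra.
Qed.

(** A finite integral makes [f] integrable. For the integral [-oo], the one-sided bounds with all
    slopes [- k] push the averages to [-oo]. *)
Theorem birkhoff_quasi_integrable :
  {ae mu, forall x, (n%:R^-1 * birkhoff_sum s f n x)%:E @[n --> \oo] -->
     (\int[mu]_x (f x)%:E)%E}.
Proof.
case E : (\int[mu]_x (f x)%:E)%E quasi_integral_lty => [r||]// _.
  have fi : mu.-integrable setT (EFin \o f) by apply: quasi_integrable; rewrite E ltNyr.
  have := birkhoff_integrable fi; rewrite E; apply: filterS => x /= cv.
  by apply: cvg_EFin => //; exact: nearW.
have up (k : nat) : {ae mu, forall x, exists B : R, forall n,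
    birkhoff_sum s f n x <= n%:R * (- k%:R) + B}.
  by apply: birkhoff_upper => //; rewrite E ltNyr.
have := ae_foralln up; apply: filterS => x ux.
(* A slope at least one unit below [A] leaves room for the constant [B] when [n] is large. *)
apply/cvgeNyPle => A; have [B HB] := ux (Num.bound `|A|).+1.
near=> n.
have n0 : 0 < n%:R :> R by rewrite ltr0n; near: n; exact: nbhs_infty_gt.
have Bn : B <= 1 * n%:R by near: n; exact: near_lin_bound.
rewrite lee_fin ler_pdivrMl//.
have := archi_boundP (normr_ge0 A); rewrite ltr_norml => /andP[h _].
have := HB n; rewrite -natr1; move: (birkhoff_sum _ _ _ _) => S h1.
have h2 : n%:R * - (Num.bound `|A|)%:R <= n%:R * A by rewrite ler_pM2l//; lra.
lra.
Unshelve. all: by end_near. Qed.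

End quasi_integrable.

End birkhoff_ergodic.

(** * Equivariant directions and functionals *)

Section asymptotic_functional.
Context {R : realType} {X : completeNormedModType R} (C : set X).
Hypothesis nC : nice_cone C.
Local Notation "x <=c y" := (cone_le C x y) (at level 70).

Variables (T : nat -> bop X X) (v : X) (D K : R).
Hypothesis T_mono : forall m n x y, (m <= n)%N -> T m x <=c T m y -> T n x <=c T n y.
Hypothesis TC : forall n x, C x -> C (T n x).
Hypothesis Cv : C v.
Hypothesis T_contr : forall e : R, 0 < e -> exists n, cone_bounded C (T n) e.
Hypothesis D1 : 1 <= D.
Hypothesis normalD : forall x y, - y <=c x -> x <=c y -> `|x| <= D * `|y|.
Hypothesis K0 : 0 < K.
Hypothesis nonflatK : forall x, exists y z,
  [/\ 0 <=c y, 0 <=c z, x = y - z, `|y| <= K * `|x| & `|z| <= K * `|x|].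

Let oppr_cone_le0 x : 0 <=c x -> - x <=c 0.
Proof. by move=> /cone_le_opp; rewrite oppr0. Qed.

Let Tv n := T n v.

Let CTv n : C (Tv n). Proof. exact: TC. Qed.

(** Both relations persist up to the later of the two times, where they compare multiples of one
    cone vector. *)
Lemma T_lower_le a b m n x : a *: Tv m <=c T m x -> T n x <=c b *: Tv n -> a <= b.
Proof.
rewrite -!linearZ => ax xb.
apply: (cone_lemm nC (CTv (maxn m n))); rewrite -!linearZ.
apply: (cone_le_trans nC (y := T (maxn m n) x)).
  exact: T_mono (leq_maxl _ _) ax.
exact: T_mono (leq_maxr _ _) xb.
Qed.

(* [r] will be the value at [x] of the equivariant functional. *)
Definition asymptotic_value (x : X) (r : R) := forall e : R, 0 < e -> exists n,
  (r - e) *: Tv n <=c T n x /\ T n x <=c (r + e) *: Tv n.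

Lemma asymptotic_value_lower x r a n :
  asymptotic_value x r -> a *: Tv n <=c T n x -> a <= r.
Proof.
move=> xr ax; apply/ler_addgt0Pr => e e0; have [m [_]] := xr e e0.
exact: T_lower_le ax.
Qed.

Lemma asymptotic_value_upper x r b n :
  asymptotic_value x r -> T n x <=c b *: Tv n -> r <= b.
Proof.
move=> xr xb; apply/ler_addgt0Pr => e e0; have [m [h _]] := xr e e0.
by rewrite -lerBlDr; exact: T_lower_le h xb.
Qed.

Lemma asymptotic_value_unique x r r' :
  asymptotic_value x r -> asymptotic_value x r' -> r = r'.
Proof.
move=> xr xr'; apply/eqP; rewrite eq_le; apply/andP; split;
  apply/ler_addgt0Pr => e e0.
  have [m [_ h]] := xr' e e0; exact: asymptotic_value_upper xr h.
have [m [_ h]] := xr e e0; exact: asymptotic_value_upper xr' h.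
Qed.

Lemma asymptotic_valueD x y r r' : asymptotic_value x r ->
  asymptotic_value y r' -> asymptotic_value (x + y) (r + r').
Proof.
move=> xr yr e e0; have e2 : 0 < e / 2 by rewrite divr_gt0.
have [m [mx mx']] := xr _ e2; have [n [ny ny']] := yr _ e2.
exists (maxn m n); rewrite linearD; split.
  rewrite (_ : r + r' - e = (r - e / 2) + (r' - e / 2)); last by field.
  by rewrite scalerDl; apply: cone_le_add => //; rewrite -linearZ;
    [apply: T_mono (leq_maxl _ _) _|apply: T_mono (leq_maxr _ _) _];
    rewrite linearZ.
rewrite (_ : r + r' + e = (r + e / 2) + (r' + e / 2)); last by field.
by rewrite scalerDl; apply: cone_le_add => //; rewrite -linearZ;
  [apply: T_mono (leq_maxl _ _) _|apply: T_mono (leq_maxr _ _) _];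
  rewrite linearZ.
Qed.

Lemma asymptotic_valueN x r : asymptotic_value x r -> asymptotic_value (- x) (- r).
Proof.
move=> xr e e0; have [n [h1 h2]] := xr e e0; exists n; rewrite linearN; split.
  by rewrite -opprD scaleNr; exact: cone_le_opp.
have -> : - r + e = - (r - e) by rewrite opprB addrC.
by rewrite scaleNr; exact: cone_le_opp.
Qed.

Lemma asymptotic_value0 : asymptotic_value 0 0.
Proof.
move=> e e0; exists 0; rewrite linear0 sub0r add0r scaleNr; split.
  by apply/oppr_cone_le0/(cone0_scale nC (ltW e0)); exact: cone_ge0.
by apply: (cone0_scale nC (ltW e0)); exact: cone_ge0.
Qed.

Lemma asymptotic_valueZ a x r : asymptotic_value x r -> asymptotic_value (a *: x) (a * r).
Proof.
wlog a0 : a / 0 < a.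
  move=> H xr; have [a0|a0|->] := ltgtP a 0.
  - rewrite -[a *: x]opprK -scaleNr -[a * r]opprK -mulNr.
    by apply: asymptotic_valueN; apply: H; rewrite ?oppr_gt0.
  - exact: H.
  - by rewrite scale0r mul0r; exact: asymptotic_value0.
move=> xr e e0; have ea : 0 < e / a by rewrite divr_gt0.
have [n [h1 h2]] := xr _ ea; exists n; rewrite linearZ/=; split.
  rewrite (_ : a * r - e = a * (r - e / a)); last by field; rewrite gt_eqF.
  by rewrite -scalerA; apply: (cone_le_scale nC) => //; exact: ltW.
rewrite (_ : a * r + e = a * (r + e / a)); last by field; rewrite gt_eqF.
by rewrite -scalerA; apply: (cone_le_scale nC) => //; exact: ltW.
Qed.

(** The value is the supremum of the lower constants over all times. At a time of diameter [d], the
    lower and upper constants enclose it and differ by at most [(e^d - 1) b0], since no lower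
    constant exceeds the first upper constant [b0]. *)
Lemma asymptotic_value_cone y : C y -> exists r, asymptotic_value y r.
Proof.
move=> Cy; have [n0 /(_ v y Cv Cy)/(prox_ratio nC (CTv n0))] := T_contr (@ltr01 R).
move=> [a0 [b0 [a00 ab0 h1 h2 _]]].
have b00 := lt_le_trans a00 ab0.
pose S := [set a | exists n, a *: Tv n <=c T n y].
have Sub b n : T n y <=c b *: Tv n -> ubound S b.
  by move=> yb a [m ay]; exact: T_lower_le ay yb.
have hS : has_sup S.
  by split; [exists a0, n0|exists b0; exact: Sub h2].
exists (sup S) => e e0.
have [d d0 de] : exists2 d, 0 < d & (expR d - 1) * b0 <= e.
  exists (ln (1 + e / b0)); first by rewrite ln_gt0// ltrDl divr_gt0.
  rewrite lnK ?posrE ?addr_gt0 ?divr_gt0// addrC addKr.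
  by rewrite mulrVK// unitfE gt_eqF.
have [n /(_ v y Cv Cy)/(prox_ratio nC (CTv n))[a [b [a0' ab ay yb ba]]]] := T_contr d0.
have aS : a <= sup S by apply: sup_upper_bound => //; exists n.
have Sb : sup S <= b by apply: ge_sup; [exists a0, n0|exact: Sub yb].
have ab0' : a <= b0 := T_lower_le ay h2.
have bae : b - a <= e.
  apply: le_trans de; rewrite (@le_trans _ _ ((expR d - 1) * a))//.
    by rewrite mulrBl mul1r lerD2r.
  rewrite ler_wpM2l// subr_ge0 -[leLHS]expR0 ler_expR ltW//.
have v0 : 0 <=c Tv n := cone_ge0 (CTv n).
exists n; split.
  by apply: (cone_le_trans nC) ay; apply: (cone_le_scalel nC) => //; lra.
by apply: (cone_le_trans nC yb); apply: (cone_le_scalel nC) => //; lra.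
Qed.

Lemma asymptotic_value_exists x : exists r, asymptotic_value x r.
Proof.
have ex0 y : 0 <=c y -> exists r, asymptotic_value y r.
  rewrite cone_le0 => -[/asymptotic_value_cone//|->].
  by exists 0; exact: asymptotic_value0.
have [y [z [/ex0[r yr] /ex0[r' zr'] -> _ _]]] := nonflatK x.
exists (r - r'); apply: asymptotic_valueD => //; exact: asymptotic_valueN.
Qed.

Let eta (x : X) : R := xget 0 [set r | asymptotic_value x r].

Let etaP x : asymptotic_value x (eta x).
Proof.
by rewrite /eta; case: xgetP => [r ->//|H]; have [r /H] := asymptotic_value_exists x.
Qed.

Let eta_linear : linear eta.
Proof.
move=> a x y; apply: (@asymptotic_value_unique (a *: x + y)) => //.
by apply: asymptotic_valueD => //; exact: asymptotic_valueZ.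
Qed.

Let eta_gt0 y : C y -> 0 < eta y.
Proof.
move=> Cy; have [n /(_ v y Cv Cy)[a [b [a0 ay _ _]]]] := T_contr (@ltr01 R).
exact: lt_le_trans a0 (asymptotic_value_lower (etaP y) ay).
Qed.

Let Tv_gt0 n : 0 < `|Tv n|.
Proof. by rewrite normr_gt0; exact: (cone_neq0 nC). Qed.

Let norm_scale_cone (a : R) y n : 0 <= a -> a *: Tv n <=c T n y ->
  a * `|Tv n| <= D * `|T n y|.
Proof.
move=> a0 ay; have v0 : 0 <=c a *: Tv n by apply: (cone0_scale nC) => //; exact: cone_ge0.
have := @normalD (a *: Tv n) (T n y); rewrite normrZ ger0_norm//; apply => //.
apply: (cone_le_trans nC _ v0); apply: oppr_cone_le0.
exact: (cone_le_trans nC v0 ay).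
Qed.

(** One has [eta y <= b <= e^t a], and normality turns [a Tv <= T y] into [a |Tv| <= D |T y|]. *)
Let eta_bound_cone t n y : cone_bounded C (T n) t -> 0 <=c y ->
  eta y * `|Tv n| <= expR t * D * (`|T n| * `|y|).
Proof.
move=> bT; rewrite cone_le0 => -[Cy|->]; last first.
  rewrite (asymptotic_value_unique (etaP 0) asymptotic_value0) mul0r.
  by rewrite normr0 !mulr0.
have [a [b [a0 ay yb ba]]] := bT v y Cv Cy.
rewrite (@le_trans _ _ (expR t * (a * `|Tv n|)))//.
  by rewrite mulrA ler_pM2r// (le_trans _ ba)//; exact: asymptotic_value_upper yb.
rewrite -mulrA ler_pM2l ?expR_gt0//.
rewrite (le_trans (norm_scale_cone (ltW a0) ay))//.
by rewrite ler_wpM2l ?(le_trans ler01 D1)//; exact: bop_opnorm_ub.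
Qed.

(** The bound for cone vectors is applied to the two parts of [x], each of norm at most [K |x|]:
    hence [2 K]. With [t = 1] it makes [eta] continuous. *)
Lemma eta_bound t n x : cone_bounded C (T n) t ->
  `|eta x| <= 2 * K * (expR t * D * `|T n| / `|Tv n|) * `|x|.
Proof.
move=> bT; have [y [z [y0 z0 -> yK zK]]] := nonflatK x; set N := `|y - z| in yK zK *.
have -> : eta (y - z) = eta y - eta z.
  by rewrite -scaleN1r addrC eta_linear scaleN1r addrC.
have cE : 0 <= expR t * D * `|T n|.
  by rewrite !mulr_ge0// ?expR_ge0// (le_trans ler01).
have h w : 0 <=c w -> `|w| <= K * N ->
    `|eta w| <= expR t * D * `|T n| / `|Tv n| * (K * N).
  move=> w0 wK.
  have ew : 0 <= eta w.
    move: w0; rewrite cone_le0 => -[/eta_gt0/ltW//|->].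
    by rewrite (asymptotic_value_unique (etaP 0) asymptotic_value0).
  rewrite ger0_norm// mulrAC ler_pdivlMr// (le_trans (eta_bound_cone bT w0))//.
  by rewrite mulrA ler_wpM2l.
rewrite (le_trans (ler_normB _ _))// (le_trans (lerD (h y y0 yK) (h z z0 zK)))//.
by rewrite le_eqVlt -subr_eq0; apply/orP; left; apply/eqP; ring.
Qed.

Let eta_continuous : continuous eta.
Proof.
pose F : {linear X -> R} := HB.pack eta (GRing.isLinear.Build _ _ _ _ _ eta_linear).
have [n bT] := T_contr (@ltr01 R).
apply/(@linear_bounded_continuous _ _ _ F)/(@linear_boundedP _ _ _ F).
near=> r; move=> x; rewrite (le_trans (eta_bound x bT))// ler_wpM2r//.
Unshelve. all: by end_near. Qed.

Fact eta_lin_cts : eta \in lin_cts X R.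
Proof. by rewrite inE; split; [exact: eta_linear|exact: eta_continuous]. Qed.

Definition asymptotic_functional : bop X R := Bop eta_lin_cts.

Lemma asymptotic_functionalP x : asymptotic_value x (asymptotic_functional x).
Proof. exact: etaP. Qed.

Lemma asymptotic_functional_gt0 y : C y -> 0 < asymptotic_functional y.
Proof. exact: eta_gt0. Qed.

Lemma asymptotic_functional_v : asymptotic_functional v = 1.
Proof.
apply: (@asymptotic_value_unique v) => [|e e0]; first exact: etaP.
have v0 := cone_ge0 (CTv 0); exists 0; rewrite -/(Tv 0).
have scale w a b : 0 <=c w -> a <= 1 -> 1 <= b -> a *: w <=c w /\ w <=c b *: w.
  by move=> w0 a1 b1; split; rewrite -[w in X in cone_le C X _]scale1r;
    rewrite -[X in _ <=c X]scale1r ?scalerA ?mul1r ?mulr1; exact: cone_le_scalel.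
by apply: scale => //; lra.
Qed.

Lemma asymptotic_functional_bound t n : cone_bounded C (T n) t ->
  `|asymptotic_functional| <= 2 * K * (expR t * D * `|T n| / `|Tv n|).
Proof.
move=> bT; apply: opnorm_le => x x1; rewrite (le_trans (eta_bound x bT))//.
have D0 : 0 <= D := le_trans ler01 D1.
by rewrite ler_piMr// !mulr_ge0 ?expR_ge0 ?invr_ge0// (ltW K0).
Qed.

(** For [w] in the cone, [T n w] and [eta w *: Tv n] both lie between [a Tv n] and [b Tv n], with
    [b - a <= (e^t - 1) a <= (e^t - 1) eta w]. Normality contributes [D], and the two cone parts of
    [x] contribute [2 K]. *)
Lemma asymptotic_functional_approx t n x : cone_bounded C (T n) t ->
  `|T n x - asymptotic_functional x *: Tv n| <=
    2 * D * K * (expR t - 1) * `|asymptotic_functional| * `|x| * `|Tv n|.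
Proof.
move=> bT; have [y [z [y0 z0 xyz yK zK]]] := nonflatK x.
have t1 : 0 <= expR t - 1.
  by rewrite subr_ge0 -[leLHS]expR0 ler_expR; exact: (prox_ge0 nC (CTv n)) (bT _ _ Cv Cv).
have D0 : 0 <= D := le_trans ler01 D1.
have h w : 0 <=c w -> `|w| <= K * `|x| -> `|T n w - eta w *: Tv n| <=
    D * (expR t - 1) * (`|asymptotic_functional| * (K * `|x|)) * `|Tv n|.
  rewrite cone_le0 => -[Cw|->] wK; last first.
    rewrite linear0 (asymptotic_value_unique (etaP 0) asymptotic_value0).
    by rewrite scale0r subr0 normr0 !mulr_ge0// ?normr_ge0// ltW.
  have [a [b [a0 aw wb ba]]] := bT v w Cv Cw.
  have ae := asymptotic_value_lower (etaP w) aw.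
  have eb := asymptotic_value_upper (etaP w) wb.
  have v0 := cone_ge0 (CTv n).
  have nb : `|T n w - eta w *: Tv n| <= D * `|(b - a) *: Tv n|.
    apply: normalD.
      rewrite -scaleNr opprB scalerBl; apply: (cone_le_add nC) => //.
      by apply: cone_le_opp; apply: (cone_le_scalel nC).
    rewrite scalerBl; apply: (cone_le_add nC) => //.
    by apply: cone_le_opp; apply: (cone_le_scalel nC).
  rewrite (le_trans nb)// normrZ ger0_norm ?subr_ge0 ?(le_trans ae)//.
  rewrite mulrA ler_pM2r// -mulrA ler_wpM2l//.
  rewrite (@le_trans _ _ ((expR t - 1) * a))//; first by rewrite mulrBl mul1r lerD2r.
  rewrite ler_wpM2l// (le_trans ae)// (le_trans (ler_norm _))//.
  rewrite (le_trans (bop_opnorm_ub asymptotic_functional w))//.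
  by rewrite -bop_normE ler_wpM2l.
have -> : T n x - asymptotic_functional x *: Tv n =
    (T n y - eta y *: Tv n) - (T n z - eta z *: Tv n).
  rewrite subrACA -linearB -scalerBl xyz; congr (_ - _ *: _).
  exact: (linearB asymptotic_functional).
rewrite (le_trans (ler_normB _ _))// (le_trans (lerD (h y y0 yK) (h z z0 zK)))//.
by rewrite le_eqVlt -subr_eq0; apply/orP; left; apply/eqP; ring.
Qed.

End asymptotic_functional.

(** * Contraction of the cocycle in terms of visits *)

Section cocycle_contraction.
Context {R : realType} {Omega : Type} {X : normedModType R}.
Variables (sigma : Omega -> Omega) (L : Omega -> bop X X) (C : set X).
Hypothesis nC : nice_cone C.
Hypothesis LC : forall w, L w @` C `<=` C.
Local Notation "x <=c y" := (cone_le C x y) (at level 70).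

Lemma cocycleD m n w x : cocycle sigma L (m + n) w x =
  cocycle sigma L m (iter n sigma w) (cocycle sigma L n w x).
Proof. by elim: m => //= m ih; rewrite ih iterD. Qed.

Lemma cocycleSr n w x :
  cocycle sigma L n.+1 w x = cocycle sigma L n (sigma w) (L w x).
Proof. by rewrite -addn1 cocycleD. Qed.

Lemma cocycle_cone n w x : C x -> C (cocycle sigma L n w x).
Proof. by elim: n => //= n ih Cx; apply: LC; exists (cocycle sigma L n w x) => //; exact: ih. Qed.

Lemma cocycle_mono m n w x y : (m <= n)%N ->
  cocycle sigma L m w x <=c cocycle sigma L m w y ->
  cocycle sigma L n w x <=c cocycle sigma L n w y.
Proof.
move=> mn xy; rewrite -(subnK mn) !cocycleD.
by apply: cone_mono => // z; exact: cocycle_cone.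
Qed.

Variables (G : set Omega) (k : nat) (Delta : R).
Hypothesis k0 : (0 < k)%N.
Hypothesis D0 : 0 < Delta.
Hypothesis GD : forall w, G w -> cone_bounded C (cocycle sigma L k w) Delta.

Definition visits n w : R := birkhoff_sum sigma \1_G n w.

Lemma visits_ge0 n w : 0 <= visits n w.
Proof. exact: birkhoff_sum_ge0. Qed.

Lemma visitsD m n w : visits (m + n) w = visits m w + visits n (iter m sigma w).
Proof. exact: birkhoff_sumD. Qed.

Lemma visits_le_nat n w : visits n w <= n%:R.
Proof.
rewrite -[n in leRHS]card_ord -sumr_const; apply: ler_sum => i _.
by rewrite indicE; case: (_ \in _).
Qed.

Lemma visits_le m n w : (m <= n)%N -> visits m w <= visits n w.
Proof. by move=> mn; rewrite -(subnKC mn) visitsD lerDl visits_ge0. Qed.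

Let r : R := tanh (Delta / 4).

Let r01 : 0 < r < 1.
Proof. by apply: tanh_itv; rewrite divr_gt0. Qed.

Let powr_le x y : y <= x -> r `^ x <= r `^ y.
Proof. by move=> yx; apply: ger_powR => //; have /andP[-> /ltW ->] := r01. Qed.

Let kR : 0 < k%:R :> R. Proof. by rewrite ltr0n. Qed.

Let nonexpansive n w : cone_contracts C (cocycle sigma L n w) 1.
Proof.
by move=> u z t Cu Cz uz; rewrite mul1r; apply: prox_map => // y; exact: cocycle_cone.
Qed.

Let contracts_eq (T T' : bop X X) c : T =1 T' ->
  cone_contracts C T c -> cone_contracts C T' c.
Proof. by move=> TT' Tc u z t Cu Cz uz; rewrite -!TT'; exact: Tc. Qed.

(** [n.+1 - k] counts the starting times from which a block of [k] steps ends by time [n]. Passing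
    over a block loses at most [k] of them, hence at most [k] visits. *)
Let visit_step n w : (k <= n)%N ->
  visits (n.+1 - k) w / k%:R <= 1 + visits ((n - k).+1 - k) (iter k sigma w) / k%:R.
Proof.
move=> kn; rewrite -[X in X + _](@divff _ k%:R) ?gt_eqF// -mulrDl ler_pM2r ?invr_gt0//.
rewrite -subSn//.
have [h|/ltnW h] := leqP k (n.+1 - k).
  rewrite -[in leLHS](subnKC h) visitsD lerD2r; exact: visits_le_nat.
rewrite (eqP h) /visits [X in _ + X]birkhoff_sum0 addr0.
by rewrite (le_trans (visits_le_nat _ _))// ler_nat.
Qed.

(** The orbit is cut greedily: in [G], a block of [k] steps is taken, which contracts by [r] and
    uses up at most [k] visits; outside [G], a single step, which does not expand. *)
Lemma cocycle_contracts n w :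
  cone_contracts C (cocycle sigma L n w) (r `^ (visits (n.+1 - k) w / k%:R)).
Proof.
have r1 : r `^ 0 = 1 by rewrite powRr0.
elim/ltn_ind: n w => n ih w.
have [nk|kn] := ltnP n k.
  by move: nk; rewrite -subn_eq0 => /eqP ->; rewrite /visits birkhoff_sum0 mul0r r1.
have [Gw|Gw] := pselect (G w).
  apply: (@contracts_eq (comp_op (cocycle sigma L (n - k) (iter k sigma w))
      (cocycle sigma L k w))).
    by move=> x /=; rewrite -cocycleD subnK.
  move=> u z t Cu Cz uz /=.
  have h1 := birkhoff_contraction nC (ltW D0) (@cocycle_cone k w) (GD Gw) Cu Cz uz.
  have nkn : (n - k < n)%N by rewrite ltn_subrL k0 (leq_trans k0).
  have := ih _ nkn (iter k sigma w) _ _ _ (cocycle_cone _ _ Cu) (cocycle_cone _ _ Cz) h1.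
  apply: prox_le; rewrite mulrA ler_wpM2r//; first exact: (prox_ge0 nC Cu uz).
  have /andP[r0 _] := r01.
  rewrite mulrC -[X in X * _](powRr1 (ltW r0)) -powRD; last by rewrite (gt_eqF r0) implybT.
  by apply: powr_le; exact: visit_step.
case: n kn ih => [|n] kn ih; first by rewrite leqNgt k0 in kn.
have vE : visits (n.+2 - k) w = visits (n.+1 - k) (sigma w).
  by rewrite subSn// /visits birkhoff_sumS indicE memNset// add0r.
rewrite vE; apply: (@contracts_eq (comp_op (cocycle sigma L n (sigma w)) (L w))).
  by move=> x; rewrite cocycleSr.
have LwC x : C x -> C (L w x) by move=> Cx; apply: LC; exists x.
move=> u z t Cu Cz uz; apply: ih => //; try exact: LwC.
exact: prox_map.
Qed.

(** The same cutting, except that the first block replaces the initial distance, possibly infinite,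
    by [Delta] instead of contracting it: the exponent loses 1. *)
Let cocycle_bounded_aux n w : 0 < visits (n.+1 - k) w ->
  cone_bounded C (cocycle sigma L n w)
    (Delta * r `^ (visits (n.+1 - k) w / k%:R - 1)).
Proof.
elim/ltn_ind: n w => n ih w v0.
have kn : (k <= n)%N.
  rewrite leqNgt; apply/negP => nk; move: v0.
  by move: nk; rewrite -subn_eq0 => /eqP ->; rewrite /visits birkhoff_sum0 ltxx.
have [Gw|Gw] := pselect (G w).
  move=> u z Cu Cz; have h1 := GD Gw Cu Cz.
  have := @cocycle_contracts (n - k) (iter k sigma w) _ _ _
    (cocycle_cone k w Cu) (cocycle_cone k w Cz) h1.
  rewrite -!cocycleD subnK//; apply: prox_le.
  rewrite mulrC ler_pM2l//; apply: powr_le; rewrite lerBlDl; exact: visit_step.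
case: n kn ih v0 => [|n] kn ih v0; first by rewrite leqNgt k0 in kn.
have vE : visits (n.+2 - k) w = visits (n.+1 - k) (sigma w).
  by rewrite subSn// /visits birkhoff_sumS indicE memNset// add0r.
rewrite vE in v0 *; move=> u z Cu Cz; rewrite !cocycleSr.
by apply: ih => //; apply: LC; [exists u|exists z].
Qed.

(* Every visit to [G] costs at most [k] steps, so that at least [visits / k]
   disjoint blocks of length [k] contract by the Birkhoff factor. *)
Lemma cocycle_bounded n w : k%:R < visits n w ->
  cone_bounded C (cocycle sigma L n w) (Delta * r `^ (visits n w / k%:R - 2)).
Proof.
(* The last times, from which no full block fits, contain at most [k] visits. They cost one unit of
   [visits / k] and the first block costs another: hence the 2 in the exponent. *)
move=> kv; have vn : visits n w <= visits (n.+1 - k) w + k%:R.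
  have [kn|nk] := leqP k n.+1; last first.
    rewrite (le_trans (visits_le_nat _ _))// ler_wpDl// ?visits_ge0// ler_nat.
    exact: (leq_trans (leqnSn _) (ltnW nk)).
  rewrite (le_trans (visits_le w (leqnSn n)))// -[in leLHS](subnK kn) visitsD lerD2l.
  exact: visits_le_nat.
have v0 : 0 < visits (n.+1 - k) w by rewrite -(ltrD2r k%:R) add0r (lt_le_trans kv).
move=> u z Cu Cz; apply: prox_le (cocycle_bounded_aux v0 Cu Cz).
rewrite ler_pM2l//; apply: powr_le.
have : visits n w / k%:R <= visits (n.+1 - k) w / k%:R + 1.
  by rewrite -[X in _ + X](@divff _ k%:R) ?gt_eqF// -mulrDl ler_pM2r ?invr_gt0.
by move: (visits n w / k%:R) (visits (n.+1 - k) w / k%:R) => a b; lra.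
Qed.

(** A diameter bound independent of [n] and [w], meant for the estimate of the norm of the
    functional: of the exponent only [- 2] is kept. *)
Lemma cocycle_boundedW n w : k%:R < visits n w ->
  cone_bounded C (cocycle sigma L n w) (Delta * r `^ (- 2)).
Proof.
move=> kv u z Cu Cz; apply: prox_le (cocycle_bounded kv Cu Cz).
rewrite ler_pM2l//; apply: powr_le.
by rewrite lerDr divr_ge0 ?visits_ge0.
Qed.

End cocycle_contraction.

Section small_constants.
Context {R : realType}.
Implicit Types (r c e D : R).

Lemma small_powR r c e : 0 < r < 1 -> 0 < c -> 0 < e ->
  exists B, forall y, B <= y -> c * r `^ y <= e.
Proof.
move=> /andP[r0 r1] c0 e0; have lr : ln r < 0 by rewrite ln_lt0// r0.
exists (ln (e / c) / ln r) => y By.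
rewrite -ler_pdivlMl// mulrC -[leRHS]lnK ?posrE ?divr_gt0//.
rewrite /powR gt_eqF// ler_expR; move: By.
by rewrite ler_ndivrMr.
Qed.

Lemma small_expR1 c e : 0 <= c -> 0 < e -> exists2 d, 0 < d & c * (expR d - 1) <= e.
Proof.
move=> c0 e0; have c1 : 0 < c + 1 by rewrite ltr_wpDl.
exists (ln (1 + e / (c + 1))); first by rewrite ln_gt0// ltrDl divr_gt0.
rewrite lnK ?posrE ?addr_gt0 ?divr_gt0// addrC addKr mulrCA.
by rewrite ger_pMr// ler_pdivrMr// mul1r lerDl.
Qed.

End small_constants.

(** * The equivariant direction as a limit along the past *)

Section equivariant_vector.
Context {R : realType} {Omega : Type} {X : completeNormedModType R}.
Variables (sigma sigmaV : Omega -> Omega) (L : Omega -> bop X X) (C : set X).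
Hypothesis sigmaK : cancel sigma sigmaV.
Hypothesis sigmaVK : cancel sigmaV sigma.
Hypothesis nC : nice_cone C.
Hypothesis LC : forall w, L w @` C `<=` C.
Variable (D : R).
Hypothesis D1 : 1 <= D.
Hypothesis normalD : forall x y,
  cone_le C (- y) x -> cone_le C x y -> `|x| <= D * `|y|.

Lemma iterVK n w : iter n sigma (iter n sigmaV w) = w.
Proof. by elim: n w => // n ih w; rewrite iterSr iterS sigmaVK ih. Qed.

(* L(n, sigma^-n w), which maps X at sigma^-n w to X at w. *)
Definition pulled n w := cocycle sigma L n (iter n sigmaV w).

Lemma pulled_cone n w x : C x -> C (pulled n w x).
Proof. exact: cocycle_cone. Qed.

Lemma pulledD m n w x : pulled (n + m) w x =
  pulled n w (cocycle sigma L m (iter (n + m) sigmaV w) x).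
Proof. by rewrite /pulled cocycleD addnC iterD iterVK. Qed.

Lemma pulledS n w x : pulled n.+1 (sigma w) x = L w (pulled n w x).
Proof.
by rewrite /pulled iterSr sigmaK/= iterVK.
Qed.

Definition normalize (x : X) := `|x|^-1 *: x.

Lemma normalize_norm x : C x -> `|normalize x| = 1.
Proof.
move=> Cx; rewrite normrZ normfV normr_id mulVf// normr_eq0.
exact: (cone_neq0 nC).
Qed.

Lemma normr_cone_gt0 x : C x -> 0 < `|x|.
Proof. by rewrite normr_gt0; exact: (cone_neq0 nC). Qed.

Lemma normalize_cone x : C x -> C (normalize x).
Proof.
by move=> Cx; apply: (cone_scale nC) => //; rewrite invr_gt0 normr_cone_gt0.
Qed.

Lemma normalizeZ a x : 0 < a -> normalize (a *: x) = normalize x.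
Proof.
move=> a0; rewrite /normalize normrZ gtr0_norm// scalerA invfM mulrAC.
by rewrite mulVf ?mul1r// gt_eqF.
Qed.

Lemma normalize_id x : `|x| = 1 -> normalize x = x.
Proof. by move=> x1; rewrite /normalize x1 invr1 scale1r. Qed.

Lemma cvg_normalize (f : nat -> X) x : x != 0 -> f @ \oo --> x ->
  normalize (f n) @[n --> \oo] --> normalize x.
Proof.
move=> x0 fx; apply: cvgZ => //; apply: cvgV; first by rewrite normr_eq0.
exact: cvg_norm.
Qed.

(** For [n <= m], [pulled m w] factors through [pulled n w], so both vectors are normalized elements
    of the image of the cone under the latter. *)
Lemma normalize_pulled_dist e m n w x y : C x -> C y -> (n <= m)%N ->
  cone_bounded C (pulled n w) e ->
  `|normalize (pulled n w x) - normalize (pulled m w y)| <= 2 * D ^+ 2 * (expR e - 1).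
Proof.
move=> Cx Cy nm b.
have Cpx := pulled_cone n w Cx; have Cpy := pulled_cone m w Cy.
apply: (prox_norm nC D1 normalD); [exact: normalize_cone|exact: normalize_norm|
  exact: normalize_norm|].
apply: (prox_scalel nC); [by rewrite invr_gt0 normr_cone_gt0|done|exact: normalize_cone|].
apply: prox_scaler; first done; first by rewrite invr_gt0 normr_cone_gt0.
by rewrite -(subnKC nm) pulledD; apply: b => //; exact: cocycle_cone.
Qed.

Variable x0 : X.
Hypothesis Cx0 : C x0.

Definition vseq n w := normalize (pulled n w x0).

Definition backward_contracting w :=
  forall e : R, 0 < e -> exists n, cone_bounded C (pulled n w) e.

Definition vlim w : X := lim (vseq n w @[n --> \oo]).

Lemma cvg_vseq w : backward_contracting w -> vseq n w @[n --> \oo] --> vlim w.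
Proof.
move=> bw; apply/cauchy_cvgP/cauchy_exP => e e0.
have [|d d0 de] := @small_expR1 _ (2 * D ^+ 2) (e / 2) _ (divr_gt0 e0 (ltr0n R 2)).
  by rewrite mulr_ge0// sqr_ge0.
have [n bn] := bw d d0.
exists (vseq n w), n => // m /= nm.
rewrite -ball_normE/= (le_lt_trans (normalize_pulled_dist Cx0 Cx0 nm bn))//.
by rewrite (le_lt_trans de)// ltr_pdivrMr// ltr_pMr// ltr1n.
Qed.

Lemma vlim_norm w : backward_contracting w -> `|vlim w| = 1.
Proof.
move=> /cvg_vseq/cvg_norm cv.
apply: (cvg_unique (@Rhausdorff R) cv).
rewrite (_ : (fun n => _) = cst 1); first exact: cvg_cst.
by apply/funext => n; exact/normalize_norm/pulled_cone.
Qed.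

Lemma vlim_cone w : backward_contracting w -> C (vlim w).
Proof.
move=> bw; have : cone_le C 0 (vlim w).
  apply: (closed_cvg _ (cone_closed nC) _ _ (cvg_vseq bw)).
  by apply: nearW => n; apply: cone_ge0; exact/normalize_cone/pulled_cone.
rewrite cone_le0 => -[//|v0]; have := vlim_norm bw.
by rewrite v0 normr0 => /esym/eqP; rewrite oner_eq0.
Qed.

Lemma vlim_dist e n w x : backward_contracting w -> C x ->
  cone_bounded C (pulled n w) e ->
  `|normalize (pulled n w x) - vlim w| <= 2 * D ^+ 2 * (expR e - 1).
Proof.
move=> bw Cx bn.
have cv : `|normalize (pulled n w x) - vseq m w| @[m --> \oo] -->
    `|normalize (pulled n w x) - vlim w|.
  by apply: cvg_norm; apply: cvgB; [exact: cvg_cst|exact: cvg_vseq].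
apply: (closed_cvg _ (@closed_le R (2 * D ^+ 2 * (expR e - 1))) _ _ cv).
exists n => // m /= nm.
exact: normalize_pulled_dist.
Qed.

(** A vector that comes from the cone at every past time is as close to the limit as the diameters
    of the images are small. *)
Lemma vlim_unique w u : backward_contracting w ->
  (forall n, exists2 x, C x & u = normalize (pulled n w x)) -> u = vlim w.
Proof.
move=> bw H; apply/eqP; rewrite -subr_eq0 -normr_le0; apply/ler_addgt0Pl => e e0.
have [|d d0 de] := @small_expR1 _ (2 * D ^+ 2) e _ e0.
  by rewrite mulr_ge0// sqr_ge0.
have [n bn] := bw d d0; have [x Cx ->] := H n.
by rewrite addr0 (le_trans (vlim_dist bw Cx bn)).
Qed.

(** The approximant of order [n + 1] at [sigma w] is the normalized image under [L w] of the
    approximant of order [n] at [w]; both sides are its limit. *)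
Lemma vlim_equivariant w : backward_contracting w -> backward_contracting (sigma w) ->
  vlim (sigma w) = normalize (L w (vlim w)).
Proof.
move=> bw bsw.
have CLv : C (L w (vlim w)) by apply: LC; exists (vlim w) => //; exact: vlim_cone.
have h1 : vseq n.+1 (sigma w) @[n --> \oo] --> vlim (sigma w).
  have := cvg_vseq bsw; rewrite -(cvg_shiftS (fun n => vseq n (sigma w))).
  exact.
have h2 : vseq n.+1 (sigma w) @[n --> \oo] --> normalize (L w (vlim w)).
  rewrite (_ : (fun n => vseq n.+1 (sigma w)) = (fun n => normalize (L w (vseq n w)))).
    apply: cvg_normalize; first exact: (cone_neq0 nC).
    by apply: (cvg_comp _ _ (cvg_vseq bw)); exact: bop_continuous.
  apply/funext => n; rewrite /vseq pulledS.
  rewrite [in RHS](_ : L w _ = `|pulled n w x0|^-1 *: L w (pulled n w x0)).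
    by rewrite normalizeZ// invr_gt0 normr_cone_gt0//; exact: pulled_cone.
  by rewrite /normalize linearZ.
exact: (cvg_unique (@norm_hausdorff _ X) h1 h2).
Qed.

End equivariant_vector.

(** * Borel measurability *)

Section borel_measurability.
Context {d : measure_display} {R : realType} {Omega : topMeasurableType d}.
Variable D : set Omega.
Hypothesis mD : measurable D.

Lemma borel_measurable_onP (T : topologicalType) (f : Omega -> T) :
  (forall U, open U -> measurable (D `&` f @^-1` U)) -> borel_measurable_on D f.
Proof.
move=> fU B; rewrite /borel.
suff : <<s @open T >> `<=` [set B | measurable (D `&` f @^-1` B)] by apply.
apply: smallest_sub => //=; split => /=.
- by rewrite preimage_set0 setI0.
- move=> A mA; rewrite setTD preimage_setC.
  by have := measurableD mD mA; rewrite setDIr setDv set0U setDE.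
- move=> A mA; rewrite preimage_bigcup setI_bigcupr.
  exact: bigcupT_measurable.
Qed.

Lemma borel_measurable_on_open (T : topologicalType) (f : Omega -> T) U :
  borel_measurable_on D f -> open U -> measurable (D `&` f @^-1` U).
Proof. by move=> mf oU; apply: mf; exact: sub_sigma_algebra. Qed.

Lemma borel_measurable_on_closed (T : topologicalType) (f : Omega -> T) U :
  borel_measurable_on D f -> closed U -> measurable (D `&` f @^-1` U).
Proof.
move=> mf cU; have := measurableD mD (borel_measurable_on_open mf (closed_openC cU)).
by rewrite preimage_setC setDIr setDv set0U setDE setCK.
Qed.

Lemma borel_measurable_on_comp (T S : topologicalType) (f : Omega -> T) (g : T -> S) :
  borel_measurable_on D f -> continuous g -> borel_measurable_on D (g \o f).
Proof.
move=> mf cg; apply: borel_measurable_onP => U oU; rewrite comp_preimage.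
by apply: borel_measurable_on_open => //; move/continuousP : cg; exact.
Qed.

Lemma borel_measurable_on_eq (T : topologicalType) (f g : Omega -> T) :
  (forall w, D w -> f w = g w) -> borel_measurable_on D f -> borel_measurable_on D g.
Proof.
move=> fg mf B /mf; congr (measurable _).
by apply/seteqP; split => w /= [Dw]; rewrite fg.
Qed.

Lemma borel_measurable_on_cst (T : topologicalType) (c : T) :
  borel_measurable_on D (fun=> c).
Proof.
move=> B _; have [Bc|Bc] := pselect (B c).
  by rewrite (_ : _ `&` _ = D)//; apply/seteqP; split => w // [].
by rewrite (_ : _ `&` _ = set0)//; apply/seteqP; split => w // [].
Qed.

Lemma measurable_fun_borel (f : Omega -> R) :
  borel_measurable_on D f -> measurable_fun D f.
Proof.
move=> mf _; apply: (measurability _ (RGenOpens.measurableE R)) => // _ [_ [a [b ->] <-]].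
by apply: borel_measurable_on_open => //; exact: interval_open.
Qed.

Lemma borel_measurable_fun (f : Omega -> R) :
  measurable_fun D f -> borel_measurable_on D f.
Proof.
by move=> mf; apply: borel_measurable_onP => U oU; apply: mf => //; exact: open_measurable.
Qed.

Section normed.
Implicit Types (X Y Z W : normedModType R).

(** Closed sets that exhaust an open [U] from inside as [e] tends to 0; they express convergence to
    a point of [U] by countably many conditions. *)
Definition erosion X (U : set X) (e : R) := [set x | ball x e `<=` U].

Lemma closed_erosion X (U : set X) e : closed (erosion U e).
Proof.
have -> : erosion U e = \bigcap_(y in ~` U) [set x | e <= `|x - y| ].
  apply/seteqP; split => x /= H.
    move=> y Uy /=; rewrite leNgt; apply/negP => xy; apply: Uy; apply: H.
    by rewrite -ball_normE.
  move=> y; rewrite -ball_normE /= => xy; apply: contrapT => Uy.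
  by have := H y Uy; rewrite /= leNgt xy.
apply: closed_bigI => y _.
rewrite (_ : [set x | _] = (fun x => `|x - y|) @^-1` [set r | e <= r])//.
apply: preimage_closed; last exact: closed_ge.
by move=> x _; apply: cvg_norm; apply: cvgB => //; exact: cvg_cst.
Qed.

Lemma open_erosion X (U : set X) x : open U -> U x ->
  exists2 e : R, 0 < e & ball x e `<=` U.
Proof.
move=> oU Ux; have : nbhs x U by exact: open_nbhs_nbhs.
by move=> /nbhs_ballP[e /= e0 eU]; exists e.
Qed.

Lemma small_inv (e : R) : 0 < e -> exists n : nat, n.+1%:R^-1 < e.
Proof.
move=> e0; have [N _ /(_ N (leqnn _))] := near_infty_natSinv_lt (PosNum e0).
by exists N.
Qed.

(** The limit is in [U] exactly when, for some [q], all late terms are in the erosion of [U] by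
    [1 / (q + 1)]. *)
Lemma borel_measurable_on_lim X (f : nat -> Omega -> X) (g : Omega -> X) :
  (forall n, borel_measurable_on D (f n)) ->
  (forall w, D w -> f n w @[n --> \oo] --> g w) -> borel_measurable_on D g.
Proof.
move=> mf fg; apply: borel_measurable_onP => U oU.
have -> : D `&` g @^-1` U = \bigcup_q \bigcup_N \bigcap_n
    (D `&` f (N + n)%N @^-1` erosion U q.+1%:R^-1).
  apply/seteqP; split => w /=.
    move=> [Dw /(open_erosion oU)[e e0 eU]].
    have [q qe] := small_inv (divr_gt0 e0 (ltr0n R 2)).
    have q0 : 0 < q.+1%:R^-1 :> R by rewrite invr_gt0.
    exists q => //.
    have /(_ _ q0)[N _ HN] : forall e : R, 0 < e -> \forall n \near \oo, `|g w - f n w| < e.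
      by apply/cvgrPdist_lt; exact: fg.
    exists N => // n _ /=; split => // y; rewrite -ball_normE/= => fy; apply: eU.
    rewrite -ball_normE/= (le_lt_trans (ler_distD (f (N + n)%N w) _ _))//.
    have := HN (N + n)%N (leq_addr _ _); move: fy qe; move: (q.+1%:R^-1) => a; lra.
  move=> [q _ [N _ H]]; have Dw : D w by have [] := H 0%N I.
  split => //; have q0 : 0 < q.+1%:R^-1 :> R by rewrite invr_gt0.
  have /(_ _ q0)[M _ HM] : forall e : R, 0 < e -> \forall n \near \oo, `|g w - f n w| < e.
    by apply/cvgrPdist_lt; exact: fg.
  have [_ /=] := H M I; apply; rewrite -ball_normE/= distrC; apply: HM => /=.
  exact: leq_addl.
apply: bigcupT_measurable => q; apply: bigcupT_measurable => N.
apply: bigcapT_measurable => n; apply: borel_measurable_on_closed => //.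
exact: closed_erosion.
Qed.

Lemma separable_seq X : separable X ->
  exists e : nat -> X, forall x (r : R), 0 < r -> exists n, `|x - e n| < r.
Proof.
move=> [E cE dE]; have E0 : E !=set0.
  by have [x []] := dE setT (ex_intro _ 0 I) openT; exists x.
have [x1 Ex1] := E0.
have [e eE] : exists e : nat -> X, E `<=` range e.
  have /countable_injP[f finj] := cE.
  exists (fun n => xget x1 [set x | E x /\ f x = n]) => x Ex; exists (f x) => //.
  case: xgetP => [y _ [Ey fyx]|/(_ x)[]//].
  by apply: finj; rewrite ?inE.
exists e => x r r0; have [y [xy Ey]] : ball x r `&` E !=set0.
  by apply: dE; [exists x; exact: ballxx|exact: ball_open].
have [n _ ny] := eE y Ey; exists n.
by rewrite ny; move: xy; rewrite -ball_normE.
Qed.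

(** The preimage of [U] is a countable union of intersections of preimages of two balls, centred on
    dense sequences and with product sent into [U]. *)
Lemma borel_measurable_on2 Y Z W (f : Omega -> Y) (h : Omega -> Z)
    (g : Y -> Z -> W) :
  separable Y -> separable Z ->
  (forall U y z, open U -> U (g y z) -> exists2 e : R, 0 < e &
     forall y' z', `|y - y'| < e -> `|z - z'| < e -> U (g y' z')) ->
  borel_measurable_on D f -> borel_measurable_on D h ->
  borel_measurable_on D (fun w => g (f w) (h w)).
Proof.
move=> /separable_seq[ey Hy] /separable_seq[ez Hz] cg mf mh.
apply: borel_measurable_onP => U oU.
pose good (i j q : nat) := forall y z, `|ey i - y| < q.+1%:R^-1 ->
  `|ez j - z| < q.+1%:R^-1 -> U (g y z).
have -> : D `&` (fun w => g (f w) (h w)) @^-1` U =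
  \bigcup_i \bigcup_j \bigcup_(q in [set q | good i j q])
    ((D `&` f @^-1` ball (ey i) q.+1%:R^-1) `&` (D `&` h @^-1` ball (ez j) q.+1%:R^-1)).
  apply/seteqP; split => w /=.
    move=> [Dw /(cg _ _ _ oU)[e e0 He]].
    have [q qe] := small_inv (divr_gt0 e0 (ltr0n R 2)).
    have q0 : 0 < q.+1%:R^-1 :> R by rewrite invr_gt0.
    have [i iw] := Hy (f w) _ q0; have [j jw] := Hz (h w) _ q0.
    exists i => //; exists j => //; exists q => /=.
      move=> y z yi zj; apply: He.
        rewrite (le_lt_trans (ler_distD (ey i) _ _))//.
        by move: iw yi qe; move: (q.+1%:R^-1) => a; lra.
      rewrite (le_lt_trans (ler_distD (ez j) _ _))//.
      by move: jw zj qe; move: (q.+1%:R^-1) => a; lra.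
    by split; split => //; rewrite -ball_normE/= distrC.
  move=> [i _ [j _ [q /= gq [[Dw fw] [_ hw]]]]]; split => //.
  by apply: gq; [move: fw|move: hw]; rewrite -ball_normE.
apply: bigcupT_measurable => i; apply: bigcupT_measurable => j.
apply: bigcup_measurable => q _; apply: measurableI;
  apply: borel_measurable_on_open => //; exact: ball_open.
Qed.

Lemma sot_eval_continuous X Y (x : X) : continuous (fun f : sot X Y => f x).
Proof.
move=> f; apply: (@continuous_comp (sot X Y) {ptws X -> Y} Y
  (fun f => bop_fun f) (fun g => g x)); first exact: initial_continuous.
have /pointwise_cvgP := @cvg_id {ptws X -> Y} (nbhs (bop_fun f : {ptws X -> Y})).
exact.
Qed.

Lemma strongly_measurable_eval X Y (A : Omega -> bop X Y) x :
  strongly_measurable_on D A -> borel_measurable_on D (fun w => A w x).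
Proof. by move=> mA; exact: borel_measurable_on_comp mA (@sot_eval_continuous X Y x). Qed.

Lemma bop_bound_seq X Y (f : bop X Y) (e : nat -> X) (M : R) : 0 <= M ->
  (forall x (r : R), 0 < r -> exists n, `|x - e n| < r) ->
  (forall n, `|f (e n)| <= M * `|e n|) -> forall x, `|f x| <= M * `|x|.
Proof.
move=> M0 He fe x; apply/ler_addgt0Pr => r r0.
have N0 : 0 < M + `|f| + 1 by rewrite ltr_wpDl// addr_ge0.
have [n xn] := He x _ (divr_gt0 r0 N0).
have h1 : `|f x| <= `|f (e n)| + `|f| * `|x - e n|.
  rewrite -lerBlDl (le_trans (lerB_dist _ _))// -linearB.
  exact: bop_opnorm_ub.
have h2 : `|e n| <= `|x| + `|x - e n|.
  by rewrite -lerBlDl distrC (le_trans (lerB_dist _ _)).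
have h3 := fe n; have h4 : M * `|e n| <= M * (`|x| + `|x - e n|) by rewrite ler_wpM2l.
have h5 : (M + `|f| + 1) * `|x - e n| <= r by rewrite mulrC -ler_pdivlMr// ltW.
have := normr_ge0 (x - e n); lra.
Qed.

(* On the set where the norms of the images of a dense sequence are bounded by a
   fixed multiple of those of its terms, the operators are equi-Lipschitz. *)
Lemma borel_measurable_on_apply X Y (A : Omega -> bop X Y) (f : Omega -> X) :
  separable X -> (forall x, borel_measurable_on D (fun w => A w x)) ->
  borel_measurable_on D f -> borel_measurable_on D (fun w => A w (f w)).
Proof.
move=> /separable_seq[e He] mA mf; apply: borel_measurable_onP => U oU.
pose B (m : nat) := \bigcap_i (D `&` (fun w => `|A w (e i)|) @^-1`
  [set y | y <= m.+1%:R * `|e i| ]).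
have bB m w : B m w -> forall x, `|A w x| <= m.+1%:R * `|x|.
  by move=> Bw; apply: bop_bound_seq He _ => // n; have [] := Bw n I.
have -> : D `&` (fun w => A w (f w)) @^-1` U =
  \bigcup_i \bigcup_m \bigcup_q (B m `&` ((D `&` f @^-1` ball (e i) q.+1%:R^-1) `&`
     (D `&` (fun w => A w (e i)) @^-1` erosion U (m.+1%:R * q.+1%:R^-1)))).
  apply/seteqP; split => w /=.
    move=> [Dw /(open_erosion oU)[r r0 rU]].
    pose m := Num.bound `|A w|.
    have m0 : 0 < m.+1%:R :> R by [].
    have Am x : `|A w x| <= m.+1%:R * `|x|.
      rewrite (le_trans (bop_opnorm_ub _ _))// ler_wpM2r//.
      rewrite (le_trans (ltW (archi_boundP (normr_ge0 (A w)))))// ler_nat.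
      exact: leqnSn.
    have [q qe] := small_inv (divr_gt0 r0 (mulr_gt0 (ltr0n R 2) m0)).
    have q0 : 0 < q.+1%:R^-1 :> R by rewrite invr_gt0.
    have [i iw] := He (f w) _ q0.
    exists i => //; exists m => //; exists q => //; split.
      by move=> j _; split => //=.
    split; first by split => //; rewrite -ball_normE/= distrC.
    split => // y; rewrite -ball_normE /= => yi; apply: rU.
    rewrite -ball_normE/= (le_lt_trans (ler_distD (A w (e i)) _ _))//.
    rewrite -linearB; have := Am (f w - e i).
    have h1 : m.+1%:R * `|f w - e i| <= m.+1%:R / q.+1%:R by rewrite ler_pM2l// ltW.
    have h2 : m.+1%:R / q.+1%:R < r / 2.
      rewrite mulrC -ltr_pdivlMr// (lt_le_trans qe)// le_eqVlt -subr_eq0.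
      by apply/orP; left; apply/eqP; field; rewrite gt_eqF.
    move: h1 h2 yi; move: (m.+1%:R / q.+1%:R) (m.+1%:R * _) => a b; lra.
  move=> [i _ [m _ [q _ [Bw [[Dw fw] [_ eU]]]]]]; split => //.
  apply: eU; rewrite -ball_normE/= -linearB.
  rewrite (le_lt_trans (bB _ _ Bw _))// ltr_pM2l//.
  by move: fw; rewrite -ball_normE.
apply: bigcupT_measurable => i; apply: bigcupT_measurable => m.
apply: bigcupT_measurable => q; apply: measurableI.
  apply: bigcapT_measurable => j; apply: borel_measurable_on_closed => //.
  by apply: borel_measurable_on_comp (mA _) _; exact: norm_continuous.
apply: measurableI; first by apply: borel_measurable_on_open => //; exact: ball_open.
by apply: borel_measurable_on_closed => //; exact: closed_erosion.
Qed.

(* For separable spaces, the Borel sets of the strong operator topology are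
   generated by the evaluations, because balls of operators are second
   countable in that topology. *)
Lemma strongly_measurable_of_eval X Y (A : Omega -> bop X Y) :
  separable X -> separable Y ->
  (forall x, borel_measurable_on D (fun w => A w x)) -> strongly_measurable_on D A.
Proof.
move=> /separable_seq[e He] /separable_seq[c Hc] mA.
apply: borel_measurable_onP => U oU.
(* A triple [(i, j, q)] asks that [f (e i)] be within [1 / (q + 1)] of [c j]. Finite lists of
   triples and bounds [m + 1] give countably many sets. *)
pose S (m : nat) (s : seq (nat * nat * nat)) : set (bop X Y) :=
  [set f | (forall i, `|f (e i)| <= m.+1%:R * `|e i|) /\
     forall p, p \in s -> `|c p.1.2 - f (e p.1.1)| < p.2.+1%:R^-1].
have mS m s : measurable (D `&` A @^-1` S m s).
  have -> : D `&` A @^-1` S m s =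
      (\bigcap_i (D `&` (fun w => `|A w (e i)|) @^-1`
         [set y | y <= m.+1%:R * `|e i| ])) `&`
      \bigcap_(p in [set` s])
        (D `&` (fun w => A w (e p.1.1)) @^-1` ball (c p.1.2) p.2.+1%:R^-1).
    apply/seteqP; split => w /=.
      move=> [Dw [h1 h2]]; split; first by move=> i _; split => //; exact: h1.
      by move=> p /= ps; split => //; rewrite -ball_normE; exact: h2.
    move=> [h1 h2]; split; first by have [] := h1 0%N I.
    split=> [i|p ps]; first by have [] := h1 i I.
    by have [_] := h2 p ps; rewrite -ball_normE.
  apply: measurableI.
    apply: bigcapT_measurable => j; apply: borel_measurable_on_closed => //.
    by apply: borel_measurable_on_comp (mA _) _; exact: norm_continuous.
  apply: fin_bigcap_measurable => [|p _]; first exact: finite_seq.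
  by apply: borel_measurable_on_open => //; exact: ball_open.
have -> : D `&` A @^-1` U = \bigcup_m
    \bigcup_s [set w | S m s `<=` U /\ (D `&` A @^-1` S m s) w].
  apply/seteqP; split => [w [Dw Uw]|w [m _ [s _ [SU [Dw /SU]]]]]; last by split.
  pose m := Num.bound `|A w|.
  have Am : forall i, `|A w (e i)| <= m.+1%:R * `|e i|.
    move=> i; rewrite (le_trans (bop_opnorm_ub _ _))// ler_wpM2r//.
    rewrite (le_trans (ltW (archi_boundP (normr_ge0 (A w)))))// ler_nat.
    exact: leqnSn.
  (* For fixed [m], the sets [S m s] containing [A w] generate a filter. It converges pointwise to
     [A w], because the bound [m + 1] carries the approximation from the dense sequence to every
     [x]; hence one of these sets is inside the open set [U]. *)
  pose F : set_system (bop X Y) :=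
    [set P | exists2 s, S m s (A w) & S m s `<=` P].
  have FF : Filter F.
    split.
    - by exists [::].
    - move=> P Q [s sw sP] [t tw tQ]; exists (s ++ t).
        split => // p; rewrite mem_cat => /orP[ps|pt]; first by apply: sw.2.
        by apply: tw.2.
      move=> f [f1 f2]; split; [apply: sP|apply: tQ]; split => // p ps;
        by apply: f2; rewrite mem_cat ps ?orbT.
    - by move=> P Q PQ [s sw sP]; exists s => //; exact: subset_trans PQ.
  have Fw : {ptws, (fun f : bop X Y => bop_fun f) @ F --> bop_fun (A w)}.
    apply/pointwise_cvgP => x; apply/cvgrPdist_lt => r r0.
    have m0 : 0 < m.+1%:R :> R by [].
    have [i xi] := He x _ (divr_gt0 r0 (mulr_gt0 (ltr0n R 4) m0)).
    have [q qr] := small_inv (divr_gt0 r0 (ltr0n R 4)).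
    have q0 : 0 < q.+1%:R^-1 :> R by rewrite invr_gt0.
    have [j jw] := Hc (A w (e i)) _ q0.
    exists [:: (i, j, q)].
      by split => // p; rewrite inE => /eqP -> /=; rewrite distrC.
    move=> f [f1 /(_ (i, j, q))]; rewrite inE eqxx => /(_ isT)/= f2 /=.
    have bd (g : bop X Y) : (forall i, `|g (e i)| <= m.+1%:R * `|e i|) ->
        `|g x - g (e i)| <= r / 4.
      move=> ge; rewrite -linearB.
      rewrite (le_trans (bop_bound_seq (ltW m0) He ge _))//.
      move: xi; rewrite ltr_pdivlMr ?mulr_gt0// => /ltW.
      by move: (m.+1%:R) (`|x - e i|) => a b; lra.
    have := bd _ Am; have := bd _ f1.
    rewrite (_ : A w x - f x = (A w x - A w (e i)) + (A w (e i) - c j) +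
      (c j - f (e i)) - (f x - f (e i))); last first.
      by rewrite !addrA !subrK opprB addrA subrK.
    move=> h1 h2; rewrite (le_lt_trans (ler_normB _ _))//.
    rewrite (@le_lt_trans _ _ (`|A w x - A w (e i)| + `|A w (e i) - c j| +
      `|c j - f (e i)| + `|f x - f (e i)|))//.
      by rewrite lerD2r (le_trans (ler_normD _ _))// lerD2r ler_normD.
    by move: h1 h2 f2 jw qr; move: (q.+1%:R^-1) => a; lra.
  have [V oV VU] := oU; exists m => //.
  have [s sw sV] : ((fun f : bop X Y => bop_fun f) @ F) V.
    by apply: Fw; apply: open_nbhs_nbhs; split => //; rewrite -VU in Uw.
  exists s => //; split; last by split.
  by rewrite -VU; exact: sV.
apply: bigcupT_measurable => m; apply: countable_bigcupT_measurable => // s.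
have [SU|SU] := pselect (S m s `<=` U).
  by rewrite (_ : [set w | _] = D `&` A @^-1` S m s)//; apply/seteqP; split => w // [].
by rewrite (_ : [set w | _] = set0)//; apply/seteqP; split => w // [].
Qed.

End normed.
End borel_measurability.

(** * The Grassmannian *)

Section grassmannian_lines.
Context {R : realType} {X : normedModType R}.
Implicit Types (v x : X) (eta : bop X R) (A B : set X).

Lemma excess_le A B (c : R) : A !=set0 ->
  (forall x, A x -> exists2 b, B b & `|x - b| <= c) -> excess A B <= c.
Proof.
move=> A0 AB; apply: ge_sup; first by have [x Ax] := A0; exists (dist_set x B), x.
move=> _ [x Ax <-]; have [b Bb xb] := AB x Ax.
apply: le_trans xb; apply: ge_inf; last by exists b.
by exists 0 => _ [y _ <-].
Qed.

Lemma closed_zero_set (f : X -> X) : continuous f -> closed [set x | f x = 0].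
Proof.
move=> cf; rewrite (_ : [set x | _] = f @^-1` [set 0])//.
apply: preimage_closed => //; apply: accessible_closed_set1.
exact: hausdorff_accessible (@norm_hausdorff _ X).
Qed.

Lemma closed_ker eta : closed (ker_op eta).
Proof.
rewrite (_ : ker_op eta = eta @^-1` [set 0])//.
apply: preimage_closed; first by move=> x _; exact: bop_continuous.
exact: closed_eq.
Qed.

Lemma subspace_ker eta : subspace_set (ker_op eta).
Proof.
split=> [|a x y /= x0 y0]; first by rewrite /ker_op/= linear0.
by rewrite /ker_op/= bop_linear x0 y0 scaler0 addr0.
Qed.

Lemma subspace_line v : subspace_set (line v).
Proof.
split=> [|a x y [b _ <-] [c _ <-]]; first by exists 0 => //; rewrite scale0r.
by exists (a * b + c) => //; rewrite scalerDl scalerA.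
Qed.

Section pairing.
Variables (eta : bop X R) (v : X).
Hypothesis ev : eta v = 1.

Lemma eta_scale a : eta (a *: v) = a.
Proof. by rewrite linearZ/= ev; exact: mulr1. Qed.

Lemma lineE : line v = [set x | x - rank1 eta v x = 0].
Proof.
apply/seteqP; split => x /=; first by move=> [a _ <-]; rewrite /= eta_scale subrr.
by move=> /subr0_eq ->; exists (eta x).
Qed.

Lemma closed_line : closed (line v).
Proof.
rewrite lineE; apply: closed_zero_set => x; apply: cvgB; first exact: cvg_id.
exact: bop_continuous.
Qed.

Lemma direct_sum_line_ker : direct_sum (line v) (ker_op eta).
Proof.
split=> [|x].
  apply/seteqP; split => x /=.
    by move=> [[a _ <-]]; rewrite /ker_op/= eta_scale => ->; rewrite scale0r.
  by move=> ->; split; [case: (subspace_line v)|case: (subspace_ker eta)].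
exists (eta x *: v), (x - eta x *: v); split; first by exists (eta x).
  by rewrite /ker_op/= linearB/= eta_scale subrr.
by rewrite addrC subrK.
Qed.

Lemma closed_complemented_line : closed_complemented (line v).
Proof.
split; [exact: subspace_line|exact: closed_line|].
have [h1 h2] := direct_sum_line_ker.
by exists (ker_op eta); split=> //; [exact: subspace_ker|exact: closed_ker].
Qed.

Lemma closed_complemented_ker : closed_complemented (ker_op eta).
Proof.
split; [exact: subspace_ker|exact: closed_ker|].
have [h1 h2] := direct_sum_line_ker.
exists (line v); split=> //; [exact: subspace_line|exact: closed_line| |].
  by rewrite setIC.
by move=> x; have [y [z [? ? ->]]] := h2 x; exists z, y; split=> //; rewrite addrC.
Qed.

End pairing.

Lemma closed_complemented0 : closed_complemented [set 0 : X].
Proof.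
split.
- by split=> // a x y -> ->; rewrite scaler0 addr0.
- apply: accessible_closed_set1; exact: hausdorff_accessible (@norm_hausdorff _ X).
- exists setT; split => //; first by rewrite setIT.
  by move=> x; exists 0, x; rewrite add0r.
Qed.

(** The map [a v] to [a v'] carries the unit ball of one line onto that of the other and moves
    points by at most [|v - v'|]. *)
Lemma gr_dist_line (E F : grassmannian X) v v' :
  gr_set E = line v -> gr_set F = line v' -> `|v| = 1 -> `|v'| = 1 ->
  gr_dist E F <= `|v - v'|.
Proof.
move=> Ev Fv' v1 v'1; rewrite ge_max.
have h (u u' : X) : `|u| = 1 -> `|u'| = 1 ->
    excess (closed_unit_ball (line u)) (closed_unit_ball (line u')) <= `|u - u'|.
  move=> u1 u'1; apply: excess_le.
    by exists 0; split; [case: (subspace_line u)|rewrite /= normr0].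
  move=> _ [[a _ <-]] /=; rewrite normrZ u1 mulr1 => a1.
  exists (a *: u'); first by split; [exists a|rewrite /= normrZ u'1 mulr1].
  by rewrite -scalerBr normrZ ler_piMl.
by rewrite Ev Fv' h//= distrC h.
Qed.

(** A vector [x] of the first unit ball is projected to [ker f'] along [u'], then divided by [1 + e]
    to return to the unit ball. The total displacement, [(e x + f'(x) u') / (1 + e)], has norm at
    most [2 e]. *)
Lemma gr_dist_ker (E F : grassmannian X) (eta eta' : bop X R) v v' :
  gr_set E = ker_op eta -> gr_set F = ker_op eta' -> eta v = 1 -> eta' v' = 1 ->
  `|v| = 1 -> `|v'| = 1 -> gr_dist E F <= 2 * `|eta - eta'|.
Proof.
move=> Ev Fv' ev ev' v1 v'1; rewrite ge_max.
have h (f f' : bop X R) (u' : X) : f' u' = 1 -> `|u'| = 1 ->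
    excess (closed_unit_ball (ker_op f)) (closed_unit_ball (ker_op f'))
      <= 2 * `|f - f'|.
  move=> fu' u'1; apply: excess_le.
    by exists 0; split; [case: (subspace_ker f)|rewrite /= normr0].
  move=> x [fx0 /= x1]; set e := `|f - f'|; have e0 : 0 <= e by exact: normr_ge0.
  have fx : `|f' x| <= e.
    have -> : f' x = - ((f - f') x) by rewrite -[(f - f') x]/(f x - f' x) fx0 sub0r opprK.
    by rewrite normrN; exact: bop_opnorm_ball.
  have e1 : 0 < 1 + e by rewrite ltr_pwDl.
  pose y := x - f' x *: u'.
  have y1 : `|y| <= 1 + e.
    by rewrite (le_trans (ler_normB _ _))// lerD// normrZ u'1 mulr1.
  exists ((1 + e)^-1 *: y).
    split; last by rewrite /= normrZ gtr0_norm ?invr_gt0// ler_pdivrMl// mulr1.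
    by rewrite /ker_op/= linearZ/= linearB/= eta_scale// subrr scaler0.
  have -> : x - (1 + e)^-1 *: y = (1 + e)^-1 *: (e *: x + f' x *: u').
    have {1}-> : x = (1 + e)^-1 *: ((1 + e) *: x).
      by rewrite scalerA mulVf ?scale1r// gt_eqF.
    rewrite -scalerBr; congr (_ *: _).
    by rewrite /y scalerDl scale1r opprB addrC addrA subrK addrC.
  rewrite normrZ gtr0_norm ?invr_gt0// ler_pdivrMl//.
  have : `|e *: x + f' x *: u'| <= 2 * e.
    rewrite (le_trans (ler_normD _ _))// !normrZ u'1 mulr1 mulr2n mulrDl mul1r.
    by rewrite lerD// ger0_norm// ler_piMr.
  have : 0 <= e * e by exact: mulr_ge0.
  lra.
rewrite Ev Fv'; apply/andP; split; first exact: (h _ _ v').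
by rewrite distrC; exact: (h _ _ v).
Qed.

End grassmannian_lines.

Section grassmannian_measurability.
Context {d : measure_display} {R : realType} {Omega : topMeasurableType d}.
Context {X : normedModType R}.

Lemma gr_nbhs_ball (E : grassmannian X) U : open U -> U E ->
  exists2 e : R, 0 < e & forall F, gr_dist E F < e -> U F.
Proof.
move=> oU UE; have : nbhs E U by exact: open_nbhs_nbhs.
by move=> /nbhs_ballP[e /= e0 eU]; exists e => // F EF; apply: eU; rewrite ballEmdist.
Qed.

(** The preimage of an open [U] under [E] is, on [D], the preimage under [v] of a union of balls.
    The union may be uncountable: it only has to be open in [X]. *)
Lemma gr_measurable_on (D : set Omega) (v : Omega -> X) (E : Omega -> grassmannian X) :
  measurable D ->
  (forall a b, D a -> D b -> gr_dist (E a) (E b) <= `|v a - v b|) ->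
  borel_measurable_on D v -> borel_measurable_on D E.
Proof.
move=> mD Ev mv; apply: borel_measurable_onP => // U oU.
pose V := \bigcup_(p in [set p : Omega * R | [/\ D p.1, 0 < p.2 &
  forall F, gr_dist (E p.1) F < p.2 -> U F]]) ball (v p.1) p.2.
have -> : D `&` E @^-1` U = D `&` v @^-1` V.
  apply/seteqP; split => w /= [Dw].
    move=> /(gr_nbhs_ball oU)[e e0 eU]; split => //; exists (w, e) => //.
    exact: ballxx.
  move=> [[b e] /= [Db e0 eU]]; rewrite -ball_normE/= => bw; split => //.
  by apply: eU; exact: le_lt_trans (Ev _ _ Db Dw) bw.
apply: borel_measurable_on_open => //; apply: bigcup_open => p _; exact: ball_open.
Qed.

End grassmannian_measurability.

(** * Sets of full measure and mu-continuity *)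

Section full_measure.
Context {d : measure_display} {T : measurableType d} {R : realType}.
Variable mu : probability T R.
Implicit Types A B : set T.

Lemma full_negligible A : measurable A -> mu A = 1%E <-> mu (~` A) = 0%E.
Proof.
move=> mA; rewrite probability_setC//; split=> [->|/eqP]; first by rewrite subee.
have fA : mu A \is a fin_num by exact: fin_num_measure.
by rewrite sube_eq ?fA// ?fin_num_adde_defr// add0e => /eqP <-.
Qed.

Lemma full_bigcap (A : nat -> set T) : (forall n, measurable (A n)) ->
  (forall n, mu (A n) = 1%E) -> mu (\bigcap_n A n) = 1%E.
Proof.
move=> mA A1; apply/full_negligible; first exact: bigcapT_measurable.
rewrite setC_bigcap; apply/negligibleP.
  by apply: bigcupT_measurable => n; exact: measurableC.
apply: negligible_bigcup => n; apply/negligibleP; first exact: measurableC.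
exact/full_negligible.
Qed.

Lemma full_setI A B : measurable A -> measurable B -> mu A = 1%E ->
  mu B = 1%E -> mu (A `&` B) = 1%E.
Proof.
move=> mA mB A1 B1; rewrite -bigcap2E; apply: full_bigcap => -[|[|n]] //=.
exact: probability_setT.
Qed.

End full_measure.

Section invariant_sets.
Context {d : measure_display} {R : realType} {Omega : topMeasurableType d}.
Variable mu : probability Omega R.
Variables sigma sigmaV : Omega -> Omega.
Hypothesis erg : ergodic_invertible_mpt mu sigma sigmaV.

Lemma ergodic_invertible_mptV : ergodic_invertible_mpt mu sigmaV sigma.
Proof.
have [[sK VK] [ms mV] inv er] := erg; split => // A mA.
  have mVA : measurable (sigmaV @^-1` A) by rewrite -[_ @^-1` _]setTI; exact: mV.
  rewrite -inv//; congr (mu _); apply/seteqP; split => w /=; by rewrite sK.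
by move=> VA; apply: er => //; rewrite -{1}VA; apply/seteqP; split => w /=; rewrite sK.
Qed.

(** The points whose whole orbit, past and future, stays in [A] form an exactly invariant set, which
    is a countable intersection of sets of full measure. *)
Lemma invariant_full_sub A : measurable A -> mu A = 1%E ->
  exists2 D, invariant_full mu sigma D & D `<=` A.
Proof.
move=> mA A1; have [[sK VK] [ms mV] inv er] := erg.
have [_ _ invV _] := ergodic_invertible_mptV.
have mP (s : Omega -> Omega) n : measurable_fun setT s -> measurable (iter n s @^-1` A).
  by move=> ms'; rewrite -[_ @^-1` _]setTI; exact: measurable_iter.
pose D := (\bigcap_n iter n sigma @^-1` A) `&` (\bigcap_n iter n sigmaV @^-1` A).
exists D; last by move=> w [/(_ 0%N I)].
split.
- by apply: measurableI; apply: bigcapT_measurable => n; exact: mP.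
- apply: full_setI; try by apply: bigcapT_measurable => n; exact: mP.
    by apply: full_bigcap => n; [exact: mP|rewrite mpt_iter].
  by apply: full_bigcap => n; [exact: mP|rewrite mpt_iter].
- apply/seteqP; split => w [H1 H2]; split => n _.
  + by case: n => [|n]; [have := H2 1%N I; rewrite /= sK|have := H1 n I; rewrite /= -iterSr].
  + by have := H2 n.+1 I; rewrite /= -iterS iterSr sK.
  + by have := H1 n.+1 I; rewrite /= -iterS iterSr.
  + case: n => [|n]; first by have := H1 1%N I.
    by rewrite /= -iterS iterSr sK; exact: (H2 n I).
Qed.

Lemma ae_invariant_full (P : Omega -> Prop) : {ae mu, forall w, P w} ->
  exists2 D, invariant_full mu sigma D & forall w, D w -> P w.
Proof.
move=> [N [mN N0 PN]]; have mCN := measurableC mN.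
have CN1 : mu (~` N) = 1%E by apply/full_negligible => //; rewrite setCK.
have [D iD DN] := invariant_full_sub mCN CN1.
exists D => // w /DN Nw; apply: contrapT => Pw; exact/Nw/PN.
Qed.

Lemma invariant_full_iter D n w : sigma @^-1` D = D -> D w ->
  D (iter n sigma w) /\ D (iter n sigmaV w).
Proof.
have [[sK VK] _ _ _] := erg; move=> sD Dw; elim: n => // n [ih1 ih2]; split => /=.
  by move: ih1; rewrite -{1}sD.
by rewrite -sD /= VK.
Qed.

End invariant_sets.

Section small_measure.
Context d (T : measurableType d) (R : realType) (mu : probability T R).
Local Open Scope ereal_scope.

Lemma measure_bigcup_small (N : nat -> set T) (e : R) : (0 <= e)%R ->
  (forall n, measurable (N n)) ->
  (forall n, mu (N n) <= (e / (2 ^ n.+1)%:R)%:E) -> mu (\bigcup_n N n) <= e%:E.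
Proof.
move=> e0 mN Ne; apply: le_trans (epsilon_trick0 xpredT e0).
apply: (@le_trans _ _ (\sum_(n <oo) mu (N n))).
  apply: measure_sigma_subadditive => //.
  exact: bigcupT_measurable.
by apply: lee_nneseries => // n _.
Qed.

Lemma decreasing_small (F : nat -> set T) (e : R) : (0 < e)%R ->
  (forall n, measurable (F n)) -> (forall m n, (m <= n)%N -> F n `<=` F m) ->
  \bigcap_n F n = set0 -> exists n, mu (F n) <= e%:E.
Proof.
move=> e0 mF dF F0.
have cv : (mu \o F) x @[x --> \oo] --> mu (\bigcap_n F n).
  apply: nonincreasing_cvg_mu => //.
  - by rewrite (le_lt_trans (probability_le1 _ _))// ltry.
  - exact: bigcapT_measurable.
  - by move=> m n mn; rewrite /Order.le/=; apply/asboolP; exact: dF.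
rewrite F0 measure0 in cv.
have e0' : 0 < e%:E by rewrite lte_fin.
have [N _ /(_ N (leqnn _)) h] := cv _ (open_ereal_lt' e0').
by exists N; exact: ltW.
Qed.

Lemma increasing_full_small (F : nat -> set T) (e : R) : (0 < e)%R ->
  (forall n, measurable (F n)) -> (forall m n, (m <= n)%N -> F m `<=` F n) ->
  mu (\bigcup_n F n) = 1 -> exists n, mu (~` F n) <= e%:E.
Proof.
move=> e0 mF iF F1; have mU : measurable (\bigcup_n F n) by exact: bigcupT_measurable.
have [||||n h] := @decreasing_small (fun n => (\bigcup_n F n) `\` F n) e.
- exact: e0.
- by move=> n; exact: measurableD.
- by move=> m n mn w [Uw Fw]; split => // /(iF _ _ mn).
- rewrite -subset0 => w H; have [[k _ Fk] _] := H 0%N I.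
  by have [_ /(_ Fk)] := H k I.
exists n; apply: le_trans h.
have -> : mu (~` F n) = mu ((\bigcup_n F n `\` F n) `|` ~` (\bigcup_n F n)).
  congr (mu _); apply/seteqP; split => w /=.
    by move=> Fw; have [Uw|Uw] := pselect ((\bigcup_n F n) w); [left|right].
  by move=> [[_ //]|Uw Fw]; apply: Uw; exists n.
apply: (le_trans (measureU2 _ _ _)); [exact: measurableD|exact: measurableC|].
by rewrite [X in _ + X](_ : _ = 0) ?adde0//; apply/full_negligible.
Qed.

End small_measure.

(** * Inner regularity by closed sets *)

Section closed_regularity.
Context {d : measure_display} {R : realType} {Omega : topMeasurableType d}.
Variable mu : probability Omega R.
Hypothesis bP : borel_of_polish R Omega.
Hypothesis mB : (@measurable d Omega) = (@borel Omega).

Lemma borel_of_polish_hausdorff : hausdorff_space Omega.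
Proof.
have [P [i [hP _ inji oi _]]] := bP; rewrite open_hausdorff => x y xy.
have ixy : i x != i y by apply: contra_neq xy => /inji.
rewrite open_hausdorff in hP; have [[A B] [/= Ax By] [oA oB AB]] := hP _ _ ixy.
exists (i @^-1` A, i @^-1` B); first by move: Ax By; rewrite !inE.
split; [by apply/oi; exists A|by apply/oi; exists B|].
by apply/eqP; rewrite -preimage_setI/= (eqP AB) preimage_set0.
Qed.

Lemma open_measurable_borel (U : set Omega) : open U -> measurable U.
Proof. by move=> oU; rewrite mB; exact: sub_sigma_algebra. Qed.

Lemma closed_measurable_borel (U : set Omega) : closed U -> measurable U.
Proof.
by move=> cU; rewrite -[U]setCK; apply/measurableC/open_measurable_borel/closed_openC.
Qed.

(** In the Polish space, the closures of the sets of points whose ball of radius [1 / (n + 1)] stays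
    in [V] increase to [V]; they are pulled back by the embedding. *)
Lemma open_Fsigma (U : set Omega) : open U -> exists F : nat -> set Omega,
  [/\ forall n, closed (F n), forall m n, (m <= n)%N -> F m `<=` F n &
      \bigcup_n F n = U].
Proof.
have [P [i [hP _ inji oi _]]] := bP; move=> /oi[V oV <-].
pose E n := [set x | ball x (n.+1%:R^-1 : R) `<=` V].
exists (fun n => i @^-1` closure (E n)); split.
- move=> n; apply: preimage_closed; last exact: closed_closure.
  by move=> x _; move: x; apply/continuousP => A oA; apply/oi; exists A.
- move=> m n mn; apply: preimage_subset; apply: closure_subset => x Em y xy.
  by apply: Em; apply: le_ball xy; rewrite lef_pV2 ?posrE// ler_nat.
- apply/seteqP; split => w /=.
    move=> [n _ /= clw].
    have n2 : 0 < n.+1%:R^-1 :> R by rewrite invr_gt0.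
    have [x [Ex xw]] := clw _ (nbhsx_ballx (i w) _ n2).
    by apply: Ex; exact: ball_sym.
  move=> Vw; have : nbhs (i w) V by exact: open_nbhs_nbhs.
  move=> /nbhs_ballP[e /= e0 eV].
  have [N _ /(_ N (leqnn _)) h] := near_infty_natSinv_lt (PosNum e0).
  exists N => //=; apply: subset_closure => y yw; apply: eV.
  by apply: le_ball yw; exact: ltW.
Qed.

(** Approximation from inside of [A] and of its complement together: the condition is symmetric,
    which makes the class stable under complement. *)
Let regular (A : set Omega) := forall e : R, 0 < e -> exists F H : set Omega,
  [/\ closed F, closed H, F `<=` A, H `<=` ~` A & (mu (~` (F `|` H)) <= e%:E)%E].

Let regular_open A : open A -> regular A.
Proof.
move=> oA e e0; have [F [cF iF FA]] := open_Fsigma oA.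
have [||||n h] := @decreasing_small _ _ _ mu (fun n => A `\` F n) e.
- exact: e0.
- by move=> n; apply: measurableD; [exact: open_measurable_borel|
    exact: closed_measurable_borel].
- by move=> m n mn w [Aw Fw]; split => // /(iF _ _ mn).
- rewrite -subset0 => w H; have [] := H 0%N I; rewrite -{1}FA => -[k _ Fk] _.
  by have [_ /(_ Fk)] := H k I.
exists (F n), (~` A); split => //.
- exact: open_closedC.
- by rewrite -FA => w Fw; exists n.
- by rewrite setCU setCK setIC -setDE.
Qed.

Let regularC A : regular A -> regular (~` A).
Proof.
move=> rA e e0; have [F [H [cF cH FA HA h]]] := rA e e0; exists H, F.
by rewrite setUC setCK; split.
Qed.

(** The union of the inner closed sets need not be closed, so it is cut at a finite stage, for half
    of [e]; the errors of the individual sets share the other half. *)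
Let regular_bigcup (A : nat -> set Omega) : (forall n, regular (A n)) ->
  regular (\bigcup_n A n).
Proof.
move=> rA e e0; have e2 : 0 < e / 2 by rewrite divr_gt0.
have e2n n : 0 < e / 2 / (2 ^ n.+1)%:R by rewrite divr_gt0// ltr0n expn_gt0.
have /choice[F /choice[H FH]] : forall n, exists F, exists H : set Omega,
  [/\ closed F, closed H, F `<=` A n, H `<=` ~` A n &
  (mu (~` (F `|` H)) <= (e / 2 / (2 ^ n.+1)%:R)%:E)%E] by move=> n; exact: rA.
have cF n : closed (F n) by have [] := FH n.
have cH n : closed (H n) by have [] := FH n.
have mF n := closed_measurable_borel (cF n).
have mH n := closed_measurable_borel (cH n).
pose FN n := \big[setU/set0]_(i < n) F i.
have FNP n w : FN n w -> exists2 i, (i < n)%N & F i w.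
  by rewrite /FN -bigcup_mkord => -[i /= iN Fi]; exists i.
have cFN n : closed (FN n) by exact: closed_bigsetU.
have mFN n := closed_measurable_borel (cFN n).
have mUF : measurable (\bigcup_n F n) by exact: bigcupT_measurable.
have iFN m n : (m <= n)%N -> FN m `<=` FN n.
  by move=> mn w /FNP[i im Fi]; rewrite /FN -bigcup_mkord; exists i => //=; exact: leq_trans im mn.
have [||||N h] := @decreasing_small _ _ _ mu (fun n => (\bigcup_n F n) `\` FN n) (e / 2).
- exact: e2.
- by move=> n; exact: measurableD.
- by move=> m n mn w [Uw Fw]; split => // /(iFN _ _ mn).
- rewrite -subset0 => w Hw; have [[k _ Fk] _] := Hw 0%N I.
  by have [_] := Hw k.+1 I; apply; rewrite /FN -bigcup_mkord; exists k => //=.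
exists (FN N), (\bigcap_n H n); split => //.
- exact: closed_bigI.
- by move=> w /FNP[i _ Fi]; exists i => //; have [_ _ /(_ _ Fi)] := FH i.
- move=> w Hw [i _ Ai]; have [_ _ _ /(_ w (Hw i I))] := FH i; exact.
have mB1 n : measurable (~` (F n `|` H n)) by apply: measurableC; exact: measurableU.
have sub : ~` (FN N `|` \bigcap_n H n) `<=`
   (\bigcup_n ~` (F n `|` H n)) `|` ((\bigcup_n F n) `\` FN N).
  move=> w; rewrite setCU => -[FNw /existsNP[n /not_implyP[_ Hn]]].
  have [Fn|Fn] := pselect (F n w); first by right; split => //; exists n.
  by left; exists n => // -[].
have mU : measurable (\bigcup_n ~` (F n `|` H n)) by exact: bigcupT_measurable.
apply: (le_trans (le_measure _ _ _ sub)); rewrite ?inE.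
- apply: measurableC; apply: measurableU => //; exact: bigcapT_measurable.
- by apply: measurableU => //; exact: measurableD.
apply: (le_trans (measureU2 _ _ _)) => //; first exact: measurableD.
rewrite [e]splitr EFinD; apply: leeD => //.
by apply: measure_bigcup_small => // [|n]; [exact: ltW|have [] := FH n].
Qed.

Lemma closed_inner_regular (A : set Omega) (e : R) : measurable A -> 0 < e ->
  exists F, [/\ closed F, F `<=` A & (mu (~` F) <= mu (~` A) + e%:E)%E].
Proof.
move=> mA e0; have rA : regular A.
  have : borel A by rewrite -mB.
  suff : @borel Omega `<=` regular by apply.
  apply: smallest_sub; last by move=> U; exact: regular_open.
  split; last exact: regular_bigcup.
    move=> r r0; exists set0, setT; rewrite setC0 set0U setCT measure0 lee_fin.
    by split => //; [exact: closed0|exact: ltW].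
  by move=> B rB; rewrite setTD; exact: regularC.
have [F [H [cF cH FA HA h]]] := rA e e0; exists F; split => //.
have mF := closed_measurable_borel cF; have mH := closed_measurable_borel cH.
have sub : ~` F `<=` ~` A `|` ~` (F `|` H).
  move=> w Fw; have [Aw|Aw] := pselect (A w); last by left.
  by right => -[//|/HA].
apply: (le_trans (le_measure _ _ _ sub)); rewrite ?inE.
- exact: measurableC.
- by apply: measurableU; apply: measurableC => //; exact: measurableU.
apply: (le_trans (measureU2 _ _ _)); [exact: measurableC| |exact: leeD].
by apply: measurableC; exact: measurableU.
Qed.

End closed_regularity.

(** * Continuity relative to a subset *)

Section continuity_within.
Context {R : realType}.

(** Continuity of the restriction to [K] in the form of a limit along a filter, to which the limit
    theorems apply directly. *)
Definition cont_in {T U : topologicalType} (K : set T) (f : T -> U) :=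
  forall w, K w -> f @ within K (nbhs w) --> f w.

Lemma cont_inP {T U : topologicalType} (K : set T) (f : T -> U) :
  {within K, continuous f} <-> cont_in K f.
Proof. exact: subspace_continuousP. Qed.

Lemma cont_in_comp {S T U : topologicalType} (K : set S) (K' : set T)
    (g : S -> T) (f : T -> U) :
  continuous g -> (forall w, K w -> K' (g w)) -> cont_in K' f -> cont_in K (f \o g).
Proof.
move=> cg KK' cf w Kw P PU.
have h : nbhs w (g @^-1` [set x | K' x -> P (f x)]) := cg w _ (cf (g w) (KK' w Kw) P PU).
change (nbhs w [set x | K x -> P (f (g x))]).
by apply: filterS h => x h Kx; exact: h (KK' x Kx).
Qed.

Lemma cont_in_eq {T U : topologicalType} (K : set T) (f g : T -> U) :
  (forall w, K w -> f w = g w) -> cont_in K f -> cont_in K g.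
Proof.
move=> fg cf w Kw P; rewrite -fg// => PU.
have h : nbhs w [set x | K x -> P (f x)] := cf w Kw P PU.
change (nbhs w [set x | K x -> P (g x)]).
by apply: filterS h => x h Kx; rewrite -fg//; exact: h.
Qed.

Lemma cvg_bilinear {T : Type} {F : set_system T} {FF : Filter F}
    {U V W : normedModType R} (B : U -> V -> W) (f : T -> U) (g : T -> V) a b :
  (forall a a' b, B (a - a') b = B a b - B a' b) ->
  (forall a b b', B a (b - b') = B a b - B a b') ->
  (forall a b, `|B a b| <= `|a| * `|b|) ->
  f @ F --> a -> g @ F --> b -> (fun x => B (f x) (g x)) @ F --> B a b.
Proof.
move=> Bl Br Bn fa gb.
have h0 : `|a - f x| * `|b| + `|f x| * `|b - g x| @[x --> F] --> `|a - a| * `|b| + `|a| * `|b - b|.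
  apply: cvgD; apply: cvgM; try exact: cvg_cst.
  - by apply: cvg_norm; apply: cvgB => //; exact: cvg_cst.
  - exact: cvg_norm.
  - by apply: cvg_norm; apply: cvgB => //; exact: cvg_cst.
rewrite !subrr !normr0 mul0r mulr0 addr0 in h0.
apply/cvgrPdist_le => e e0; move/cvgrPdist_le : h0 => /(_ e e0).
apply: filterS => x; rewrite sub0r normrN ger0_norm ?addr_ge0 ?mulr_ge0//.
apply: le_trans.
have -> : B a b - B (f x) (g x) = B (a - f x) b + B (f x) (b - g x).
  by rewrite Bl Br addrA subrK.
by rewrite (le_trans (ler_normD _ _))// lerD.
Qed.

Lemma cont_in_bilinear {T : topologicalType} {U V W : normedModType R}
    (B : U -> V -> W) (K : set T) (f : T -> U) (g : T -> V) :
  (forall a a' b, B (a - a') b = B a b - B a' b) ->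
  (forall a b b', B a (b - b') = B a b - B a b') ->
  (forall a b, `|B a b| <= `|a| * `|b|) ->
  cont_in K f -> cont_in K g -> cont_in K (fun x => B (f x) (g x)).
Proof.
move=> Bl Br Bn cf cg w Kw.
by apply: (cvg_bilinear Bl Br Bn); [exact: cf|exact: cg].
Qed.

Lemma cont_in_comp_op {T : topologicalType} {X Y Z : normedModType R} (K : set T)
    (f : T -> bop Y Z) (g : T -> bop X Y) :
  cont_in K f -> cont_in K g -> cont_in K (fun w => comp_op (f w) (g w) : bop X Z).
Proof.
apply: (@cont_in_bilinear T (bop Y Z) (bop X Y) (bop X Z) (fun f g => comp_op f g)).
- by move=> a a' b; apply/bopP => x.
- by move=> a b b'; apply/bopP => x /=; exact: (linearB a).
- move=> a b; apply: opnorm_le => x x1 /=.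
  rewrite (le_trans (bop_opnorm_ub _ _))// ler_wpM2l ?bop_opnorm_ge0//.
  exact: bop_opnorm_ball.
Qed.

Lemma cont_in_eval {T : topologicalType} {X Y : normedModType R} (K : set T)
    (f : T -> bop X Y) (g : T -> X) :
  cont_in K f -> cont_in K g -> cont_in K (fun w => f w (g w)).
Proof.
apply: (@cont_in_bilinear T (bop X Y) X Y (fun f g => f g)).
- by [].
- by move=> a b b'; exact: (linearB a).
- by move=> a b; exact: bop_opnorm_ub.
Qed.

Lemma rank1_norm_le {X Y : normedModType R} (eta : bop X R) (v : Y) :
  `|rank1 eta v| <= `|eta| * `|v|.
Proof.
by apply: opnorm_le => x x1 /=; rewrite normrZ ler_wpM2r//; exact: bop_opnorm_ball.
Qed.

Lemma cont_in_rank1 {T : topologicalType} {X Y : normedModType R} (K : set T)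
    (f : T -> bop X R) (g : T -> Y) :
  cont_in K f -> cont_in K g -> cont_in K (fun w => rank1 (f w) (g w)).
Proof.
apply: (@cont_in_bilinear T (bop X R) Y (bop X Y) (fun f g => rank1 f g)).
- move=> a a' b; apply/bopP => x.
  by rewrite -[LHS]/((a x - a' x) *: b) scalerBl.
- by move=> a b b'; apply/bopP => x /=; exact: scalerBr.
- by move=> a b; exact: rank1_norm_le.
Qed.

Lemma cont_in_uniform_limit {T : topologicalType} {X : normedModType R} (K : set T)
    (f : T -> X) :
  (forall e : R, 0 < e -> exists2 g, cont_in K g & forall w, K w -> `|g w - f w| <= e) ->
  cont_in K f.
Proof.
move=> H w Kw; apply/cvgrPdist_le => e e0.
have e3 : 0 < e / 3 by rewrite divr_gt0.
have [g cg gf] := H _ e3; have := cg w Kw; move/cvgrPdist_le => /(_ _ e3).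
have := withinT K (nbhs_filter w); apply: filterS2 => x Kx gx.
have -> : f w - f x = (g w - g x) - (g w - f w) + (g x - f x).
  by rewrite opprB [g w - g x + _]addrC !subrKA.
rewrite (le_trans (ler_normD _ _))// (_ : e = e / 3 + e / 3 + e / 3); last by field.
by rewrite lerD ?gf// (le_trans (ler_normB _ _))// lerD ?gf.
Qed.

End continuity_within.

(** * Compact sets of almost full measure *)

Section mu_continuity.
Context {d : measure_display} {R : realType} {Omega : topMeasurableType d}.
Variable mu : probability Omega R.
Hypothesis bP : borel_of_polish R Omega.
Hypothesis mB : (@measurable d Omega) = (@borel Omega).

Lemma compact_closed_polish (K : set Omega) : compact K -> closed K.
Proof. by apply: compact_closed; exact: borel_of_polish_hausdorff bP. Qed.

(** The definition asks for an increasing sequence: finite unions provide it, and continuity on each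
    piece passes to a finite union because compact sets are closed here. *)
Lemma mu_continuous_of_small (D : set Omega) (T : topologicalType) (f : Omega -> T) :
  (forall e : R, 0 < e -> exists K, [/\ compact K, K `<=` D, cont_in K f &
     (mu (~` K) <= e%:E)%E]) -> mu_continuous_on mu D f.
Proof.
move=> H; have /choice[K HK] : forall n : nat, exists K, [/\ compact K, K `<=` D, cont_in K f &
   (mu (~` K) <= (n.+1%:R^-1)%:E)%E].
  by move=> n; apply: H; rewrite invr_gt0.
have cK n : closed (K n) by have [/compact_closed_polish] := HK n.
have mK n := closed_measurable_borel mB (cK n).
pose Q n := \big[setU/set0]_(i < n.+1) K i.
have QS n : Q n.+1 = Q n `|` K n.+1 by rewrite /Q big_ord_recr.
have Q0 : Q 0%N = K 0%N by rewrite /Q big_ord_recr big_ord0/= set0U.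
have QP n : [/\ compact (Q n), Q n `<=` D & cont_in (Q n) f].
  elim: n => [|n [cQ QD ctQ]]; first by rewrite Q0; have [] := HK 0%N.
  have [cK' KD ctK _] := HK n.+1; rewrite QS; split.
  - exact: compactU.
  - by move=> w [/QD|/KD].
  - apply/cont_inP/withinU_continuous => //; [exact: compact_closed_polish|..];
      exact/cont_inP.
exists Q; split.
- by move=> n; have [] := QP n.
- by move=> n; rewrite QS; exact: subsetUl.
- have mQ n : measurable (Q n).
    by apply: closed_measurable_borel => //; have [/compact_closed_polish] := QP n.
  have mU : measurable (\bigcup_n Q n) by exact: bigcupT_measurable.
  apply/full_negligible => //; apply/eqP; rewrite eq_le measure_ge0 andbT.
  apply/lee_addgt0Pr => e e0; rewrite add0e.
  have [N _ /(_ N (leqnn _)) h] := near_infty_natSinv_lt (PosNum e0).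
  apply: (@le_trans _ _ (mu (~` K N))).
    apply: le_measure; rewrite ?inE; [exact: measurableC|exact: measurableC|].
    apply: subsetC => w Kw; exists N => //.
    by rewrite /Q big_ord_recr/=; right.
  have [_ _ _ /le_trans] := HK N; apply; rewrite lee_fin; exact: ltW.
- by move=> n; apply/cont_inP; have [] := QP n.
Qed.

Variables sigma sigmaV : Omega -> Omega.
Hypothesis erg : ergodic_invertible_mpt mu sigma sigmaV.
Hypothesis csigma : continuous sigma.
Hypothesis csigmaV : continuous sigmaV.

Lemma continuous_iter (s : Omega -> Omega) n : continuous s -> continuous (iter n s).
Proof.
move=> cs; elim: n => [|n ih]; first by move=> x; exact: cvg_id.
by move=> x; apply: (continuous_comp (ih x)); exact: cs.
Qed.

(** For each [j], the condition that [sigma^j w] and [sigma^-j w] be in a compact set of continuity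
    of [L] loses a share of order [e / 2^j] of the measure, since [sigma] preserves it. A closed
    subset of [A] takes the remaining [e / 2]. *)
Lemma compact_continuity_set {X : normedModType R} (L : Omega -> bop X X) A (e : R) :
  mu_continuous_on mu setT L -> measurable A -> 0 < e ->
  exists K, [/\ compact K, K `<=` A,
    forall j, cont_in K (L \o iter j sigma),
    forall j, cont_in K (L \o iter j sigmaV) &
    (mu (~` K) <= mu (~` A) + e%:E)%E].
Proof.
move=> [K0 [cK0 iK0 K01 ctK0]] mA e0.
have [[sK VK] [ms mV] inv _] := erg.
have [_ _ invV _] := ergodic_invertible_mptV erg.
have clK0 n : closed (K0 n) by apply: compact_closed_polish; have [] := cK0 n.
have mK0 n := closed_measurable_borel mB (clK0 n).
have iK0' m n : (m <= n)%N -> K0 m `<=` K0 n.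
  elim: n => [|n ih]; first by rewrite leqn0 => /eqP ->.
  by rewrite leq_eqVlt ltnS => /predU1P[->//|/ih h] w /h /iK0.
have e4 : 0 < e / 4 by rewrite divr_gt0.
have /choice[q Hq] : forall j, exists n, (mu (~` K0 n) <= (e / 4 / (2 ^ j.+1)%:R)%:E)%E.
  move=> j; apply: increasing_full_small => //.
  by rewrite divr_gt0// ltr0n expn_gt0.
have [F [cF FA hF]] := closed_inner_regular mu bP mB mA (divr_gt0 e0 (ltr0n R 2)).
pose P (s : Omega -> Omega) := \bigcap_j (iter j s @^-1` K0 (q j)).
have cP s : continuous s -> closed (P s).
  move=> cs; apply: closed_bigI => j _; apply: preimage_closed => // x _.
  exact: continuous_iter.
have muP s : continuous s -> measurable_fun setT s ->
    (forall B, measurable B -> mu (s @^-1` B) = mu B) -> (mu (~` P s) <= (e / 4)%:E)%E.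
  move=> cs mes invs; rewrite setC_bigcap; apply: measure_bigcup_small => [|n|n].
  - exact: ltW.
  - by apply: measurableC; rewrite -[_ @^-1` _]setTI; exact: measurable_iter.
  - by rewrite preimage_setC mpt_iter//; exact: measurableC.
exists (F `&` (P sigma `&` P sigmaV)); split.
(* The condition for [j = 0] already places this closed set in the compact set [K0 (q 0)]. *)
- apply: (@subclosed_compact _ _ (K0 (q 0%N))).
  + by apply: closedI => //; apply: closedI; exact: cP.
  + by have [] := cK0 (q 0%N).
  + by move=> w [_ [/(_ 0%N I)]].
- by move=> w [/FA].
- move=> j; apply: (@cont_in_comp _ _ _ _ (K0 (q j))); first exact: continuous_iter.
    by move=> w [_ [/(_ j I)]].
  exact/cont_inP.
- move=> j; apply: (@cont_in_comp _ _ _ _ (K0 (q j))); first exact: continuous_iter.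
    by move=> w [_ [_ /(_ j I)]].
  exact/cont_inP.
- have mF := closed_measurable_borel mB cF.
  have mP1 := closed_measurable_borel mB (cP _ csigma).
  have mP2 := closed_measurable_borel mB (cP _ csigmaV).
  rewrite !setCI.
  apply: (le_trans (measureU2 _ _ _)); [exact: measurableC| |].
    by apply: measurableU; exact: measurableC.
  rewrite [e]splitr EFinD addeA; apply: leeD => //.
  apply: (le_trans (measureU2 _ _ _)); [exact: measurableC|exact: measurableC|].
  rewrite (_ : e / 2 = e / 4 + e / 4); last by field.
  by rewrite EFinD; apply: leeD; exact: muP.
Qed.

End mu_continuity.

(** * The invariant splitting *)

Section construction.
Context {R : realType} {Omega : Type} {X : completeNormedModType R}.
Variables (sigma sigmaV : Omega -> Omega) (L : Omega -> bop X X) (C : set X).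
Hypothesis sigmaK : cancel sigma sigmaV.
Hypothesis sigmaVK : cancel sigmaV sigma.
Hypothesis nC : nice_cone C.
Hypothesis LC : forall w, L w @` C `<=` C.
Variables (G : set Omega) (k : nat) (Delta : R).
Hypothesis k0 : (0 < k)%N.
Hypothesis Delta0 : 0 < Delta.
Hypothesis GD : forall w, G w -> cone_bounded C (cocycle sigma L k w) Delta.
Variables (D K : R).
Hypothesis D1 : 1 <= D.
Hypothesis normalD : forall x y,
  cone_le C (- y) x -> cone_le C x y -> `|x| <= D * `|y|.
Hypothesis K0 : 0 < K.
Hypothesis nonflatK : forall x, exists y z, [/\ cone_le C 0 y, cone_le C 0 z,
  x = y - z, `|y| <= K * `|x| & `|z| <= K * `|x|].
Variable x0 : X.
Hypothesis Cx0 : C x0.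

Local Notation visits := (visits sigma G).
Local Notation pulled := (pulled sigma sigmaV L).
Local Notation cocycle := (cocycle sigma L).

(** The second clause counts the visits during the [n] steps that lead to [w]. *)
Definition visited w := (forall B : R, exists n, B < visits n w) /\
  (forall B : R, exists n, B < visits n (iter n sigmaV w)).

(** The threshold [B] does not depend on [w]: a uniform number of visits will make the limits
    uniform. *)
Lemma visits_contract (e : R) : 0 < e ->
  exists B : R, forall n w, B < visits n w -> cone_bounded C (cocycle n w) e.
Proof.
move=> e0; have r01 : 0 < tanh (Delta / 4) < 1 by apply: tanh_itv; rewrite divr_gt0.
have [B HB] := small_powR r01 Delta0 e0.
have kR : 0 < k%:R :> R by rewrite ltr0n.
exists (Num.max k%:R ((B + 2) * k%:R)) => n w; rewrite gt_max => /andP[h1 h2].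
move=> u z Cu Cz; apply: prox_le (cocycle_bounded nC LC k0 Delta0 GD h1 Cu Cz).
by apply: HB; rewrite lerBrDr ler_pdivlMr// ltW.
Qed.

Lemma visited_forward w : visited w ->
  forall e : R, 0 < e -> exists n, cone_bounded C (cocycle n w) e.
Proof. by move=> [vw _] e /visits_contract[B HB]; have [n /HB] := vw B; exists n. Qed.

Lemma visited_backward w : visited w -> backward_contracting sigma sigmaV L C w.
Proof. by move=> [_ vw] e /visits_contract[B HB]; have [n /HB] := vw B; exists n. Qed.

Variable Om : set Omega.
Hypothesis Om_visited : forall w, Om w -> visited w.
Hypothesis OmS : forall w, Om w -> Om (sigma w).
Hypothesis OmV : forall w, Om w -> Om (sigmaV w).

Let v := vlim sigma sigmaV L x0.
Let phi w := `|L w (v w)|.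

Lemma dir_cone w : Om w -> C (v w).
Proof. by move=> /Om_visited/visited_backward; exact: (vlim_cone sigmaVK nC LC D1 normalD). Qed.

Lemma dir_norm w : Om w -> `|v w| = 1.
Proof. by move=> /Om_visited/visited_backward; exact: (vlim_norm sigmaVK nC LC D1 normalD). Qed.

Let CLv w : Om w -> C (L w (v w)).
Proof. by move=> /dir_cone Cv; apply: LC; exists (v w). Qed.

Lemma dir_phi_gt0 w : Om w -> 0 < phi w.
Proof. by move=> /CLv Cv; rewrite normr_gt0; exact: (cone_neq0 nC). Qed.

Lemma dir_equivariant w : Om w -> L w (v w) = phi w *: v (sigma w).
Proof.
move=> Ow; have := visited_backward (Om_visited (OmS Ow)).
have := visited_backward (Om_visited Ow) => bw bsw.
rewrite /v (vlim_equivariant sigmaK sigmaVK nC LC D1 normalD Cx0 bw bsw).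
by rewrite /normalize scalerA divff ?scale1r// gt_eqF// dir_phi_gt0.
Qed.

Lemma OmSn n w : Om w -> Om (iter n sigma w).
Proof. by move=> Ow; elim: n => //= n; exact: OmS. Qed.

Lemma OmVn n w : Om w -> Om (iter n sigmaV w).
Proof. by move=> Ow; elim: n => //= n; exact: OmV. Qed.

Lemma cocycle_dir (u : Omega -> X) (psi : Omega -> R) n w :
  (forall w, Om w -> L w (u w) = psi w *: u (sigma w)) -> Om w ->
  cocycle n w (u w) = (\prod_(i < n) psi (iter i sigma w)) *: u (iter n sigma w).
Proof.
move=> uE Ow; elim: n => [|n ih] /=; first by rewrite big_ord0 scale1r.
by rewrite ih linearZ/= uE ?scalerA ?big_ord_recr//; exact: OmSn.
Qed.

(** By equivariance, [u w] is the normalized image of the cone vector [u (sigma^-n w)] for every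
    [n], and [vlim_unique] applies. *)
Lemma dir_unique (u : Omega -> X) (psi : Omega -> R) :
  (forall w, Om w -> C (u w)) -> (forall w, Om w -> `|u w| = 1) ->
  (forall w, Om w -> 0 < psi w) ->
  (forall w, Om w -> L w (u w) = psi w *: u (sigma w)) ->
  forall w, Om w -> u w = v w.
Proof.
move=> uC u1 psi0 uE w Ow.
apply: (vlim_unique sigmaVK nC LC D1 normalD Cx0).
  exact: visited_backward (Om_visited Ow).
move=> n; exists (u (iter n sigmaV w)); first exact/uC/OmVn.
rewrite /pulled (cocycle_dir n uE (OmVn n Ow)) iterVK// normalizeZ.
  by rewrite normalize_id// u1.
by apply: prodr_gt0 => i _; apply: psi0; apply/OmSn/OmVn.
Qed.

Let Tv w n := cocycle n w (v w).

(** What the regularity and growth statements use of [eta]; they take any family with these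
    properties. *)
Definition functional_spec w (eta : bop X R) := [/\
  forall x, asymptotic_value C (fun n => cocycle n w) (v w) x (eta x),
  forall x, C x -> 0 < eta x,
  eta (v w) = 1,
  forall t n, cone_bounded C (cocycle n w) t ->
    `|eta| <= 2 * K * (expR t * D * `|cocycle n w| / `|Tv w n|) &
  forall t n x, cone_bounded C (cocycle n w) t ->
    `|cocycle n w x - eta x *: Tv w n| <=
      2 * D * K * (expR t - 1) * `|eta| * `|x| * `|Tv w n| ].

Lemma functional_exists : exists eta : Omega -> bop X R,
  forall w, Om w -> functional_spec w (eta w).
Proof.
suff /choice[eta H] : forall w, exists e : bop X R, Om w -> functional_spec w e.
  by exists eta.
move=> w.
have [Ow|nOw] := pselect (Om w); last by exists 0.
pose T n := cocycle n w.
have Tm m n x y : (m <= n)%N -> cone_le C (T m x) (T m y) -> cone_le C (T n x) (T n y).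
  exact: cocycle_mono.
have TC n x : C x -> C (T n x) by exact: cocycle_cone.
have Tc := visited_forward (Om_visited Ow).
exists (asymptotic_functional nC Tm TC (dir_cone Ow) Tc D1 normalD nonflatK) => _.
split.
- exact: asymptotic_functionalP.
- exact: asymptotic_functional_gt0.
- exact: asymptotic_functional_v.
- exact: asymptotic_functional_bound.
- exact: asymptotic_functional_approx.
Qed.

Variable eta : Omega -> bop X R.
Hypothesis etaP : forall w, Om w -> functional_spec w (eta w).

(** Time [n] from [sigma w] is time [n + 1] from [w], and [v] is rescaled by [phi w]: the left side
    divided by [phi w] is an asymptotic value of [x], which is unique. *)
Lemma functional_equivariant w x : Om w ->
  eta (sigma w) (L w x) = phi w * eta w x.
Proof.
move=> Ow; have p0 := dir_phi_gt0 Ow.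
have [ew _ _ _ _] := etaP Ow; have [esw _ _ _ _] := etaP (OmS Ow).
have Tm m n y z : (m <= n)%N -> cone_le C (cocycle m w y) (cocycle m w z) ->
   cone_le C (cocycle n w y) (cocycle n w z) by exact: cocycle_mono.
have TC n y : C y -> C (cocycle n w y) by exact: cocycle_cone.
suff -> : eta w x = eta (sigma w) (L w x) / phi w.
  by rewrite mulrC divfK// gt_eqF.
apply: (asymptotic_value_unique nC Tm TC (dir_cone Ow) (ew x)) => e e0.
have [n [h1 h2]] := esw (L w x) (e * phi w) (mulr_gt0 e0 p0).
have vE : cocycle n (sigma w) (v (sigma w)) = (phi w)^-1 *: cocycle n.+1 w (v w).
  by rewrite cocycleSr dir_equivariant// linearZ/= scalerA mulVf ?scale1r// gt_eqF.
exists n.+1; rewrite -cocycleSr vE !scalerA in h1 h2.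
rewrite (_ : eta (sigma w) (L w x) / phi w - e =
  (eta (sigma w) (L w x) - e * phi w) / phi w); last by field; rewrite gt_eqF.
rewrite (_ : eta (sigma w) (L w x) / phi w + e =
  (eta (sigma w) (L w x) + e * phi w) / phi w); last by field; rewrite gt_eqF.
by split.
Qed.

Lemma functional_norm_ge1 w : Om w -> 1 <= `|eta w|.
Proof.
move=> Ow; have [_ _ e1 _ _] := etaP Ow.
by rewrite -[leLHS]normr1 -e1; apply: bop_opnorm_ball; rewrite dir_norm.
Qed.

Lemma cocycle_norm_dir n w : Om w ->
  `|cocycle n w (v w)| = \prod_(i < n) phi (iter i sigma w).
Proof.
move=> Ow; rewrite (cocycle_dir n dir_equivariant Ow) normrZ dir_norm ?mulr1.
  by rewrite ger0_norm// prodr_ge0// => i _; rewrite ltW// dir_phi_gt0//; exact: OmSn.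
exact: OmSn.
Qed.

Lemma cocycle_dir_gt0 n w : Om w -> 0 < `|cocycle n w (v w)|.
Proof.
by move=> Ow; rewrite cocycle_norm_dir// prodr_gt0// => i _; apply/dir_phi_gt0/OmSn.
Qed.

(** From [n0] on the image of the cone keeps diameter at most 1, so one constant serves for all
    later times. *)
Lemma cocycle_norm_le w : Om w -> exists2 c, 0 < c &
  \forall n \near \oo, `|cocycle n w| <= c * `|cocycle n w (v w)|.
Proof.
move=> Ow; have [_ _ _ _ ap] := etaP Ow.
have [n0 b0] := visited_forward (Om_visited Ow) (@ltr01 R).
have e1 := functional_norm_ge1 Ow.
have c0 : 0 <= 2 * D * K * (expR 1 - 1) * `|eta w|.
  have d0 : 0 <= D := le_trans ler01 D1.
  have d1 : 0 <= expR 1 - 1 :> R by rewrite subr_ge0 -[leLHS]expR0 ler_expR.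
  by rewrite !mulr_ge0// ltW.
exists (2 * D * K * (expR 1 - 1) * `|eta w| + `|eta w|).
  by rewrite ltr_wpDl// (lt_le_trans ltr01).
exists n0 => // n /= n0n; apply: opnorm_le => x x1.
have bn : cone_bounded C (cocycle n w) 1.
  move=> u z Cu Cz; rewrite -(subnK n0n) !cocycleD.
  by apply: prox_map; [move=> y; exact: cocycle_cone|exact: b0].
have -> : cocycle n w x = (cocycle n w x - eta w x *: Tv w n) + eta w x *: Tv w n.
  by rewrite subrK.
rewrite (le_trans (ler_normD _ _))// mulrDl lerD//.
  rewrite (le_trans (ap 1 n x bn))// ler_wpM2r//.
  by rewrite -[leRHS]mulr1 ler_wpM2l.
by rewrite normrZ ler_wpM2r//; exact: bop_opnorm_ball.
Qed.

Lemma cocycle_norm_ge n w : Om w -> `|cocycle n w (v w)| <= `|cocycle n w|.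
Proof. by move=> Ow; apply: bop_opnorm_ball; rewrite dir_norm. Qed.

(** On the kernel the main term of the approximation vanishes; only the error, governed by the
    current diameter, remains. *)
Lemma cocycle_ker_le n w : Om w -> k%:R < visits n w :> R ->
  opnorm_on (ker_op (eta w)) (cocycle n w) <=
    2 * D * K * (expR (Delta * tanh (Delta / 4) `^ (visits n w / k%:R - 2)) - 1) *
      `|eta w| * `|cocycle n w (v w)|.
Proof.
move=> Ow kv; have [_ _ _ _ ap] := etaP Ow.
have bn := cocycle_bounded nC LC k0 Delta0 GD kv.
set t := Delta * _ in bn *.
have t1 : 0 <= expR t - 1.
  by rewrite subr_ge0 -[leLHS]expR0 ler_expR mulr_ge0 ?powR_ge0// ltW.
apply: ge_sup.
  by exists `|cocycle n w 0|, 0 => //; split; [case: (subspace_ker (eta w))|rewrite /= normr0].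
move=> _ [x [ex /= x1] <-].
have := ap _ _ x bn; rewrite ex scale0r subr0 => /le_trans; apply.
have d0 : 0 <= D := le_trans ler01 D1.
by rewrite ler_wpM2r// -[leRHS]mulr1 ler_wpM2l// !mulr_ge0// ltW.
Qed.

(** The diameter bound [Delta r ^ (- 2)], valid after more than [k] visits, makes [c] independent of
    [m] and [w], so that the inequality can be used at varying points of an orbit. *)
Lemma functional_log_bound : exists c, forall m w, Om w -> k%:R < visits m w :> R ->
  ln `|eta w| <= c + (ln `|cocycle m w| - ln `|cocycle m w (v w)|).
Proof.
pose t := Delta * tanh (Delta / 4) `^ (- 2).
exists (ln (2 * K * (expR t * D))) => m w Ow kv.
have [_ _ _ bd _] := etaP Ow.
have D0 : 0 < D := lt_le_trans ltr01 D1.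
have v0 := cocycle_dir_gt0 m Ow.
have c0 : 0 < `|cocycle m w| := lt_le_trans v0 (cocycle_norm_ge m Ow).
have A0 : 0 < 2 * K * (expR t * D) by rewrite !mulr_gt0// expR_gt0.
have q0 : 0 < `|cocycle m w| / `|cocycle m w (v w)| by rewrite divr_gt0.
have e0 : 0 < `|eta w| := lt_le_trans ltr01 (functional_norm_ge1 Ow).
rewrite -ln_div ?posrE// -lnM ?posrE// ler_ln ?posrE//; last exact: mulr_gt0.
have := bd _ _ (cocycle_boundedW nC LC k0 Delta0 GD kv).
by rewrite !mulrA.
Qed.

End construction.

(** * Averages and upper limits *)

Section limsup.
Context {R : realType}.
Implicit Types (u a : nat -> \bar R) (l x : \bar R).

Lemma lee_forall_fin x l : (forall c : R, (l < c%:E)%E -> (x <= c%:E)%E) -> (x <= l)%E.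
Proof.
case: l => [r||] H; last 2 first.
- exact: leey.
- case: x H => [r| |//] H; last by have := H 0 (ltNyr 0).
  by have := H (r - 1) (ltNyr _); rewrite lee_fin lerBrDr gerDl ler10.
- apply/lee_addgt0Pr => e e0; rewrite -EFinD; apply: H.
  by rewrite lte_fin ltrDl.
Qed.

Lemma limn_esup_le u a l : (\forall n \near \oo, (u n <= a n)%E) ->
  a @ \oo --> l -> (limn_esup u <= l)%E.
Proof.
move=> ua al; apply: lee_forall_fin => c lc.
have ac : \forall n \near \oo, (a n < c%:E)%E by exact: al _ (open_ereal_lt' lc).
apply: (@le_trans _ _ (ereal_sup (u @` [set n | (u n <= c%:E)%E]))).
  apply: ereal_inf_lbound; exists [set n | (u n <= c%:E)%E] => //.
  by apply: filterS2 ua ac => n h1 h2; exact: le_trans h1 (ltW h2).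
by apply: ge_ereal_sup => _ [n /= un <-].
Qed.

Lemma limn_esup_cvg u l : u @ \oo --> l -> limn_esup u = l.
Proof.
move=> ul; rewrite is_cvg_limn_esupE; first exact: cvg_lim.
by apply/cvg_ex; exists l.
Qed.

Lemma lne_le_expR (y b : R) : y <= expR b -> (lne y%:E <= b%:E)%E.
Proof.
move=> yb; have [y0|y0] := leP y 0; first by rewrite le0_lneNy ?lee_fin// leNye.
by rewrite lne_EFin// lee_fin -[leRHS]expRK ler_ln ?posrE// expR_gt0.
Qed.

(** The hypothesis is stated with [expR (b n)] because [y n] may be 0, in which case its logarithm
    is [-oo]. *)
Lemma limn_esup_lne (y : nat -> R) (b : nat -> R) (s : nat -> R) l :
  (\forall n \near \oo, y n <= expR (b n)) ->
  (n%:R^-1 * (b n - s n))%:E @[n --> \oo] --> l ->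
  (limn_esup (fun n : nat => n%:R^-1%:E * lne (y n)%:E - (n%:R^-1 * s n)%:E) <= l)%E.
Proof.
move=> yb; apply: limn_esup_le; apply: filterS yb => n yb.
rewrite mulrBr EFinB leeB// EFinM lee_wpmul2l ?lee_fin//.
exact: lne_le_expR.
Qed.

End limsup.

Section averages.
Context {R : realType}.
Implicit Types (U : nat -> R).

Lemma cvg_average_cst (c : R) : n%:R^-1 * c @[n --> \oo] --> (0 : R).
Proof.
rewrite -[X in _ --> X](mul0r c); apply: cvgM; last exact: cvg_cst.
apply/cvgrPdist_le => e e0; near=> n.
rewrite sub0r normrN ger0_norm ?invr_ge0//.
have n0 : 0 < n%:R :> R by rewrite ltr0n; near: n; exact: nbhs_infty_gt.
rewrite -[leLHS]mul1r ler_pdivrMr//; near: n; exact: near_lin_bound.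
Unshelve. all: by end_near. Qed.

(** The finitely many terms before the averages are close to [u] are absorbed in the constant
    [M]. *)
Lemma average_linear_bound U (u : R) : n%:R^-1 * U n @[n --> \oo] --> u ->
  forall e : R, 0 < e -> exists M, forall n, `|U n - n%:R * u| <= e * n%:R + M.
Proof.
move=> /cvgrPdist_le Uu e e0; have [N _ HN] := Uu e e0.
exists (\sum_(j < N.+1) `|U j - j%:R * u|) => n.
have [nN|Nn] := leqP n N.
  rewrite (bigD1 (Ordinal (nN : n < N.+1)%N))//= addrCA lerDl.
  by apply: addr_ge0; [rewrite mulr_ge0// ltW|exact: sumr_ge0].
rewrite (@le_trans _ _ (e * n%:R))// ?lerDl ?sumr_ge0//.
have n0 : 0 < n%:R :> R by rewrite ltr0n (leq_trans _ Nn).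
have := HN n (ltnW Nn); rewrite /= -(ler_pM2r n0) => /(le_trans _); apply.
have -> : U n - n%:R * u = - ((u - n%:R^-1 * U n) * n%:R) by field; rewrite gt_eqF.
by rewrite normrN normrM (ger0_norm (ltW n0)).
Qed.

Lemma average_increment U (u : R) : n%:R^-1 * U n @[n --> \oo] --> u ->
  forall e : R, 0 < e -> \forall n \near \oo, forall m, (m <= n)%N ->
    `|U (n + m)%N - U n - m%:R * u| <= e * n%:R /\
    `|U n - U (n - m)%N - m%:R * u| <= e * n%:R.
Proof.
(* With slope error [e / 5], the deviations at [n + m <= 2 n] and at [n] cost three shares of [n],
   and the constant [M], counted twice, two more. *)
move=> Uu e e0; have e5 : 0 < e / 5 by rewrite divr_gt0.
have [M HM] := average_linear_bound Uu e5.
near=> n => m mn.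
have Mn : M <= e / 5 * n%:R by near: n; exact: near_lin_bound.
have mn' : m%:R <= n%:R :> R by rewrite ler_nat.
have m0 : 0 <= m%:R :> R by [].
have := HM n; have := HM (n + m)%N; have := HM (n - m)%N.
rewrite natrD natrB// !ler_norml => /andP[a1 a2] /andP[b1 b2] /andP[c1 c2].
have em : e * m%:R <= e * n%:R by rewrite ler_pM2l.
have em0 : 0 <= e * m%:R by rewrite mulr_ge0// ltW.
move: (U n) (U (n + m)%N) (U (n - m)%N) a1 a2 b1 b2 c1 c2 => p q r a1 a2 b1 b2 c1 c2.
by split; apply/andP; split; lra.
Unshelve. all: by end_near. Qed.

(* If f n is controlled by an increment of length m as soon as another
   increment of the same length exceeds k, and both have linear growth, then
   choosing m a small proportion of n shows that f is sublinear. *)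
Lemma sublinear_of_increments (f : nat -> R) (A B : nat -> nat -> R) (c k u h : R) :
  0 < u -> (forall n, 0 <= f n) ->
  (forall n m, (m <= n)%N -> k < A n m -> f n <= c + B n m) ->
  (forall e : R, 0 < e -> \forall n \near \oo, forall m, (m <= n)%N ->
     `|A n m - m%:R * u| <= e * n%:R /\ `|B n m - m%:R * h| <= e * n%:R) ->
  n%:R^-1 * f n @[n --> \oo] --> (0 : R).
Proof.
move=> u0 f0 fAB HAB.
suff key (e : R) : 0 < e -> \forall n \near \oo, `|0 - n%:R^-1 * f n| <= e.
  by apply/cvgrPdist_le => e; exact: key.
move=> e0; have h1 : 0 < `|h| + 1 by rewrite ltr_wpDl.
(* [1 / (q + 1)] is the proportion of [n] given to [m], small enough that [m |h|] is at most [e / 4]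
   times [n]. *)
have [q qe] : exists q : nat, q.+1%:R^-1 < e / 4 / (`|h| + 1).
  by apply: small_inv; rewrite !divr_gt0.
have q0 : 0 < q.+1%:R^-1 :> R by rewrite invr_gt0.
(* The error allowed in the increments: a quarter of [e] for [B], and a quarter of the main term
   [u / (q + 1)] for [A]. *)
pose d := Num.min (e / 4) (q.+1%:R^-1 * u / 4).
have d0 : 0 < d by rewrite lt_min !divr_gt0// mulr_gt0.
have de : d <= e / 4 by rewrite ge_min lexx.
have du : d <= q.+1%:R^-1 * u / 4 by rewrite ge_min lexx orbT.
near=> n; have n0 : 0 < n%:R :> R by rewrite ltr0n; near: n; exact: nbhs_infty_gt.
have ku : k + u <= q.+1%:R^-1 * u / 4 * n%:R.
  by near: n; apply: near_lin_bound; rewrite divr_gt0// mulr_gt0.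
have ce : c <= e / 4 * n%:R by near: n; apply: near_lin_bound; rewrite divr_gt0.
pose m := (n %/ q.+1)%N; have mn : (m <= n)%N := leq_div n q.+1.
have [h2 h3] : `|A n m - m%:R * u| <= d * n%:R /\ `|B n m - m%:R * h| <= d * n%:R.
  by move: m mn; near: n; exact: HAB.
have mq : m%:R <= n%:R * q.+1%:R^-1 :> R.
  by rewrite ler_pdivlMr// -natrM ler_nat leq_trunc_div.
have qm : n%:R * q.+1%:R^-1 - 1 <= m%:R :> R.
  rewrite lerBlDr ler_pdivrMr// natr1 -natrM ler_nat ltnW//.
  by rewrite /m; exact: ltn_ceil.
have m0 : 0 <= m%:R :> R by [].
rewrite sub0r normrN ger0_norm ?mulr_ge0 ?invr_ge0//.
rewrite mulrC ler_pdivrMr//.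
have dn : d * n%:R <= e / 4 * n%:R by rewrite ler_pM2r.
have dnu : d * n%:R <= q.+1%:R^-1 * u / 4 * n%:R by rewrite ler_pM2r.
have mu : (n%:R * q.+1%:R^-1 - 1) * u <= m%:R * u by rewrite ler_pM2r.
have mh : m%:R * h <= e / 4 * n%:R.
  rewrite (@le_trans _ _ (m%:R * (`|h| + 1)))//.
    by rewrite ler_wpM2l// (le_trans (ler_norm h))// lerDl.
  rewrite (@le_trans _ _ (n%:R * q.+1%:R^-1 * (`|h| + 1)))//.
    by rewrite ler_pM2r.
  rewrite -mulrA [leRHS]mulrC ler_pM2l// -ler_pdivlMr//.
  exact: ltW.
move: h2 h3; rewrite !ler_norml => /andP[h2 _] /andP[_ h3].
have kA : k < A n m.
  have s0' := q0; move: h2 dnu mu ku s0'.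
  move: (q.+1%:R^-1) (m%:R * u) => s mu0 h2 dnu mu ku s0.
  have : 0 < s * u * n%:R by rewrite !mulr_gt0.
  lra.
have en : 0 < e * n%:R by rewrite mulr_gt0.
have := fAB n m mn kA; lra.
Unshelve. all: by end_near. Qed.

End averages.

(** * Regularity of the splitting *)

Section continuity_of_limits.
Context {d : measure_display} {R : realType} {Omega : topMeasurableType d}.
Context {X : completeNormedModType R}.
Variables (sigma sigmaV : Omega -> Omega) (L : Omega -> bop X X) (C : set X).
Hypothesis sigmaK : cancel sigma sigmaV.
Hypothesis sigmaVK : cancel sigmaV sigma.
Hypothesis nC : nice_cone C.
Hypothesis LC : forall w, L w @` C `<=` C.
Variables (G : set Omega) (k : nat) (Delta : R).
Hypothesis k0 : (0 < k)%N.
Hypothesis Delta0 : 0 < Delta.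
Hypothesis GD : forall w, G w -> cone_bounded C (cocycle sigma L k w) Delta.
Variables (D K : R).
Hypothesis D1 : 1 <= D.
Hypothesis normalD : forall x y,
  cone_le C (- y) x -> cone_le C x y -> `|x| <= D * `|y|.
Hypothesis K0 : 0 < K.
Variable x0 : X.
Hypothesis Cx0 : C x0.
Variable Om : set Omega.
Hypothesis Om_visited : forall w, Om w -> visited sigma sigmaV G (R:=R) w.
Hypothesis OmS : forall w, Om w -> Om (sigma w).
Hypothesis OmV : forall w, Om w -> Om (sigmaV w).

Local Notation pulled := (pulled sigma sigmaV L).
Local Notation cocycle := (cocycle sigma L).
Let v := vlim sigma sigmaV L x0.

Variable Q : set Omega.
Hypothesis QOm : Q `<=` Om.
Hypothesis QS : forall j, cont_in Q (L \o iter j sigma).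
Hypothesis QV : forall j, cont_in Q (L \o iter j sigmaV).
Hypothesis Q_visits : forall B : R, exists n, forall w, Q w ->
  B < visits sigma G n w /\ B < visits sigma G n (iter n sigmaV w).

Lemma cont_in_cocycle n : cont_in Q (cocycle n : Omega -> bop X X).
Proof.
elim: n => [|n ih]; first by move=> w _; exact: cvg_cst.
exact: (cont_in_comp_op (@QS n) ih).
Qed.

Lemma cont_in_pulled n : cont_in Q (pulled n : Omega -> bop X X).
Proof.
elim: n => [|n ih]; first by move=> w _; exact: cvg_cst.
apply: (cont_in_eq _ (cont_in_comp_op ih (@QV n.+1))) => w _.
by apply/bopP => x; rewrite -[RHS]/(pulled n.+1 w x) -addn1 (pulledD _ sigmaVK) addn1.
Qed.

Let Cnz x : C x -> x != 0. Proof. exact: cone_neq0. Qed.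

Lemma cont_in_normalize (f : Omega -> X) :
  (forall w, Q w -> C (f w)) -> cont_in Q f -> cont_in Q (fun w => normalize (f w)).
Proof.
move=> Cf cf w Qw; apply: cvgZ; last exact: cf.
apply: cvgV; last by apply: cvg_norm; exact: cf.
by rewrite normr_eq0; exact/Cnz/Cf.
Qed.

Let Qpulled (e : R) : 0 < e -> exists n, forall w, Q w -> cone_bounded C (pulled n w) e.
Proof.
move=> /(visits_contract nC LC k0 Delta0 GD)[B HB]; have [n Hn] := Q_visits B.
by exists n => w /Hn[_ h]; exact: HB.
Qed.

Let Qcocycle (e : R) : 0 < e -> exists n, forall w, Q w -> cone_bounded C (cocycle n w) e.
Proof.
move=> /(visits_contract nC LC k0 Delta0 GD)[B HB]; have [n Hn] := Q_visits B.
by exists n => w /Hn[h _]; exact: HB.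
Qed.

Lemma cont_in_dir : cont_in Q v.
Proof.
apply: cont_in_uniform_limit => e e0.
have [|t t0 te] := @small_expR1 _ (2 * D ^+ 2) e _ e0.
  by rewrite mulr_ge0// sqr_ge0.
have [n Hn] := Qpulled t0.
exists (fun w => normalize (pulled n w x0)).
  apply: cont_in_normalize; first by move=> w _; exact: pulled_cone.
  by apply: cont_in_eval; [exact: cont_in_pulled|move=> w _; exact: cvg_cst].
move=> w Qw; apply: le_trans te.
apply: (vlim_dist sigmaVK nC LC D1 normalD Cx0) => //; last exact: Hn.
exact: (visited_backward nC LC k0 Delta0 GD (Om_visited (QOm Qw))).
Qed.

Variable eta : Omega -> bop X R.
Hypothesis etaP : forall w, Om w ->
  functional_spec sigma sigmaV L C D K x0 w (eta w).

Let Cv w : Q w -> C (v w).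
Proof. by move=> /QOm; exact: (dir_cone sigmaVK nC LC k0 Delta0 GD D1 normalD Cx0 Om_visited). Qed.

Let Tv n w := cocycle n w (v w).

Let CTv n w : Q w -> C (Tv n w).
Proof. by move=> /Cv; exact: cocycle_cone. Qed.

Let Tv_gt0 n w : Q w -> 0 < `|Tv n w|.
Proof. by move=> /CTv Cw; rewrite normr_gt0; exact: Cnz. Qed.

Let cTv n : cont_in Q (Tv n).
Proof. by apply: cont_in_eval; [exact: cont_in_cocycle|exact: cont_in_dir]. Qed.

(* [eta w] is recovered, up to a small error, from the continuous family of
   operators [cocycle n w] divided by [`|cocycle n w (v w)|]. *)
Lemma cont_in_functional : cont_in Q eta.
Proof.
move=> w Qw; apply/cvgrPdist_le => e e0.
have D0 : 0 <= D := le_trans ler01 D1.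
have [n1 Hn1] := Qcocycle (@ltr01 R).
(* The error of the approximation contains the factor [|eta w'|]. The bound of this norm at the
   single time [n1] depends continuously on [w'], so it is locally bounded. *)
pose bnd (w' : Omega) := 2 * K * (expR 1 * D * `|cocycle n1 w'| / `|Tv n1 w'|).
have cb : bnd w' @[w' --> within Q (nbhs w)] --> bnd w.
  apply: cvgM; first exact: cvg_cst.
  apply: cvgM; last first.
    apply: cvgV; first by rewrite gt_eqF// Tv_gt0.
    by apply: cvg_norm; exact: cTv.
  apply: cvgM; first exact: cvg_cst.
  by apply: cvg_norm; exact: cont_in_cocycle.
pose M := bnd w + 1.
have nM : \forall w' \near within Q (nbhs w), Q w' -> `|eta w'| <= M.
  move/cvgrPdist_le : cb => /(_ _ ltr01); apply: filterS => w' h Qw'.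
  have [_ _ _ bd _] := etaP (QOm Qw').
  rewrite (le_trans (bd _ _ (Hn1 w' Qw')))//.
  by rewrite /M -lerBlDl (le_trans (ler_norm _))// distrC.
have M0 : 0 <= M.
  by rewrite /M /bnd addr_ge0// !mulr_ge0 ?expR_ge0 ?invr_ge0// ltW.
have e4 : 0 < e / 4 by rewrite divr_gt0.
have c0 : 0 <= 2 * D * K * M by rewrite !mulr_ge0// ltW.
have [t t0 te] := small_expR1 c0 e4.
have [n Hn] := Qcocycle t0.
have approx w' x : Q w' -> `|eta w'| <= M -> `|x| <= 1 ->
   `|(`|Tv n w'|^-1) *: cocycle n w' x - eta w' x *: normalize (Tv n w')| <= e / 4.
  move=> Qw' eM x1; have [_ _ _ _ ap] := etaP (QOm Qw').
  have Tv0 := Tv_gt0 n Qw'.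
  rewrite /normalize scalerA mulrC -scalerA -scalerBr normrZ.
  rewrite ger0_norm ?invr_ge0// ler_pdivrMl// mulrC.
  rewrite (le_trans (ap t n x (Hn w' Qw')))//.
  rewrite ler_wpM2r//; apply: le_trans te.
  have t1 : 0 <= expR t - 1.
    by rewrite subr_ge0 -[leLHS]expR0 ler_expR ltW.
  have a1 : `|eta w'| * `|x| <= M * 1 by apply: ler_pM.
  have a2 : 0 <= 2 * D * K * (expR t - 1) by rewrite !mulr_ge0// ltW.
  have := ler_wpM2l a2 a1; rewrite mulr1 mulrA => /le_trans; apply.
  by rewrite mulrAC.
have cP : (fun w' => `|Tv n w'|^-1 *: cocycle n w' : bop X X) @ within Q (nbhs w) -->
    (`|Tv n w|^-1 *: cocycle n w : bop X X).
  apply: cvgZ; last exact: cont_in_cocycle.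
  apply: cvgV; first by rewrite gt_eqF// Tv_gt0.
  by apply: cvg_norm; exact: cTv.
have cu := cont_in_normalize (@CTv n) (@cTv n) Qw.
have e4M : 0 < e / 4 / (M + 1) by rewrite divr_gt0// ltr_wpDl.
have eMw : `|eta w| <= M.
  have [_ _ _ bd _] := etaP (QOm Qw).
  by rewrite (le_trans (bd _ _ (Hn1 w Qw)))// lerDl.
move/cvgrPdist_le : cP => /(_ _ e4) cP; move/cvgrPdist_le : cu => /(_ _ e4M) cu.
have wQ := withinT Q (nbhs_filter w).
near=> w'.
have Qw' : Q w' by near: w'.
have eMw' : `|eta w'| <= M by near: w'; apply: filterS2 wQ nM => z Qz; exact.
have hP : `|(`|Tv n w|^-1 *: cocycle n w : bop X X) - `|Tv n w'|^-1 *: cocycle n w'| <= e / 4.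
  by near: w'.
have hu : `|normalize (Tv n w) - normalize (Tv n w')| <= e / 4 / (M + 1) by near: w'.
apply: opnorm_le => x x1.
have a1 := approx w x Qw eMw x1; have a2 := approx w' x Qw' eMw' x1.
have a3 : `|(`|Tv n w|^-1) *: cocycle n w x - (`|Tv n w'|^-1) *: cocycle n w' x| <= e / 4.
  by apply: le_trans hP; exact: (bop_opnorm_ball
    ((`|Tv n w|^-1 *: cocycle n w : bop X X) - `|Tv n w'|^-1 *: cocycle n w') x1).
set P := `|Tv n w|^-1 *: cocycle n w x in a1 a3.
set P' := `|Tv n w'|^-1 *: cocycle n w' x in a2 a3.
set u := normalize (Tv n w) in a1 hu.
set u' := normalize (Tv n w') in a2 hu.
have u1 : `|u| = 1 by rewrite (normalize_norm nC)//; exact: CTv.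
(* Since [u] is a unit vector, the difference of scalars becomes a difference of vectors, compared
   through the normalized operators [P] and [P']: four errors of [e / 4]. *)
have -> : `|(eta w - eta w') x| = `|(eta w x *: u - eta w' x *: u)|.
  by rewrite -scalerBl normrZ u1 mulr1.
have -> : eta w x *: u - eta w' x *: u = - (P - eta w x *: u) + (P - P') +
    ((P' - eta w' x *: u') - eta w' x *: (u - u')).
  by rewrite opprB subrKA scalerBr opprB -(addrA P') [- _ + (_ - _)]addrA addNr add0r subrKA.
have a4 : `|eta w' x *: (u - u')| <= e / 4.
  rewrite normrZ (@le_trans _ _ (M * (e / 4 / (M + 1))))//.
    apply: ler_pM => //; apply: le_trans eMw'; exact: bop_opnorm_ball.
  rewrite mulrA ler_pdivrMr ?ltr_wpDl// mulrC ler_pM2l// lerDl ler01//.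
rewrite (le_trans (ler_normD _ _))//.
have := ler_normD (- (P - eta w x *: u)) (P - P').
have := ler_normB (P' - eta w' x *: u') (eta w' x *: (u - u')).
rewrite normrN; move: a1 a2 a3 a4.
move: `|P - _| `|P' - _| `|P - P'| `|_ *: (u - u')| `|_ + (P - P')| `|_ - _ *: (u - u')|.
move=> p q r s y z; lra.
Unshelve. all: by end_near. Qed.

End continuity_of_limits.

(** * Measurability of cocycles and of their norms *)

Section more_measurability.
Context {d : measure_display} {R : realType} {Omega : topMeasurableType d}.
Variable D : set Omega.
Hypothesis mD : measurable D.

Lemma borel_measurable_on_comp_in (T S : topologicalType) (f : Omega -> T)
    (g : T -> S) (O : set T) :
  open O -> (forall w, D w -> O (f w)) -> (forall x, O x -> {for x, continuous g}) ->
  borel_measurable_on D f -> borel_measurable_on D (g \o f).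
Proof.
move=> oO fO cg mf; apply: borel_measurable_onP => // U oU.
have oV : open (O `&` g @^-1` U).
  rewrite openE => x [Ox Ux]; apply: filterI; first exact: open_nbhs_nbhs.
  by apply: (cg x Ox); exact: open_nbhs_nbhs.
rewrite (_ : _ `&` _ = D `&` f @^-1` (O `&` g @^-1` U)).
  exact: borel_measurable_on_open.
by apply/seteqP; split => w /= [Dw]; [split => //; split => //; exact: fO|case].
Qed.

Lemma measurable_fun_invr (f : Omega -> R) : (forall w, D w -> f w != 0) ->
  measurable_fun D f -> measurable_fun D (fun w => (f w)^-1).
Proof.
move=> f0 mf; apply: measurable_fun_borel => //.
apply: (@borel_measurable_on_comp_in _ _ f (@GRing.inv R) [set x | x != 0]) => //.
- by move=> x /= x0; exact: inv_continuous.
- exact: borel_measurable_fun.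
Qed.

Lemma borel_measurable_on_normalize (X : completeNormedModType R) (f : Omega -> X) :
  (forall w, D w -> f w != 0) ->
  borel_measurable_on D f -> borel_measurable_on D (fun w => normalize (f w)).
Proof.
move=> f0; apply: (@borel_measurable_on_comp_in _ _ f (@normalize R X) [set x | x != 0]) => //.
- rewrite (_ : [set x | _] = ~` [set 0]).
    apply: closed_openC; apply: accessible_closed_set1.
    exact: hausdorff_accessible (@norm_hausdorff _ X).
  by apply/seteqP; split => x /= /eqP.
- move=> x /= x0; apply: cvgZ => //; apply: cvgV; first by rewrite normr_eq0.
  exact: norm_continuous.
Qed.

Lemma borel_measurable_on_norm (X : normedModType R) (f : Omega -> X) :
  borel_measurable_on D f -> measurable_fun D (fun w => `|f w|).
Proof.
move=> mf; apply: measurable_fun_borel => //.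
by apply: borel_measurable_on_comp mf _ => //; exact: norm_continuous.
Qed.

Lemma separable_realType : separable R.
Proof.
exists (range (@ratr R)); last exact: dense_rat.
exact: sub_countable (card_image_le _ _) (countableP _).
Qed.

End more_measurability.

Section cocycle_measurability.
Context {d : measure_display} {R : realType} {Omega : topMeasurableType d}.
Variable mu : probability Omega R.
Context {X : normedModType R}.
Variables (sigma sigmaV : Omega -> Omega) (L : Omega -> bop X X).
Hypothesis erg : ergodic_invertible_mpt mu sigma sigmaV.

Lemma borel_measurable_on_precomp (T : topologicalType) (f : Omega -> T) (s : Omega -> Omega) :
  measurable_fun setT s -> borel_measurable_on setT f ->
  borel_measurable_on setT (f \o s).
Proof. by move=> ms mf B /mf mB; have := ms measurableT _ mB; rewrite !setTI. Qed.

Lemma borel_measurable_cocycle : strongly_measurable_rds L ->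
  forall n x, borel_measurable_on setT (fun w => cocycle sigma L n w x).
Proof.
move=> [sX mL] n x; have [_ [ms _] _ _] := erg.
elim: n => [|n ih] /=; first exact: borel_measurable_on_cst.
apply: borel_measurable_on_apply => // y.
apply: (@borel_measurable_on_precomp _ (fun w => L w y) (iter n sigma)).
  exact: measurable_iter.
exact: strongly_measurable_eval.
Qed.

Lemma cont_in_measurable (Q : set Omega) (f : Omega -> R) :
  (@measurable d Omega) = (@borel Omega) -> closed Q -> cont_in Q f ->
  measurable_fun Q f.
Proof.
move=> mB cQ cf; have mQ := closed_measurable_borel mB cQ.
apply: measurable_fun_borel => //; apply: borel_measurable_onP => // U oU.
pose V := [set w | Q w -> U (f w)].
have -> : Q `&` f @^-1` U = Q `&` V°.
  apply/seteqP; split => w /= [Qw]; last by move=> /interior_subset/(_ Qw).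
  by move=> Uw; split => //; apply: (cf w Qw U); exact: open_nbhs_nbhs.
by apply: measurableI => //; apply: open_measurable_borel => //; exact: open_interior.
Qed.

(** In the mu-continuous case, these scalar functions are continuous on compact sets whose union has
    full measure, which yields measurability without separability of [X]. *)
Lemma cocycle_norm_measurable (x : X) :
  strongly_measurable_rds L \/ mu_continuous_rds mu sigma sigmaV L ->
  exists Om, [/\ measurable Om, mu Om = 1%E &
    forall n, measurable_fun Om (fun w => `|cocycle sigma L n w x|)].
Proof.
move=> [sL|[bP mB [cs cV] cL]].
  exists setT; split => //; first exact: probability_setT.
  by move=> n; apply: borel_measurable_on_norm => //; exact: borel_measurable_cocycle.
have /choice[Q HQ] : forall n, exists K, [/\ compact K, K `<=` setT,
    forall j, cont_in K (L \o iter j sigma),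
    forall j, cont_in K (L \o iter j sigmaV) &
    (mu (~` K) <= mu (~` setT) + (n.+1%:R^-1)%:E)%E].
  move=> n; apply: (compact_continuity_set bP mB erg cs cV cL measurableT).
  by rewrite invr_gt0.
have cQ n : closed (Q n) by have [/(compact_closed_polish bP)] := HQ n.
have mQ n := closed_measurable_borel mB (cQ n).
have mU : measurable (\bigcup_n Q n) by exact: bigcupT_measurable.
exists (\bigcup_n Q n); split => //.
- apply/full_negligible => //; apply/eqP; rewrite eq_le measure_ge0 andbT.
  apply/lee_addgt0Pr => e e0; rewrite add0e.
  have [N _ /(_ N (leqnn _)) h] := near_infty_natSinv_lt (PosNum e0).
  apply: (@le_trans _ _ (mu (~` Q N))).
    apply: le_measure; rewrite ?inE; [exact: measurableC|exact: measurableC|].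
    by apply: subsetC => w Kw; exists N.
  have [_ _ _ _ /le_trans] := HQ N; apply.
  by rewrite setCT measure0 add0e lee_fin; exact: ltW.
- move=> n; apply/measurable_fun_bigcup => // i.
  apply: cont_in_measurable => //; have [_ _ QS _ _] := HQ i.
  have cc : cont_in (Q i) (cocycle sigma L n : Omega -> bop X X).
    elim: n => [|n ih]; first by move=> w _; exact: cvg_cst.
    exact: (cont_in_comp_op (@QS n) ih).
  have cx : cont_in (Q i) (fun w => cocycle sigma L n w x).
    by apply: cont_in_eval => // w _; exact: cvg_cst.
  by move=> w Qw; apply: cvg_norm; exact: cx.
Qed.

End cocycle_measurability.

(** * Measurability and mu-continuity of the splitting *)

Section regularity.
Context {d : measure_display} {R : realType} {Omega : topMeasurableType d}.
Variable mu : probability Omega R.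
Context {X : completeNormedModType R}.
Variables (sigma sigmaV : Omega -> Omega) (L : Omega -> bop X X) (C : set X).
Hypothesis erg : ergodic_invertible_mpt mu sigma sigmaV.
Hypothesis nC : nice_cone C.
Hypothesis LC : forall w, L w @` C `<=` C.
Variables (G : set Omega) (k : nat) (Delta : R).
Hypothesis mG : measurable G.
Hypothesis k0 : (0 < k)%N.
Hypothesis Delta0 : 0 < Delta.
Hypothesis GD : forall w, G w -> cone_bounded C (cocycle sigma L k w) Delta.
Variables (D K : R).
Hypothesis D1 : 1 <= D.
Hypothesis normalD : forall x y,
  cone_le C (- y) x -> cone_le C x y -> `|x| <= D * `|y|.
Hypothesis K0 : 0 < K.
Variable x0 : X.
Hypothesis Cx0 : C x0.
Variable Om : set Omega.
Hypothesis mOm : measurable Om.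
Hypothesis Om_visited : forall w, Om w -> visited sigma sigmaV G (R:=R) w.
Hypothesis sOm : sigma @^-1` Om = Om.

Let sigmaK : cancel sigma sigmaV. Proof. by case: erg => -[]. Qed.
Let sigmaVK : cancel sigmaV sigma. Proof. by case: erg => -[]. Qed.
Let ms : measurable_fun setT sigma. Proof. by case: erg => _ []. Qed.
Let mV : measurable_fun setT sigmaV. Proof. by case: erg => _ []. Qed.

Lemma invariantS w : Om w -> Om (sigma w).
Proof. by rewrite -{1}sOm. Qed.

Lemma invariantV w : Om w -> Om (sigmaV w).
Proof. by move=> Ow; rewrite -sOm /= sigmaVK. Qed.

Let OmS := invariantS.
Let OmV := invariantV.

Let v := vlim sigma sigmaV L x0.

Let Cv w : Om w -> C (v w).
Proof. exact: (dir_cone sigmaVK nC LC k0 Delta0 GD D1 normalD Cx0 Om_visited). Qed.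

Let v1 w : Om w -> `|v w| = 1.
Proof. exact: (dir_norm sigmaVK nC LC k0 Delta0 GD D1 normalD Cx0 Om_visited). Qed.

Variable eta : Omega -> bop X R.
Hypothesis etaP : forall w, Om w ->
  functional_spec sigma sigmaV L C D K x0 w (eta w).

Let ev w : Om w -> eta w (v w) = 1.
Proof. by move=> /etaP[]. Qed.

(** An element of the Grassmannian carries a proof, available only on [Om] from [eta w (v w) = 1];
    elsewhere the zero subspace is a default. *)
Definition line_gr w : grassmannian X :=
  match pselect (Om w) with
  | left Ow => Grassmannian (closed_complemented_line (ev Ow))
  | right _ => Grassmannian (@closed_complemented0 R X)
  end.

Definition ker_gr w : grassmannian X :=
  match pselect (Om w) with
  | left Ow => Grassmannian (closed_complemented_ker (ev Ow))
  | right _ => Grassmannian (@closed_complemented0 R X)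
  end.

Lemma line_grE w : Om w -> gr_set (line_gr w) = line (v w).
Proof. by move=> Ow; rewrite /line_gr; case: pselect. Qed.

Lemma ker_grE w : Om w -> gr_set (ker_gr w) = ker_op (eta w).
Proof. by move=> Ow; rewrite /ker_gr; case: pselect. Qed.

Lemma line_gr_dist a b : Om a -> Om b ->
  gr_dist (line_gr a) (line_gr b) <= `|v a - v b|.
Proof. by move=> Oa Ob; apply: gr_dist_line (line_grE Oa) (line_grE Ob) (v1 Oa) (v1 Ob). Qed.

Lemma ker_gr_dist a b : Om a -> Om b ->
  gr_dist (ker_gr a) (ker_gr b) <= 2 * `|eta a - eta b|.
Proof.
move=> Oa Ob; exact: gr_dist_ker (ker_grE Oa) (ker_grE Ob) (ev Oa) (ev Ob) (v1 Oa) (v1 Ob).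
Qed.

Lemma measurable_visits n : measurable_fun setT (visits sigma G n : Omega -> R).
Proof.
apply: measurable_sum => i; apply: measurableT_comp; first exact: measurable_indic.
exact: measurable_iter.
Qed.

Lemma measurable_superlevel (f : Omega -> R) c : measurable_fun setT f ->
  measurable [set w | c < f w].
Proof.
move=> mf; have -> : [set w | c < f w] = setT `&` f @^-1` `]c, +oo[.
  by rewrite setTI; apply/seteqP; split => w /=; rewrite in_itv/= andbT.
exact: mf.
Qed.

Lemma backward_visits_le m n w : (m <= n)%N ->
  visits sigma G m (iter m sigmaV w) <= visits sigma G n (iter n sigmaV w) :> R.
Proof.
move=> mn; rewrite -(subnK mn) visitsD iterD (iterVK sigmaVK) lerDr.
exact: visits_ge0.
Qed.

Section continuous_case.
Hypothesis Om1 : mu Om = 1%E.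
Hypothesis cL : mu_continuous_rds mu sigma sigmaV L.

(** Egorov's argument: for each integer threshold [B], the points that reach it by time [n] in both
    directions increase to [Om]; a time is chosen for each [B] at the cost of [e / 2^(B + 1)]. *)
Lemma uniform_visits (e : R) : 0 < e -> exists A, [/\ measurable A, A `<=` Om,
  forall B : R, exists n, forall w, A w ->
    B < visits sigma G n w /\ B < visits sigma G n (iter n sigmaV w) &
  (mu (~` A) <= e%:E)%E].
Proof.
move=> e0; pose F (B n : nat) := Om `&`
  ([set w | B%:R < visits sigma G n w :> R] `&`
   [set w | B%:R < visits sigma G n (iter n sigmaV w) :> R]).
have mF B n : measurable (F B n).
  apply: measurableI => //; apply: measurableI; apply: measurable_superlevel.
    exact: measurable_visits.
  by apply: (measurableT_comp (measurable_visits n)); exact: measurable_iter.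
have iF B m n : (m <= n)%N -> F B m `<=` F B n.
  move=> mn w [Ow [h1 h2]]; split => //; split.
    exact: lt_le_trans h1 (visits_le _ _ _ mn).
  exact: lt_le_trans h2 (backward_visits_le _ mn).
have UF B : \bigcup_n F B n = Om.
  apply/seteqP; split => w; first by move=> [n _ []].
  move=> Ow; have [f b] := Om_visited Ow.
  have [n1 h1] := f B%:R; have [n2 h2] := b B%:R.
  exists (maxn n1 n2) => //; split => //; split.
    exact: lt_le_trans h1 (visits_le _ _ _ (leq_maxl _ _)).
  exact: lt_le_trans h2 (backward_visits_le _ (leq_maxr _ _)).
have /choice[N HN] : forall B, exists n, (mu (~` F B n) <= (e / (2 ^ B.+1)%:R)%:E)%E.
  move=> B; have eB : 0 < e / (2 ^ B.+1)%:R by rewrite divr_gt0// ltr0n expn_gt0.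
  by apply: (increasing_full_small eB (mF B) (iF B)); rewrite UF.
exists (\bigcap_B F B (N B)); split.
- exact: bigcapT_measurable.
- by move=> w /(_ 0%N I)[].
- move=> B; pose b := Num.bound `|B|; exists (N b) => w /(_ b I)[_ [h1 h2]].
  have Bb : B <= b%:R.
    by rewrite (le_trans (ler_norm B))// ltW// archi_boundP.
  by split; [exact: le_lt_trans Bb h1|exact: le_lt_trans Bb h2].
- rewrite setC_bigcap; apply: measure_bigcup_small => // [|n]; first exact: ltW.
  exact: measurableC.
Qed.

Let good_compact (e : R) : 0 < e -> exists Q, [/\ compact Q, Q `<=` Om,
  cont_in Q v, cont_in Q eta & (mu (~` Q) <= e%:E)%E].
Proof.
have [bP mB [cs cV] ctL] := cL.
move=> e0; have e2 : 0 < e / 2 by rewrite divr_gt0.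
have [A [mA AOm Avis hA]] := uniform_visits e2.
have [Q [cQ QA QS QV hQ]] := compact_continuity_set bP mB erg cs cV ctL mA e2.
have QOm := subset_trans QA AOm.
have Qvis (B : R) : exists n, forall w, Q w ->
    B < visits sigma G n w /\ B < visits sigma G n (iter n sigmaV w).
  by have [n Hn] := Avis B; exists n => w /QA; exact: Hn.
exists Q; split => //.
- exact: (@cont_in_dir d R Omega X sigma sigmaV L C sigmaVK nC LC G k Delta k0 Delta0 GD
    D D1 normalD x0 Cx0 Om Om_visited Q QOm QV Qvis).
- exact: (cont_in_functional sigmaVK nC LC k0 Delta0 GD D1 normalD K0 Cx0 Om_visited
    QOm QS QV Qvis etaP).
- by rewrite (le_trans hQ)// [in leRHS](splitr e) EFinD leeD.
Qed.

(** Every mu-continuity statement reduces to deducing continuity on a set from that of [v] and [eta]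
    there. *)
Let mu_continuous_intro (T : topologicalType) (f : Omega -> T) :
  (forall Q, Q `<=` Om -> cont_in Q v -> cont_in Q eta -> cont_in Q f) ->
  mu_continuous_on mu Om f.
Proof.
have [bP mB _ _] := cL; move=> H; apply: mu_continuous_of_small => // e e0.
have [Q [cQ QOm cv ce hQ]] := good_compact e0.
by exists Q; split => //; exact: H.
Qed.

Lemma mu_continuous_dir : mu_continuous_on mu Om v.
Proof. exact: mu_continuous_intro. Qed.

Lemma mu_continuous_functional : mu_continuous_on mu Om eta.
Proof. exact: mu_continuous_intro. Qed.

Lemma mu_continuous_proj : mu_continuous_on mu Om (fun w => rank1 (eta w) (v w)).
Proof. by apply: mu_continuous_intro => Q _ cv ce; exact: cont_in_rank1. Qed.

Lemma mu_continuous_coproj :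
  mu_continuous_on mu Om (fun w => idop - rank1 (eta w) (v w) : bop X X).
Proof.
apply: mu_continuous_intro => Q _ cv ce w Qw; apply: cvgB; first exact: cvg_cst.
exact: (cont_in_rank1 ce cv).
Qed.

Lemma gr_cont_in (Y : normedModType R) (Q : set Omega) (f : Omega -> Y)
    (E : Omega -> grassmannian X) (c : R) : 0 < c ->
  (forall a b, Q a -> Q b -> gr_dist (E a) (E b) <= c * `|f a - f b|) ->
  cont_in Q f -> cont_in Q E.
Proof.
move=> c0 fE cf w Qw U /nbhs_ballP[e /= e0 eU].
have := cf w Qw; move=> /cvgrPdist_lt/(_ _ (divr_gt0 e0 c0)) h.
have {}h : nbhs w [set x | Q x -> `|f w - f x| < e / c] := h.
change (nbhs w [set x | Q x -> U (E x)]).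
apply: filterS h => x h Qx; apply: eU; rewrite ballEmdist /=.
rewrite (le_lt_trans (fE _ _ Qw Qx))// mulrC -ltr_pdivlMr//.
exact: h.
Qed.

Lemma mu_continuous_line : mu_continuous_on mu Om line_gr.
Proof.
apply: mu_continuous_intro => Q QOm cv _.
apply: (@gr_cont_in _ Q v line_gr 1) => // a b /QOm Oa /QOm Ob.
by rewrite mul1r line_gr_dist.
Qed.

Lemma mu_continuous_ker : mu_continuous_on mu Om ker_gr.
Proof.
apply: mu_continuous_intro => Q QOm _ ce.
apply: (@gr_cont_in _ Q eta ker_gr 2) => // a b /QOm Oa /QOm Ob.
exact: ker_gr_dist.
Qed.

End continuous_case.

(** The approximation of [cocycle n w x], divided by the norm of [cocycle n w (v w)]. Taking norms
    loses the sign, but [eta] is positive on the cone. *)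
Lemma functional_limit w x : Om w ->
  (`|cocycle sigma L n w (v w)|^-1) * `|cocycle sigma L n w x| @[n --> \oo] --> `|eta w x|.
Proof.
move=> Ow; have [_ _ _ _ ap] := etaP Ow; have D0 : 0 <= D := le_trans ler01 D1.
apply/cvgrPdist_le => e e0.
have c0 : 0 <= 2 * D * K * (`|eta w| * `|x|) by rewrite !mulr_ge0// ltW.
have [t t0 te] := small_expR1 c0 e0.
have [n0 b0] := visited_forward nC LC k0 Delta0 GD (Om_visited Ow) t0.
exists n0 => // n /= n0n.
have bn : cone_bounded C (cocycle sigma L n w) t.
  move=> u z Cu Cz; rewrite -(subnK n0n) !cocycleD.
  by apply: prox_map; [move=> y; exact: cocycle_cone|exact: b0].
have Tv0 : 0 < `|cocycle sigma L n w (v w)|.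
  by rewrite normr_gt0; apply: (cone_neq0 nC); apply: cocycle_cone => //; exact: Cv.
set T := cocycle sigma L n w in bn Tv0 *.
have -> : `|eta w x| - `|T (v w)|^-1 * `|T x| =
    `|T (v w)|^-1 * (`|eta w x *: T (v w)| - `|T x|).
  by rewrite mulrBr normrZ mulrCA mulVf ?mulr1// gt_eqF.
rewrite normrM ger0_norm ?invr_ge0// ler_pdivrMl//.
rewrite (le_trans (ler_dist_dist _ _))// distrC (le_trans (ap t n x bn))//.
rewrite mulrC ler_pM2l//; apply: le_trans te.
by rewrite le_eqVlt -subr_eq0; apply/orP; left; apply/eqP; ring.
Qed.

Section strong_case.
Hypothesis sL : strongly_measurable_rds L.

Let sX : separable X. Proof. by case: sL. Qed.

Let mS (T : topologicalType) (f : Omega -> T) : borel_measurable_on setT f ->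
  borel_measurable_on Om f.
Proof. by move=> mf B /mf mB; rewrite setTI in mB; exact: measurableI. Qed.

Lemma borel_measurable_dir : borel_measurable_on Om v.
Proof.
apply: (@borel_measurable_on_lim _ _ _ Om mOm _ (vseq sigma sigmaV L x0)) => [n|w Ow].
  apply: borel_measurable_on_normalize => //.
    by move=> w _; apply: (cone_neq0 nC); exact: pulled_cone.
  apply: mS; apply: (@borel_measurable_on_precomp _ _ X
    (fun w => cocycle sigma L n w x0) (iter n sigmaV)); first exact: measurable_iter.
  exact: (borel_measurable_cocycle erg sL).
apply: (cvg_vseq sigmaVK nC LC D1 normalD Cx0).
exact: (visited_backward nC LC k0 Delta0 GD (Om_visited Ow)).
Qed.

Let mcoc n (x : X) : measurable_fun Om (fun w => `|cocycle sigma L n w x|).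
Proof.
by apply: borel_measurable_on_norm => //; apply: mS; exact: (borel_measurable_cocycle erg sL).
Qed.

Let mcocv n : measurable_fun Om (fun w => `|cocycle sigma L n w (v w)|).
Proof.
apply: borel_measurable_on_norm => //; apply: borel_measurable_on_apply => //.
  by move=> x; apply: mS; exact: (borel_measurable_cocycle erg sL).
exact: borel_measurable_dir.
Qed.

(** On a cone vector [eta] equals its absolute value, a limit of measurable quotients of norms; any
    [x] is a difference of two cone vectors. *)
Lemma measurable_functional x : measurable_fun Om (fun w => eta w x).
Proof.
have mC y : C y -> measurable_fun Om (fun w => eta w y).
  move=> Cy; apply: (measurable_fun_cvg (h := fun n w =>
    `|cocycle sigma L n w (v w)|^-1 * `|cocycle sigma L n w y|)) => [n|w Ow].
    apply: measurable_funM; last exact: mcoc.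
    apply: measurable_fun_invr => // w Ow.
    rewrite normr_eq0; apply: (cone_neq0 nC); apply: cocycle_cone => //; exact: Cv.
  have [_ e0 _ _ _] := etaP Ow; rewrite -[eta w y]ger0_norm ?ltW ?e0//.
  exact: functional_limit.
have [_ _ _ _ [_ /(_ x)[y [z [Cy Cz ->]]] _]] := nC.
rewrite (_ : (fun w => _) = (fun w => eta w y) \- (fun w => eta w z)).
  by apply: measurable_funB; exact: mC.
by apply/funext => w; rewrite linearB.
Qed.

Lemma strongly_measurable_functional : strongly_measurable_on Om eta.
Proof.
apply: strongly_measurable_of_eval => //; first exact: separable_realType.
by move=> x; apply: (borel_measurable_fun mOm (@measurable_functional _)).
Qed.

Let strongly_measurable_pair (g : X -> R -> X -> X) (A : Omega -> bop X X) :
  (forall w x, A w x = g x (eta w x) (v w)) ->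
  (forall x, continuous (fun p : R * X => g x p.1 p.2)) ->
  strongly_measurable_on Om A.
Proof.
move=> Ag cg; apply: strongly_measurable_of_eval => // x.
apply: (@borel_measurable_on_eq _ _ Om _ (fun w => g x (eta w x) (v w))) => //.
apply: (@borel_measurable_on2 _ _ _ Om mOm R X X (fun w => eta w x) v (g x)) => //.
- exact: separable_realType.
- move=> U y z oU Uyz.
  have : nbhs (y, z) ((fun p : R * X => g x p.1 p.2) @^-1` U).
    by apply: cg; exact: open_nbhs_nbhs.
  move=> /nbhs_ballP[e /= e0 eU]; exists e => // y' z' yy' zz'.
  by apply: (eU (y', z')); split; rewrite -ball_normE.
- by apply: (borel_measurable_fun mOm (@measurable_functional _)).
- exact: borel_measurable_dir.
Qed.

Let cvg_scale_pair (p : R * X) : q.1 *: q.2 @[q --> p] --> p.1 *: p.2.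
Proof. by apply: cvgZ; [exact: cvg_fst|exact: cvg_snd]. Qed.

Lemma strongly_measurable_proj :
  strongly_measurable_on Om (fun w => rank1 (eta w) (v w)).
Proof. by apply: (@strongly_measurable_pair (fun x a u => a *: u)). Qed.

Lemma strongly_measurable_coproj :
  strongly_measurable_on Om (fun w => idop - rank1 (eta w) (v w) : bop X X).
Proof.
apply: (@strongly_measurable_pair (fun x a u => x - a *: u)) => // x p.
by apply: cvgB; [exact: cvg_cst|exact: cvg_scale_pair].
Qed.

Lemma borel_measurable_line : borel_measurable_on Om line_gr.
Proof.
by apply: (gr_measurable_on mOm _ borel_measurable_dir); exact: line_gr_dist.
Qed.

End strong_case.

(** The norm of [L w (vseq n w)] is the quotient of two norms of images of the fixed vector [x0],
    taken at [sigma^-n w]; these are measurable in both settings. *)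
Lemma measurable_phi (Om0 : set Omega) : measurable Om0 -> Om `<=` Om0 ->
  (forall n, measurable_fun Om0 (fun w => `|cocycle sigma L n w x0|)) ->
  measurable_fun Om (fun w => `|L w (v w)|).
Proof.
move=> mOm0 OO0 mc.
have OmVn' n w : Om w -> Om (iter n sigmaV w) by move=> Ow; exact: OmVn.
have mp n m : measurable_fun Om (fun w => `|cocycle sigma L n (iter m sigmaV w) x0|).
  apply: (@measurable_comp _ _ _ _ _ _ Om0 (fun w => `|cocycle sigma L n w x0|) Om
    (iter m sigmaV)) => //.
    by move=> _ [w Ow <-]; apply: OO0; exact: OmVn'.
  by apply: measurable_funTS; exact: measurable_iter.
have pc n w : 0 < `|pulled sigma sigmaV L n w x0|.
  by rewrite normr_gt0; apply: (cone_neq0 nC); exact: pulled_cone.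
apply: (measurable_fun_cvg (h := fun n w =>
    `|cocycle sigma L n (iter n sigmaV w) x0|^-1 *
    `|cocycle sigma L n.+1 (iter n sigmaV w) x0|)) => [n|w Ow].
  apply: measurable_funM => //; apply: measurable_fun_invr => // w _.
  by have /lt0r_neq0 := pc n w.
rewrite (_ : (fun n => _) = (fun n => `|L w (vseq sigma sigmaV L x0 n w)|)); last first.
  apply/funext => n; rewrite /vseq /normalize linearZ/= normrZ.
  by rewrite ger0_norm ?invr_ge0//= (iterVK sigmaVK).
apply: cvg_norm; apply: (cvg_comp _ _ (cvg_vseq sigmaVK nC LC D1 normalD Cx0 _)).
  exact: (visited_backward nC LC k0 Delta0 GD (Om_visited Ow)).
exact: bop_continuous.
Qed.

End regularity.

(** * Growth rates *)

Section reversed_sums.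
Context {T : Type} {R : realType} (s sV : T -> T).
Hypothesis sK : cancel s sV.
Hypothesis sVK : cancel sV s.

(** The forward sum of [n] terms from the [n]-th past point stops just before [w], so the backward
    sum starts at [sV w]. *)
Lemma birkhoff_sum_reverse (f : T -> R) n w :
  birkhoff_sum s f n (iter n sV w) = birkhoff_sum sV f n (sV w).
Proof.
elim: n => [|n ih]; first by rewrite !birkhoff_sum0.
rewrite birkhoff_sumS [in RHS]/birkhoff_sum big_ord_recr/= sVK ih addrC.
by rewrite -iterSr.
Qed.

Lemma birkhoff_sum_reverse_le (f : T -> R) m n w : (m <= n)%N ->
  birkhoff_sum s f m (iter n sV w) =
  birkhoff_sum sV f n (sV w) - birkhoff_sum sV f (n - m) (sV w).
Proof.
move=> mn; apply/eqP; rewrite eq_sym subr_eq; apply/eqP.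
rewrite -!birkhoff_sum_reverse -{1}(subnKC mn) birkhoff_sumD; congr (_ + birkhoff_sum _ _ _ _).
by rewrite -{1}(subnKC mn) iterD (iterVK sVK).
Qed.

End reversed_sums.

Lemma expR_sub1_le {R : realType} (t : R) : expR t - 1 <= t * expR t.
Proof.
have := expR_ge1Dx (- t); rewrite expRN => h.
have e0 := expR_gt0 t; have := ler_wpM2r (ltW e0) h.
by rewrite mulVf ?gt_eqF//; move: (expR t) => y; lra.
Qed.

Lemma opnorm_on_ub {R : realType} {X Y : normedModType R} (E : set X) (T : bop X Y) x :
  subspace_set E -> E x -> `|T x| <= opnorm_on E T * `|x|.
Proof.
move=> [E0 ES] Ex; have [->|x0] := eqVneq x 0; first by rewrite linear0 !normr0 mulr0.
have nx : 0 < `|x| by rewrite normr_gt0.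
rewrite -ler_pdivrMr//.
have -> : `|T x| / `|x| = `|T (`|x|^-1 *: x)|.
  by rewrite linearZ/= normrZ ger0_norm ?invr_ge0// mulrC.
apply: sup_upper_bound; last first.
  exists (`|x|^-1 *: x) => //; split; first by rewrite -[_ *: _]addr0; exact: ES.
  by rewrite /= normrZ ger0_norm ?invr_ge0// mulVf// gt_eqF.
split; first by exists `|T 0|, 0 => //; split; rewrite //= normr0.
by exists (opnorm T) => _ [y [_ y1] <-]; exact: bop_opnorm_ball.
Qed.

Lemma rank1_norm {R : realType} {X : normedModType R} (eta : bop X R) (v : X) :
  `|v| = 1 -> `|rank1 eta v| = `|eta|.
Proof.
move=> v1; congr sup; apply/seteqP; split => r [x xX <-]; exists x => //=;
  by rewrite normrZ v1 mulr1.
Qed.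

(** * Lyapunov exponents and temperedness *)

Section growth.
Context {R : realType} {Omega : Type} {X : completeNormedModType R}.
Variables (sigma sigmaV : Omega -> Omega) (L : Omega -> bop X X) (C : set X).
Hypothesis sigmaK : cancel sigma sigmaV.
Hypothesis sigmaVK : cancel sigmaV sigma.
Hypothesis nC : nice_cone C.
Hypothesis LC : forall w, L w @` C `<=` C.
Variables (G : set Omega) (k : nat) (Delta : R).
Hypothesis k0 : (0 < k)%N.
Hypothesis Delta0 : 0 < Delta.
Hypothesis GD : forall w, G w -> cone_bounded C (cocycle sigma L k w) Delta.
Variables (D K : R).
Hypothesis D1 : 1 <= D.
Hypothesis normalD : forall x y,
  cone_le C (- y) x -> cone_le C x y -> `|x| <= D * `|y|.
Hypothesis K0 : 0 < K.
Variable x0 : X.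
Hypothesis Cx0 : C x0.
Variable Om : set Omega.
Hypothesis Om_visited : forall w, Om w -> visited sigma sigmaV G (R:=R) w.
Hypothesis OmS : forall w, Om w -> Om (sigma w).
Hypothesis OmV : forall w, Om w -> Om (sigmaV w).

Local Notation visits := (visits sigma G).
Local Notation cocycle := (cocycle sigma L).
Let v := vlim sigma sigmaV L x0.
Let phi w := `|L w (v w)|.
Variable eta : Omega -> bop X R.
Hypothesis etaP : forall w, Om w ->
  functional_spec sigma sigmaV L C D K x0 w (eta w).

Let v1 w : Om w -> `|v w| = 1.
Proof. exact: (dir_norm sigmaVK nC LC k0 Delta0 GD D1 normalD Cx0 Om_visited). Qed.

Let Tv_gt0 n w : Om w -> 0 < `|cocycle n w (v w)|.
Proof.
exact: (cocycle_dir_gt0 sigmaK sigmaVK nC LC k0 Delta0 GD D1 normalD Cx0 Om_visited OmS).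
Qed.

Let eta1 w : Om w -> 1 <= `|eta w|.
Proof.
exact: (functional_norm_ge1 sigmaVK nC LC k0 Delta0 GD D1 normalD Cx0 Om_visited etaP).
Qed.

Let r : R := tanh (Delta / 4).

Let r01 : 0 < r < 1. Proof. by apply: tanh_itv; rewrite divr_gt0. Qed.

Let S n w : R := \sum_(i < n) ln (phi (iter i sigma w)).

Lemma ln_cocycle_dir n w : Om w -> ln `|cocycle n w (v w)| = S n w.
Proof.
move=> Ow.
have p0 i : 0 < phi (iter i sigma w).
  apply: (dir_phi_gt0 sigmaVK nC LC k0 Delta0 GD D1 normalD Cx0 Om_visited).
  exact: OmSn.
rewrite (cocycle_norm_dir sigmaK sigmaVK nC LC k0 Delta0 GD D1 normalD Cx0 Om_visited OmS _ Ow).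
rewrite /S; elim: n => [|n ih]; first by rewrite !big_ord0 ln1.
have pn : 0 < \prod_(i < n) phi (iter i sigma w) by apply: prodr_gt0 => i _; exact: p0.
have pp := p0 n; by rewrite !big_ord_recr/= lnM ?posrE ?ih.
Qed.

Lemma growth_dir w (l : \bar R) : Om w -> (n%:R^-1 * S n w)%:E @[n --> \oo] --> l ->
  (n%:R^-1%:E * lne `|cocycle n w (v w)|%:E)%E @[n --> \oo] --> l.
Proof.
move=> Ow; rewrite (_ : (fun n => _) = (fun n : nat => (n%:R^-1 * S n w)%:E))//.
by apply/funext => n; rewrite lne_EFin ?Tv_gt0// ln_cocycle_dir// EFinM.
Qed.

Lemma cvg_average_shift (s : nat -> R) (c : R) (l : \bar R) :
  (n%:R^-1 * s n)%:E @[n --> \oo] --> l -> (n%:R^-1 * (c + s n))%:E @[n --> \oo] --> l.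
Proof.
move=> sl; under eq_fun do rewrite mulrDr EFinD.
rewrite -[l]add0e; apply: cvgeD => //.
by apply: cvg_EFin; [exact: nearW|exact: (cvg_average_cst c)].
Qed.

Lemma growth_norm w (l : \bar R) : Om w -> (n%:R^-1 * S n w)%:E @[n --> \oo] --> l ->
  (n%:R^-1%:E * lne `|cocycle n w|%:E)%E @[n --> \oo] --> l.
Proof.
move=> Ow Sl.
have [c c0 Hc] := cocycle_norm_le sigmaVK nC LC k0 Delta0 GD D1 normalD K0 Cx0 Om_visited etaP Ow.
apply: (squeeze_cvge _ Sl (cvg_average_shift (ln c) Sl)).
apply: filterS Hc => n Hc.
have a0 := Tv_gt0 n Ow.
have ab := cocycle_norm_ge sigmaVK nC LC k0 Delta0 GD D1 normalD Cx0 Om_visited n Ow.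
have b0 := lt_le_trans a0 ab.
rewrite lne_EFin// -EFinM !lee_fin -ln_cocycle_dir//.
apply/andP; split; rewrite ler_wpM2l// ?invr_ge0//.
  by rewrite ler_ln ?posrE.
by rewrite -lnM ?posrE// ler_ln ?posrE// mulr_gt0.
Qed.

(** [e^t - 1 <= t e^t] keeps the decaying factor [t], while the exponential is bounded because
    [t <= Delta r ^ (- 2)]. *)
Lemma cocycle_ker_expR w : Om w ->
  exists c, \forall n \near \oo, opnorm_on (ker_op (eta w)) (cocycle n w) <=
    expR (c + visits n w * (ln r / k%:R) + S n w).
Proof.
move=> Ow; have [r0 r1] := andP r01.
have D0 : 0 < D := lt_le_trans ltr01 D1.
have e0 : 0 < `|eta w| := lt_le_trans ltr01 (eta1 Ow).
have A0 : 0 < 2 * D * K * `|eta w| by rewrite !mulr_gt0.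
(* [- 2 ln r] comes from the exponent [visits / k - 2], and the last term is the bound of [t] in
   [e^t]. *)
exists (ln (2 * D * K * `|eta w|) + ln Delta - 2 * ln r + Delta * r `^ (- 2)).
have [n0 kv] : exists n0, k%:R < visits n0 w :> R by have [vw _] := Om_visited Ow; exact: vw.
exists n0 => // n /= n0n.
have {}kv : k%:R < visits n w :> R := lt_le_trans kv (visits_le _ _ _ n0n).
have := cocycle_ker_le nC LC k0 Delta0 GD D1 K0 etaP Ow kv.
move=> /le_trans; apply; rewrite -/r /powR gt_eqF//.
set a := visits n w / k%:R - 2; set t := Delta * expR (a * ln r).
have lr : ln r < 0 by rewrite ln_lt0// r01.
have a2 : -2 <= a by rewrite /a lerDr divr_ge0// visits_ge0.
have tT : t <= Delta * expR (- 2 * ln r).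
  by rewrite ler_pM2l// ler_expR ler_nM2r.
have -> : `|cocycle n w (v w)| = expR (S n w) by rewrite -ln_cocycle_dir// lnK ?posrE ?Tv_gt0.
rewrite -/(v w) expRD ler_pM2r ?expR_gt0//.
rewrite mulrAC (mulrC _ (_ - 1)) mulrC.
have -> : 2 * D * K * `|eta w| = expR (ln (2 * D * K * `|eta w|)) by rewrite lnK ?posrE.
apply: (@le_trans _ _ (expR (ln (2 * D * K * `|eta w|)) * (t * expR (Delta * expR (-2 * ln r))))).
  rewrite ler_pM2l ?expR_gt0// (le_trans (expR_sub1_le t))//.
  by rewrite ler_pM2l ?ler_expR// /t mulr_gt0// expR_gt0.
rewrite /t -{1}[Delta]lnK ?posrE// -!expRD ler_expR /a.
move: (ln (2 * _ * _ * _)) (expR _) => x y; rewrite expRK.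
by rewrite le_eqVlt -subr_eq0; apply/orP; left; apply/eqP; ring.
Qed.

Let kernel_rate (s : nat -> R) (V : nat -> R) (c p : R) (l : \bar R) :
  n%:R^-1 * V n @[n --> \oo] --> p -> (n%:R^-1 * s n)%:E @[n --> \oo] --> l ->
  (n%:R^-1 * (c + V n * (ln r / k%:R) + s n))%:E @[n --> \oo] -->
    ((p * (ln r / k%:R))%:E + l)%E.
Proof.
move=> Vp sl; under eq_fun do rewrite -addrA.
apply: cvg_average_shift; under eq_fun do rewrite mulrDr EFinD.
apply: cvgeD => //; apply: cvg_EFin; first exact: nearW.
rewrite (_ : fine \o _ = (fun n : nat => n%:R^-1 * V n * (ln r / k%:R))).
  by apply: cvgM; [exact: Vp|exact: cvg_cst].
by apply/funext => n /=; rewrite -mulrA.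
Qed.

Let rateE p : - (p / k%:R * ln r^-1) = p * (ln r / k%:R).
Proof.
have [r0 _] := andP r01.
rewrite lnV ?posrE// mulrN opprK; field.
by rewrite pnatr_eq0 -lt0n.
Qed.

(** The sum [S n w] cancels before the limit is taken, which covers the case where its averages tend
    to [-oo]. *)
Lemma limsup_cocycle_ker w (p : R) : Om w -> 
  n%:R^-1 * visits n w @[n --> \oo] --> p ->
  (limn_esup (fun n : nat =>
     n%:R^-1%:E * lne (opnorm_on (ker_op (eta w)) (cocycle n w))%:E
       - (n%:R^-1 * S n w)%:E) <= (- (p / k%:R * ln r^-1))%:E)%E.
Proof.
move=> Ow Vp; have [c Hc] := cocycle_ker_expR Ow.
apply: (limn_esup_lne Hc); rewrite rateE.
under eq_fun do rewrite addrK.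
have z0 : (n%:R^-1 * (0 : R))%:E @[n --> \oo] --> 0%E.
  by under eq_fun do rewrite mulr0; exact: cvg_cst.
have := kernel_rate c Vp z0; rewrite adde0.
by under eq_fun do rewrite addr0.
Qed.

Lemma lyapunov_line w (l : \bar R) x : Om w ->
  (n%:R^-1 * S n w)%:E @[n --> \oo] --> l ->
  line (v w) x -> x != 0 -> lyapunov sigma L w x = l.
Proof.
move=> Ow Sl [a _ <-] ax0; apply: limn_esup_cvg.
have a0 : 0 < `|a| by rewrite normr_gt0; apply: contraNneq ax0 => ->; rewrite scale0r.
rewrite (_ : (fun n => _) = (fun n : nat => (n%:R^-1 * (ln `|a| + S n w))%:E)).
  exact: cvg_average_shift.
apply/funext => n; rewrite linearZ_LR normrZ lne_EFin ?mulr_gt0 ?Tv_gt0//.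
by rewrite lnM ?posrE ?Tv_gt0// ln_cocycle_dir// EFinM.
Qed.

Lemma lyapunov_ker w (p l : R) x : Om w -> 0 < p ->
  n%:R^-1 * visits n w @[n --> \oo] --> p ->
  (n%:R^-1 * S n w)%:E @[n --> \oo] --> l%:E ->
  ker_op (eta w) x -> (lyapunov sigma L w x < l%:E)%E.
Proof.
move=> Ow p0 Vp Sl ex; have [c Hc] := cocycle_ker_expR Ow.
have [r0 _] := andP r01.
(* [|x| + 1] replaces [|x|] to have a positive number under the logarithm also for [x = 0]. *)
have x1 : 0 < `|x| + 1 by rewrite ltr_wpDl.
apply: (@le_lt_trans _ _ ((p * (ln r / k%:R))%:E + l%:E)%E); last first.
  rewrite -EFinD lte_fin gtrDr pmulr_rlt0// pmulr_llt0 ?invr_gt0 ?ltr0n//.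
  by rewrite ln_lt0.
apply: limn_esup_le (kernel_rate (ln (`|x| + 1) + c) Vp Sl).
apply: filterS Hc => n Hc; rewrite EFinM lee_wpmul2l ?lee_fin ?invr_ge0//.
apply: lne_le_expR; rewrite -!addrA expRD lnK ?posrE// mulrC addrA.
apply: le_trans (opnorm_on_ub _ (subspace_ker (eta w)) ex) _.
rewrite (le_trans (ler_wpM2r (normr_ge0 x) Hc))//.
by rewrite ler_pM2l ?expR_gt0// lerDl.
Qed.

(** The operator is idempotent, so its norm is 0, where [ln] is 0 by convention, or at least 1. *)
Lemma ln_norm_coproj w : Om w ->
  0 <= ln `|idop - rank1 (eta w) (v w) : bop X X| <= ln 2 + ln `|eta w|.
Proof.
move=> Ow; have e1 := eta1 Ow; set P : bop X X := _ - _.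
have PP x : P (P x) = P x.
  rewrite [LHS](_ : _ = P x - eta w (P x) *: v w)//.
  have [_ _ ev _ _] := etaP Ow; have PE y : P y = y - eta w y *: v w by [].
  have -> : eta w (P x) = 0.
    have -> : eta w (P x) = eta w x - eta w x * eta w (v w) by rewrite PE linearB linearZ_LR.
    by rewrite [eta w (v w)]ev mulr1 subrr.
  by rewrite scale0r subr0.
have [P0|Pn0] := eqVneq `|P| 0.
  by rewrite P0 ln0// lexx addr_ge0// ln_ge0// ler1n.
have P0 : 0 < `|P| by rewrite lt_def Pn0 normr_ge0.
have P1 : 1 <= `|P|.
  rewrite -(ler_pM2l P0) mulr1; apply: opnorm_le => x x1.
  rewrite -PP (le_trans (bop_opnorm_ub P _))// ler_wpM2l//.
    exact: bop_opnorm_ge0.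
  exact: bop_opnorm_ball.
rewrite ln_ge0//= -lnM ?posrE ?(lt_le_trans ltr01 e1)// ler_ln ?posrE//; last first.
  by rewrite mulr_gt0// (lt_le_trans ltr01 e1).
apply: opnorm_le => x x1.
rewrite -[P x]/(x - eta w x *: v w) (le_trans (ler_normB _ _))//.
rewrite normrZ v1// mulr1 mulr_natl mulr2n lerD ?(le_trans x1 e1)//.
exact: bop_opnorm_ball.
Qed.

Variable g : Omega -> R.
Hypothesis gL : forall w, ln `|L w| <= g w.
Let h w := g w - ln (phi w).

Lemma ln_cocycle_le n w : Om w -> ln `|cocycle n w| <= birkhoff_sum sigma g n w.
Proof.
move=> Ow.
have c0 m : 0 < `|cocycle m w|.
  apply: lt_le_trans (Tv_gt0 m Ow) _.
  exact: (cocycle_norm_ge sigmaVK nC LC k0 Delta0 GD D1 normalD Cx0 Om_visited).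
have i1 : `|idop : bop X X| <= 1 by apply: opnorm_le.
elim: n => [|n ih]; first by rewrite birkhoff_sum0 /=; apply: ln_le0.
have cS : `|cocycle n.+1 w| <= `|L (iter n sigma w)| * `|cocycle n w|.
  apply: opnorm_le => x x1 /=; rewrite (le_trans (bop_opnorm_ub _ _))//.
  by apply: ler_wpM2l; [exact: bop_opnorm_ge0|exact: bop_opnorm_ball].
have L0 : 0 < `|L (iter n sigma w)|.
  have := lt_le_trans (c0 n.+1) cS; rewrite pmulr_lgt0//.
rewrite /birkhoff_sum big_ord_recr/=.
apply: (@le_trans _ _ (ln (`|L (iter n sigma w)| * `|cocycle n w|))).
  by rewrite ler_ln// posrE; [exact: (c0 n.+1)|exact: mulr_gt0].
by rewrite lnM ?posrE// addrC lerD.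
Qed.

Lemma functional_ln_le : exists c, forall m w, Om w -> k%:R < visits m w :> R ->
  ln `|eta w| <= c + birkhoff_sum sigma h m w.
Proof.
have [c Hc] := functional_log_bound sigmaK sigmaVK nC LC k0 Delta0 GD D1 normalD K0 Cx0
  Om_visited OmS etaP.
exists c => m w Ow /(Hc _ _ Ow) /le_trans; apply.
rewrite lerD2l ln_cocycle_dir//.
have -> : birkhoff_sum sigma h m w = birkhoff_sum sigma g m w - S m w.
  by rewrite /S -sumrB.
by rewrite lerB// ln_cocycle_le.
Qed.

Lemma functional_sublinear w (p H : R) : Om w -> 0 < p ->
  n%:R^-1 * visits n w @[n --> \oo] --> p ->
  n%:R^-1 * birkhoff_sum sigma h n w @[n --> \oo] --> H ->
  n%:R^-1 * ln `|eta (iter n sigma w)| @[n --> \oo] --> (0 : R).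
Proof.
move=> Ow p0 Vp hH; have [c Hc] := functional_ln_le.
have OS n := OmSn OmS n Ow.
apply: (@sublinear_of_increments R _
  (fun n m => visits (n + m) w - visits n w)
  (fun n m => birkhoff_sum sigma h (n + m) w - birkhoff_sum sigma h n w) c k%:R p H p0).
- by move=> n; rewrite ln_ge0// eta1.
- move=> n m _.
  have -> : visits (n + m) w - visits n w = visits m (iter n sigma w) :> R.
    by rewrite visitsD addrAC subrr add0r.
  rewrite birkhoff_sumD [X in c + X](addrAC) subrr add0r; exact: Hc.
- move=> e e0; near=> n => m mn; split.
    by have [] : _ /\ _ := (near (average_increment Vp e0) n _) m mn.
  by have [] : _ /\ _ := (near (average_increment hH e0) n _) m mn.
Unshelve. all: by end_near. Qed.

(** A forward sum of length [m] from [sigma^-n w] is the increment between [n - m] and [n] of the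
    backward sums from [sigmaV w], which are the ones known to have averages. *)
Lemma functional_sublinearV w (p H : R) : Om w -> 0 < p ->
  n%:R^-1 * birkhoff_sum sigmaV \1_G n (sigmaV w) @[n --> \oo] --> p ->
  n%:R^-1 * birkhoff_sum sigmaV h n (sigmaV w) @[n --> \oo] --> H ->
  n%:R^-1 * ln `|eta (iter n sigmaV w)| @[n --> \oo] --> (0 : R).
Proof.
move=> Ow p0 Vp hH; have [c Hc] := functional_ln_le.
have OS n := OmVn OmV n Ow.
apply: (@sublinear_of_increments R _
  (fun n m => birkhoff_sum sigmaV \1_G n (sigmaV w) - birkhoff_sum sigmaV \1_G (n - m) (sigmaV w))
  (fun n m => birkhoff_sum sigmaV h n (sigmaV w) - birkhoff_sum sigmaV h (n - m) (sigmaV w))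
  c k%:R p H p0).
- by move=> n; rewrite ln_ge0// eta1.
- move=> n m mn; rewrite -!(birkhoff_sum_reverse_le sigmaVK)//; exact: Hc.
- move=> e e0; near=> n => m mn; split.
    by have [] : _ /\ _ := (near (average_increment Vp e0) n _) m mn.
  by have [] : _ /\ _ := (near (average_increment hH e0) n _) m mn.
Unshelve. all: by end_near. Qed.

End growth.

Lemma average_unbounded {R : realType} (U : nat -> R) (p : R) : 0 < p ->
  n%:R^-1 * U n @[n --> \oo] --> p -> forall B, exists n, B < U n.
Proof.
move=> p0 Up B; have p2 : 0 < p / 2 by rewrite divr_gt0.
move/cvgrPdist_le : Up => /(_ _ p2) Up.
suff : \forall n \near \oo, B < U n by move=> [n _ /(_ n (leqnn n))]; exists n.
near=> n.
have n0 : 0 < n%:R :> R by rewrite ltr0n; near: n; exact: nbhs_infty_gt.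
have Bn : B + 1 <= p / 2 * n%:R by near: n; exact: near_lin_bound.
have : `|p - n%:R^-1 * U n| <= p / 2 by near: n.
rewrite ler_norml => /andP[_ h].
have : p / 2 * n%:R <= U n by rewrite mulrC -ler_pdivlMl//; lra.
lra.
Unshelve. all: by end_near. Qed.

(** * Two-sided averages and the integral of log phi *)

Section averages_full.
Context {d : measure_display} {R : realType} {Omega : topMeasurableType d}.
Variable mu : probability Omega R.
Variables sigma sigmaV : Omega -> Omega.
Hypothesis erg : ergodic_invertible_mpt mu sigma sigmaV.

Let sigmaK : cancel sigma sigmaV. Proof. by case: erg => -[]. Qed.
Let sigmaVK : cancel sigmaV sigma. Proof. by case: erg => -[]. Qed.

Lemma invariant_full_setI A B : invariant_full mu sigma A -> invariant_full mu sigma B ->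
  invariant_full mu sigma (A `&` B).
Proof.
move=> [mA A1 sA] [mB B1 sB]; split; first exact: measurableI.
  exact: full_setI.
by rewrite preimage_setI sA sB.
Qed.

Lemma birkhoff_two_sided (f : Omega -> R) : mu.-integrable setT (EFin \o f) ->
  exists2 D, invariant_full mu sigma D & forall w, D w ->
    n%:R^-1 * birkhoff_sum sigma f n w @[n --> \oo] --> fine (\int[mu]_x (f x)%:E) /\
    n%:R^-1 * birkhoff_sum sigmaV f n w @[n --> \oo] --> fine (\int[mu]_x (f x)%:E).
Proof.
move=> intf.
have [_ [ms mV] inv er] := erg.
have [_ _ invV erV] := ergodic_invertible_mptV erg.
apply: (ae_invariant_full erg).
by apply: filterS2 (birkhoff_integrable ms inv er intf) (birkhoff_integrable mV invV erV intf).
Qed.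

Lemma visits_average (G : set Omega) : measurable G -> exists2 D, invariant_full mu sigma D &
  forall w, D w -> n%:R^-1 * visits sigma G n w @[n --> \oo] --> fine (mu G) /\
    n%:R^-1 * birkhoff_sum sigmaV \1_G n w @[n --> \oo] --> fine (mu G).
Proof.
move=> mG; have intG : mu.-integrable setT (EFin \o (\1_G : Omega -> R)).
  exact: integrable_indic.
have [D iD HD] := birkhoff_two_sided intG; exists D => // w /HD.
by rewrite integral_indic// setIT.
Qed.

Lemma average_visited (G D : set Omega) : sigma @^-1` D = D -> (0 < fine (mu G))%R ->
  (forall w, D w -> n%:R^-1 * visits sigma G n w @[n --> \oo] --> fine (mu G) /\
    n%:R^-1 * birkhoff_sum sigmaV \1_G n w @[n --> \oo] --> fine (mu G)) ->
  forall w, D w -> visited sigma sigmaV G (R:=R) w.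
Proof.
move=> sD p0 H w Dw; split.
  by have [h _] := H _ Dw; exact: average_unbounded h.
have DVw : D (sigmaV w) by rewrite -sD /= sigmaVK.
have [_ /(average_unbounded p0) h] := H _ DVw.
by move=> B; have [n hn] := h B; exists n; rewrite /visits (birkhoff_sum_reverse sigmaVK).
Qed.

Section growth_rate.
Variables (O1 : set Omega) (phi g : Omega -> R).
Hypothesis iO1 : invariant_full mu sigma O1.
Hypothesis mphi : measurable_fun O1 phi.
Hypothesis intg : mu.-integrable setT (EFin \o g).
Hypothesis g0 : forall w, 0 <= g w.
Hypothesis phig : forall w, O1 w -> ln (phi w) <= g w.

Let mO1 : measurable O1. Proof. by case: iO1. Qed.

(** Extension by 0 outside [O1]: the ergodic theorem speaks of functions on the whole space, whereas
    [phi] is known to be measurable on [O1] only. *)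
Let f : Omega -> R := (@ln R \o phi) \_ O1.

Let fE w : O1 w -> f w = ln (phi w).
Proof. by move=> Ow; rewrite /f patchE mem_set. Qed.

Let fg w : f w <= g w.
Proof.
have [Ow|nOw] := pselect (O1 w); first by rewrite fE// phig.
by rewrite /f patchE memNset.
Qed.

Let mlnphi : measurable_fun O1 (@ln R \o phi).
Proof. exact: measurableT_comp. Qed.

Let mf : measurable_fun setT f.
Proof. exact/(measurable_restrictT _ mO1). Qed.

Let intfp : mu.-integrable setT (EFin \o (fun x => Num.max 0 (f x))).
Proof.
apply: (le_integrable measurableT _ _ intg).
  by apply/measurable_EFinP; exact: measurable_maxr.
move=> w _ /=; rewrite lee_fin ger0_norm ?le_max ?lexx// ger0_norm//.
by rewrite ge_max g0 fg.
Qed.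

Lemma integrable_log_plus (D : set Omega) : measurable D -> D `<=` O1 ->
  mu.-integrable D (EFin \o log_plus \o phi).
Proof.
move=> mD DO; have iD : mu.-integrable D (EFin \o (fun x => Num.max 0 (f x))).
  exact: integrableS intfp.
by apply: eq_integrable iD => // w; rewrite inE => /DO Ow /=; rewrite /log_plus fE.
Qed.

Let lambda : \bar R := (\int[mu]_w (f w)%:E)%E.

Let iter_O1 n w : O1 w -> O1 (iter n sigma w) /\ O1 (iter n sigmaV w).
Proof. by have [_ _ sO] := iO1; exact: (invariant_full_iter erg). Qed.

Lemma integral_ln_full (D : set Omega) : invariant_full mu sigma D -> D `<=` O1 ->
  (\int[mu]_(w in D) (ln (phi w))%:E = lambda)%E.
Proof.
move=> [mD D1 _] DO; rewrite integral_mkcond; apply: ae_eq_integral => //.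
- apply/(measurable_restrictT _ mD)/measurable_EFinP.
  exact: measurable_funS mlnphi.
- exact/measurable_EFinP.
- exists (~` D); split; [exact: measurableC|exact/full_negligible|].
  move=> w /= Hw Dw; apply: Hw => _.
  by rewrite patchE mem_set// fE//; exact: DO.
Qed.

Lemma growth_rate : exists (D : set Omega) (l : \bar R), [/\
  invariant_full mu sigma D, D `<=` O1, (l < +oo)%E,
  l = (\int[mu]_(w in D) (ln (phi w))%:E)%E &
  (forall w, D w -> (n%:R^-1 * \sum_(i < n) ln (phi (iter i sigma w)))%:E @[n --> \oo] --> l) /\
  ((-oo < l)%E -> exists H : R, forall w, D w ->
    n%:R^-1 * birkhoff_sum sigma (fun w => g w - ln (phi w)) n w @[n --> \oo] --> H /\
    n%:R^-1 * birkhoff_sum sigmaV (fun w => g w - ln (phi w)) n w @[n --> \oo] --> H)].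
Proof.
have [_ [ms mV] inv er] := erg.
have [D0 iD0 HD0] := ae_invariant_full erg (birkhoff_quasi_integrable ms inv er mf intfp).
have [D2 iD2 HD2] : exists2 D2, invariant_full mu sigma D2 & (-oo < lambda)%E ->
    exists H : R, forall w, D2 w ->
    n%:R^-1 * birkhoff_sum sigma (fun w => g w - f w) n w @[n --> \oo] --> H /\
    n%:R^-1 * birkhoff_sum sigmaV (fun w => g w - f w) n w @[n --> \oo] --> H.
  (* For [lambda = -oo] nothing is asked of [D2], and [O1] is a default. Otherwise [f], hence
     [g - f], is integrable and has averages in both directions. *)
  have [lNy|] := boolP (-oo < lambda)%E; last by exists O1.
  have intf := quasi_integrable mf intfp lNy.
  have inth : mu.-integrable setT (EFin \o (fun w => g w - f w)).
    by have := integrableB measurableT intg intf; apply: eq_integrable.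
  have [D2 iD2 HD2] := birkhoff_two_sided inth; exists D2 => // _.
  by eexists; exact: HD2.
pose D := O1 `&` (D0 `&` D2); exists D, lambda.
have iD : invariant_full mu sigma D by do 2 apply: invariant_full_setI => //.
have DO : D `<=` O1 by move=> w [].
split => //; first exact: (quasi_integral_lty intfp).
  by rewrite integral_ln_full.
split=> [w [Ow [D0w _]]|/HD2[H HH]].
  have := HD0 w D0w; rewrite (_ : (fun n => _) =
    (fun n : nat => (n%:R^-1 * \sum_(i < n) ln (phi (iter i sigma w)))%:E))//.
  apply/funext => n; congr (_ * _)%:E; apply: eq_bigr => i _.
  by rewrite fE//; have [] := iter_O1 i Ow.
exists H => w [Ow [_ /HH[h1 h2]]]; split.
  move: h1; rewrite (_ : (fun n => _) = (fun n : nat => n%:R^-1 *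
    birkhoff_sum sigma (fun w => g w - ln (phi w)) n w))//.
  apply/funext => n; congr (_ * _); apply: eq_bigr => i _.
  by rewrite fE//; have [] := iter_O1 i Ow.
move: h2; rewrite (_ : (fun n => _) = (fun n : nat => n%:R^-1 *
  birkhoff_sum sigmaV (fun w => g w - ln (phi w)) n w))//.
apply/funext => n; congr (_ * _); apply: eq_bigr => i _.
by rewrite fE//; have [] := iter_O1 i Ow.
Qed.

End growth_rate.
End averages_full.

(** * The splitting on one invariant set of full measure *)

Theorem theorem2p17 (R : realType) (d : measure_display)
    (Omega : topMeasurableType d) (mu : probability Omega R)
    (sigma sigmaV : Omega -> Omega) (X : completeNormedModType R)
    (L : Omega -> bop X X) (C : set X)
    (GP : set Omega) (kP : nat) (DP : R) :
  ergodic_invertible_mpt mu sigma sigmaV ->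
  strongly_measurable_rds L \/ mu_continuous_rds mu sigma sigmaV L ->
  mu.-integrable setT (fun w => (log_plus `|L w|)%:E) ->
  nice_cone C ->
  (forall w, L w @` C `<=` C) ->
  measurable GP -> (0 < mu GP)%E ->
  (0 < kP)%N -> 0 < DP ->
  (forall w, GP w -> (cone_diam C (cocycle sigma L kP w @` C) <= DP%:E)%E) ->
  exists Omega' : set Omega, invariant_full mu sigma Omega' /\
  exists (v : Omega -> X) (phi : Omega -> R) (eta : Omega -> bop X R)
         (lambda1 : \bar R),
  let proj w : bop X X := rank1 (eta w) (v w) in
  let coproj w : bop X X := idop - proj w in
  (* (1) *)
  (equivariant_direction mu sigma L C Omega' v phi /\
   forall (v' : Omega -> X) (phi' : Omega -> R),
     equivariant_direction mu sigma L C Omega' v' phi' ->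
     forall w, Omega' w -> v' w = v w) /\
  (* (2) *)
  [/\ forall w, Omega' w -> forall x, C x -> 0 < eta w x,
      forall w, Omega' w ->
        forall x, eta (sigma w) (L w x) = phi w * eta w x,
      forall w, Omega' w -> eta w (v w) = 1,
      (forall w, Omega' w -> direct_sum (line (v w)) (ker_op (eta w))) /\
      equivariant sigma L Omega' (fun w => line (v w)) /\
      equivariant sigma L Omega' (fun w => ker_op (eta w)) &
      forall w, Omega' w ->
        [/\ comp_op (proj w) (proj w) = proj w,
            range (proj w) = line (v w) &
            ker_op (proj w) = ker_op (eta w)]] /\
  (* (3) *)
  (strongly_measurable_rds L ->
     [/\ borel_measurable_on Omega' v,
         strongly_measurable_on Omega' eta,
         strongly_measurable_on Omega' proj,
         strongly_measurable_on Omega' coproj &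
         exists2 E : Omega -> grassmannian X,
           forall w, Omega' w -> gr_set (E w) = line (v w) &
           borel_measurable_on Omega' E]) /\
  (mu_continuous_rds mu sigma sigmaV L ->
     [/\ mu_continuous_on mu Omega' v,
         mu_continuous_on mu Omega' eta,
         mu_continuous_on mu Omega' proj /\ mu_continuous_on mu Omega' coproj,
         exists2 E : Omega -> grassmannian X,
           forall w, Omega' w -> gr_set (E w) = line (v w) &
           mu_continuous_on mu Omega' E &
         exists2 F : Omega -> grassmannian X,
           forall w, Omega' w -> gr_set (F w) = ker_op (eta w) &
           mu_continuous_on mu Omega' F]) /\
  (* (4) *)
  [/\ (lambda1 < +oo)%E,
      forall w, Omega' w ->
        [/\ (n%:R^-1%:E * lne `|cocycle sigma L n w (v w)|%:E)%E @[n --> \oo]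
              --> lambda1,
            (n%:R^-1 * \sum_(i < n) ln (phi (iter i sigma w)))%:E @[n --> \oo]
              --> lambda1 &
            (n%:R^-1%:E * lne `|cocycle sigma L n w|%:E)%E @[n --> \oo]
              --> lambda1],
      forall w, Omega' w ->
        (limn_esup (fun n : nat =>
           n%:R^-1%:E * lne (opnorm_on (ker_op (eta w)) (cocycle sigma L n w))%:E
           - (n%:R^-1 * \sum_(i < n) ln (phi (iter i sigma w)))%:E)
         <= (- (fine (mu GP) / kP%:R * ln (tanh (DP / 4))^-1))%:E)%E,
      - (fine (mu GP) / kP%:R * ln (tanh (DP / 4))^-1) < 0 &
      (-oo < lambda1)%E ->
        [/\ forall w, Omega' w ->
              (forall x, line (v w) x -> x != 0 ->
                 lyapunov sigma L w x = lambda1) /\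
              (forall x, ker_op (eta w) x ->
                 (lyapunov sigma L w x < lambda1)%E),
            lambda1 = (\int[mu]_(w in Omega') (ln (phi w))%:E)%E,
            tempered_on Omega' sigma sigmaV (fun w => `|proj w|) &
            tempered_on Omega' sigma sigmaV (fun w => `|coproj w|)]].
Proof.
move=> erg LL intL nC LC mG muG k0 DP0 diamG.
have [[sigmaK sigmaVK] _ _ _] := erg.
have GD w : GP w -> cone_bounded C (cocycle sigma L kP w) DP.
  move=> /diamG; apply: cone_diam_bounded => // x Cx; exact: cocycle_cone.
have p0 : 0 < fine (mu GP).
  by rewrite fine_gt0// muG (le_lt_trans (probability_le1 mu mG))// ltry.
have [D D1 normalD] := cone_normal nC.
have [K K0 nonflatK] := cone_nonflat nC.
have [x0 Cx0] : exists x0, C x0.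
  by have [_ _ _ _ [_ /(_ 0)[x0 [_ [Cx0 _ _]]] _]] := nC; exists x0.
have [Oa [mOa Oa1 mcoc]] := cocycle_norm_measurable erg x0 LL.
have [Oc iOc OcOa] := invariant_full_sub erg mOa Oa1.
have [Ob iOb Hb] := visits_average erg mG.
(* On [O1] the visits have the right frequency, so [v] and [eta] are defined, and [phi] will be
   measurable: the ergodic theorem for [ln phi] needs this before the set can be reduced again. *)
pose O1 := Oc `&` Ob; have iO1 : invariant_full mu sigma O1 by exact: invariant_full_setI.
have [mO1 _ sO1] := iO1.
have Hb1 w : O1 w -> n%:R^-1 * visits sigma GP n w @[n --> \oo] --> fine (mu GP) /\
    n%:R^-1 * birkhoff_sum sigmaV \1_GP n w @[n --> \oo] --> fine (mu GP).
  by move=> [_ /Hb].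
have vis1 := average_visited erg sO1 p0 Hb1.
have O1S w : O1 w -> O1 (sigma w) by rewrite -{1}sO1.
have O1V w : O1 w -> O1 (sigmaV w) by move=> Ow; rewrite -sO1 /= sigmaVK.
pose v := vlim sigma sigmaV L x0; pose phi w := `|L w (v w)|.
have v1' w : O1 w -> `|v w| = 1.
  exact: (dir_norm sigmaVK nC LC k0 DP0 GD D1 normalD Cx0 vis1).
have phi0' w : O1 w -> 0 < phi w.
  exact: (dir_phi_gt0 sigmaVK nC LC k0 DP0 GD D1 normalD Cx0 vis1).
have mphi : measurable_fun O1 phi.
  apply: (measurable_phi erg nC LC k0 DP0 GD D1 normalD Cx0 mO1 vis1 sO1 mOa) => //.
  by move=> w [/OcOa].
have [eta etaP'] := functional_exists sigmaVK nC LC k0 DP0 GD D1 normalD K0 nonflatK Cx0 vis1.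
pose g w := log_plus `|L w|.
have g0 w : 0 <= g w by rewrite /g /log_plus le_max lexx.
have gL w : ln `|L w| <= g w by rewrite /g /log_plus le_max lexx orbT.
have phig w : O1 w -> ln (phi w) <= g w.
  move=> Ow; apply: le_trans (gL w); have pw := phi0' w Ow.
  have pL : phi w <= `|L w| by apply: bop_opnorm_ball; rewrite v1'.
  by rewrite ler_ln ?posrE// (lt_le_trans pw).
(* The second reduction secures the averages of [ln phi] and, for finite [lambda1], those of
   [g - ln phi]; [v] and [eta] are simply restricted. *)
have [Om [l [iOm OmO1 lty lE [Hl Hh]]]] := growth_rate erg iO1 mphi intL g0 phig.
have [mOm Om1 sOm] := iOm.
have vis w : Om w -> visited sigma sigmaV GP (R:=R) w by move=> /OmO1; exact: vis1.
have OmS w : Om w -> Om (sigma w) by rewrite -{1}sOm.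
have OmV w : Om w -> Om (sigmaV w) by move=> Ow; rewrite -sOm /= sigmaVK.
have etaP w : Om w -> functional_spec sigma sigmaV L C D K x0 w (eta w).
  by move=> /OmO1; exact: etaP'.
have Cv w : Om w -> C (v w).
  exact: (dir_cone sigmaVK nC LC k0 DP0 GD D1 normalD Cx0 vis).
have v1 w : Om w -> `|v w| = 1 by move=> /OmO1; exact: v1'.
have phi0 w : Om w -> 0 < phi w by move=> /OmO1; exact: phi0'.
have Lv w : Om w -> L w (v w) = phi w *: v (sigma w).
  exact: (dir_equivariant sigmaK sigmaVK nC LC k0 DP0 GD D1 normalD Cx0 vis OmS).
have ev w : Om w -> eta w (v w) = 1 by move=> /etaP[].
have eL w x : Om w -> eta (sigma w) (L w x) = phi w * eta w x.
  exact: (functional_equivariant sigmaK sigmaVK nC LC k0 DP0 GD D1 normalD Cx0 vis OmS etaP).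
have Vp w : Om w -> n%:R^-1 * visits sigma GP n w @[n --> \oo] --> fine (mu GP).
  by move=> /OmO1/Hb1[].
exists Om; split=> //; exists v, phi, eta, l => proj coproj.
split; last split; last split; last split.
- split.
    split => //; last exact: (integrable_log_plus iO1 mphi intL g0 phig mOm OmO1).
    by split => //; exact: measurable_funS mphi.
  move=> v' phi' [C' n1' [phi'0 _] _ L'] w Ow.
  exact: (dir_unique sigmaVK nC LC k0 DP0 GD D1 normalD Cx0 vis OmS OmV C' n1' phi'0 L' Ow).
- split => //.
  + by move=> w /etaP[].
  + by move=> w Ow x; exact: eL.
  + split; first by move=> w Ow; exact: direct_sum_line_ker (ev w Ow).
    split=> w Ow _ [x xE <-].
      by move: xE => [a _ <-]; exists (a * phi w) => //; rewrite linearZ/= Lv// scalerA.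
    have e0 : eta w x = 0 by exact: xE.
    by have := eL w x Ow; rewrite e0 mulr0.
  + move=> w Ow; split.
    * apply/bopP => x; rewrite -[LHS]/(eta w (eta w x *: v w) *: v w).
      by rewrite (eta_scale (ev w Ow)).
    * apply/seteqP; split => [_ [x _ <-]|_ [a _ <-]]; first by exists (eta w x).
      exists (a *: v w) => //; rewrite -[LHS]/(eta w (a *: v w) *: v w).
      by rewrite (eta_scale (ev w Ow)).
    * apply/seteqP; split => x; rewrite /ker_op/=.
        move=> /(congr1 (eta w)); rewrite linear0 -[X in eta w X = _]/(eta w x *: v w).
        by rewrite (eta_scale (ev w Ow)).
      by move=> ex; rewrite -[LHS]/(eta w x *: v w) ex scale0r.
- move=> sL; split.
  + exact: (borel_measurable_dir erg nC LC k0 DP0 GD D1 normalD Cx0 mOm vis sL).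
  + exact: (strongly_measurable_functional erg nC LC k0 DP0 GD D1 normalD K0 Cx0 mOm vis etaP sL).
  + exact: (strongly_measurable_proj erg nC LC k0 DP0 GD D1 normalD K0 Cx0 mOm vis etaP sL).
  + exact: (strongly_measurable_coproj erg nC LC k0 DP0 GD D1 normalD K0 Cx0 mOm vis etaP sL).
  + exists (line_gr etaP); first by move=> w; exact: line_grE.
    exact: (borel_measurable_line erg nC LC k0 DP0 GD D1 normalD Cx0 mOm vis etaP sL).
- move=> cL; split.
  + exact: (mu_continuous_dir erg nC LC mG k0 DP0 GD D1 normalD K0 Cx0 mOm vis etaP Om1 cL).
  + exact: (mu_continuous_functional erg nC LC mG k0 DP0 GD D1 normalD K0 Cx0 mOm vis etaP Om1 cL).
  + split.
      exact: (mu_continuous_proj erg nC LC mG k0 DP0 GD D1 normalD K0 Cx0 mOm vis etaP Om1 cL).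
    exact: (mu_continuous_coproj erg nC LC mG k0 DP0 GD D1 normalD K0 Cx0 mOm vis etaP Om1 cL).
  + exists (line_gr etaP); first by move=> w; exact: line_grE.
    exact: (mu_continuous_line erg nC LC mG k0 DP0 GD D1 normalD K0 Cx0 mOm vis etaP Om1 cL).
  + exists (ker_gr etaP); first by move=> w; exact: ker_grE.
    exact: (mu_continuous_ker erg nC LC mG k0 DP0 GD D1 normalD K0 Cx0 mOm vis etaP Om1 cL).
- split => //.
  + move=> w Ow; split; last 2 first.
    * exact: Hl.
    * exact: (growth_norm sigmaK sigmaVK nC LC k0 DP0 GD D1 normalD K0 Cx0 vis OmS etaP
          Ow (Hl w Ow)).
    * exact: (growth_dir sigmaK sigmaVK nC LC k0 DP0 GD D1 normalD Cx0 vis OmS Ow (Hl w Ow)).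
  + move=> w Ow.
    exact: (limsup_cocycle_ker sigmaK sigmaVK nC LC k0 DP0 GD D1 normalD K0 Cx0 vis OmS etaP
      Ow (Vp w Ow)).
  + rewrite oppr_lt0 mulr_gt0//; first by rewrite divr_gt0// ltr0n.
    have /tanh_itv/andP[t0 t1] : 0 < DP / 4 by rewrite divr_gt0.
    by rewrite ln_gt0// invf_gt1.
  + move=> lNy; have lf : l = (fine l)%:E by rewrite fineK// fin_numE gt_eqF// lt_eqF.
    have [H HH] := Hh lNy.
    have fwd w : Om w -> n%:R^-1 * ln `|eta (iter n sigma w)| @[n --> \oo] --> (0 : R).
      move=> Ow; have [h1 _] := HH w Ow.
      exact: (functional_sublinear sigmaK sigmaVK nC LC k0 DP0 GD D1 normalD K0 Cx0 vis OmS
        etaP gL Ow p0 (Vp w Ow) h1).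
    have bwd w : Om w -> n%:R^-1 * ln `|eta (iter n sigmaV w)| @[n --> \oo] --> (0 : R).
      move=> Ow; have OVw := OmV w Ow; have [_ h2] := HH _ OVw.
      have [_ Vp2] := Hb1 _ (OmO1 _ OVw).
      exact: (functional_sublinearV sigmaK sigmaVK nC LC k0 DP0 GD D1 normalD K0 Cx0 vis OmS OmV
        etaP gL Ow p0 Vp2 h2).
    have it n w : Om w -> Om (iter n sigma w) /\ Om (iter n sigmaV w).
      exact: (invariant_full_iter erg).
    have projE w : Om w -> `|proj w| = `|eta w| by move=> /v1; exact: rank1_norm.
    split => //.
    * move=> w Ow; split => x; last first.
        rewrite lf; apply: (lyapunov_ker sigmaK sigmaVK nC LC k0 DP0 GD D1 normalD K0 Cx0
          vis OmS etaP Ow p0 (Vp w Ow)).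
        by rewrite -lf; exact: Hl.
      exact: (lyapunov_line sigmaK sigmaVK nC LC k0 DP0 GD D1 normalD Cx0 vis OmS Ow (Hl w Ow)).
    * move=> w Ow; split.
        rewrite (_ : (fun n => _) = (fun n : nat => n%:R^-1 * ln `|eta (iter n sigma w)|)).
          exact: fwd.
        by apply/funext => n; rewrite normr_id projE//; have [] := it n w Ow.
      rewrite (_ : (fun n => _) = (fun n : nat => n%:R^-1 * ln `|eta (iter n sigmaV w)|)).
        exact: bwd.
      by apply/funext => n; rewrite normr_id projE//; have [] := it n w Ow.
    (* The logarithm of the norm is squeezed between 0 and [ln 2 + ln |eta|], along either direction
       of the orbit. *)
    * have key (u : nat -> Omega) : (forall n, Om (u n)) ->
        n%:R^-1 * ln `|eta (u n)| @[n --> \oo] --> (0 : R) ->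
        n%:R^-1 * ln `|(`|coproj (u n)|)| @[n --> \oo] --> (0 : R).
        move=> Ou eu.
        have z : (fun n => n%:R^-1 * ln 2 + n%:R^-1 * ln `|eta (u n)| : R) @ \oo --> (0 : R).
          by rewrite -(addr0 (0 : R)); apply: cvgD => //; exact: cvg_average_cst.
        apply: (squeeze_cvgr (f := fun=> 0 : R) _ _ z); last exact: cvg_cst.
        apply: nearW => n; rewrite normr_id.
        have /andP[c1 c2] := ln_norm_coproj sigmaVK nC LC k0 DP0 GD D1 normalD Cx0 vis etaP (Ou n).
        by rewrite mulr_ge0 ?invr_ge0//= -mulrDr ler_wpM2l// invr_ge0.
      move=> w Ow; split; apply: key => //; last exact: bwd.
      - by move=> n; have [] := it n w Ow.
      - exact: fwd.
      - by move=> n; have [] := it n w Ow.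
Qed.
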